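(* Let $h>0$. (i) For all $F\in D_h(\mathbb{R}^{2n})$ and all $X\in\mathbb{R}^{2n}$, $$F(X)=(\pi h)^{-n}\int_{\mathbb{R}^{2n}}e^{-\frac1h|X-T|^2}H_hF(T)\,dT,$$ where $$H_hF(T)=(4\pi h)^{-n}\int_{\mathbb{R}^{2n}}F^{\rm ext}\Big(T+\frac Z2,T-\frac Z2\Big)e^{-\frac{1}{4h}|Z|^2}\,dZ,\qquad T\in\mathbb{R}^{2n}.$$ (ii) The operator $H_h$ maps $D_h(\mathbb{R}^{2n})$ into $L^\infty(\mathbb{R}^{2n})$, commutes with translations, and its symbol is $u\mapsto e^{h|u|^2/4}$. (iii) Let $F\in D_h(\mathbb{R}^{2n})$, with associated function $\psi_F$. There exists a function $\widetilde F$ on $\mathbb{C}^{2n}\simeq\mathbb{R}^{4n}$, whose variable is written $(x_1,x_2,x_3,x_4)$ with $x_k\in\mathbb{R}^n$ and corresponds to the complex point $(x_1+ix_2,\,x_3+ix_4)$, which is holomorphic in the sense that $$(\partial_1+i\partial_2)\widetilde F=0,\qquad(\partial_3+i\partial_4)\widetilde F=0$$ (componentwise, $\partial_k$ being the gradient in $x_k$), whose restriction to $\mathbb{R}^{2n}$ is $F$, i.e. $\widetilde F(x,0,\xi,0)=F(x,\xi)$, and such that $$|\widetilde F(X+iY)|\le(4\pi h)^{-n}\|\psi_F\|_{L^1(\mathbb{R}^{2n})}\,e^{\frac1h|Y|^2},\qquad X,Y\in\mathbb{R}^{2n},$$ that is, $|\widetilde F(x_1,x_2,x_3,x_4)|\le(4\pi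 h)^{-n}\|\psi_F\|_{L^1(\mathbb{R}^{2n})}e^{\frac1h(|x_2|^2+|x_4|^2)}$. (iv) For $F\in D_h(\mathbb{R}^{2n})$ and $X=(x,\xi)$, $Y=(y,\eta)$ in $\mathbb{R}^{2n}$, $$F^{\rm ext}(X,Y)=\widetilde F\Big(\frac{x+y}2,\frac{\xi-\eta}2,\frac{\xi+\eta}2,\frac{y-x}2\Big).$$ If $\widetilde F$ satisfies the Cauchy–Riemann equations of (iii), then the function $F^{\rm ext}$ given by this formula satisfies $(\partial_{x_j}+i\partial_{\xi_j})F^{\rm ext}=0$ and $(\partial_{y_j}-i\partial_{\eta_j})F^{\rm ext}=0$ for $1\le j\le n$. (v) If a function $F$ on $\mathbb{R}^{2n}$ has a holomorphic extension $\widetilde F$ to $\mathbb{C}^{2n}$ (in the sense of (iii)) satisfying $$|\widetilde F(X+iY)|\le|\psi(Y)|\,e^{\frac1h|Y|^2},\qquad X,Y\in\mathbb{R}^{2n},$$ for some $\psi\in L^1(\mathbb{R}^{2n})\cap L^\infty(\mathbb{R}^{2n})$, then $F\in D_h(\mathbb{R}^{2n})$. (vi) The convolution by a bounded measure on $\mathbb{R}^{2n}$ is an operator in $D_h(\mathbb{R}^{2n})$ having a norm smaller than or equal to $1$.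
   Context: Points of $\mathbb{R}^{2n}$ are written $X=(x,\xi)$ with $x,\xi\in\mathbb{R}^n$. For $h>0$, $D_h(\mathbb{R}^{2n})$ is the set of functions $F:\mathbb{R}^{2n}\to\mathbb{C}$ for which there is a real-analytic function $(X,Y)\mapsto F^{\rm ext}(X,Y)$ on $\mathbb{R}^{2n}\times\mathbb{R}^{2n}\simeq\mathbb{C}^{2n}$ (called the sesqui-holomorphic extension of $F$; it is unique) such that, with $X=(x,\xi)$, $Y=(y,\eta)$: 1. $(\partial_{x_j}+i\partial_{\xi_j})F^{\rm ext}(X,Y)=0$ and $(\partial_{y_j}-i\partial_{\eta_j})F^{\rm ext}(X,Y)=0$ for $1\le j\le n$; 2. $F^{\rm ext}(X,X)=F(X)$; 3. there is $\psi_F\in L^1(\mathbb{R}^{2n})\cap L^\infty(\mathbb{R}^{2n})$ with $|F^{\rm ext}(X,Y)|\le e^{\frac1{4h}|X-Y|^2}\psi_F(X-Y)$ for all $X,Y$. The norm is $\|F\|_{D_h(\mathbb{R}^{2n})}=\|\psi_F\|_{L^1}+\|\psi_F\|_{L^\infty}$, where $\psi_F$ is taken to be the least admissible function, $\psi_F(V)=\sup_{X-Y=V}|F^{\rm ext}(X,Y)|e^{-|V|^2/(4h)}$. A translation-commuting operator $T$ has symbol $\varphi$ if $T(e^{ia\cdot X})=\varphi(a)e^{ia\cdot X}$ for every $a\in\mathbb{R}^{2n}$. A bounded measure is a finite complex Borel measure; the convolution of $F$ by $\nu$ is $(F\star\nu)(X)=\int F(X-T)\,d\nu(T)$.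
   Formalization: In (vi), ''norm smaller than or equal to 1'' fails for a general bounded measure (twice the Dirac mass at 0 doubles F); what is proved is that convolution by ν has norm at most the total variation |ν|(R^{2n}), hence at most 1 when |ν|(R^{2n}) ≤ 1. *)

(* Defs.v *)
From HB Require Import structures.
From mathcomp Require Import all_boot all_order all_algebra complex.
From mathcomp Require Import all_classical all_reals all_analysis.

Set Implicit Arguments.
Unset Strict Implicit.
Unset Printing Implicit Defensive.

Import Order.TTheory GRing.Theory Num.Theory.
Import numFieldNormedType.Exports.

Local Open Scope classical_set_scope.
Local Open Scope complex_scope.
Local Open Scope ring_scope.

(* Matrices carry the sigma-algebra generated by the coordinates.  On 'rV[R]_m
   over a realType this is the Borel sigma-algebra of R^m. *)

Definition measure_matrix_display : measure_display -> measure_display.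
Proof. exact. Qed.

Section measurable_matrix.
Context {d} {T : measurableType d}.
Variables m n : nat.

Definition mx_cylinder : set (set 'M[T]_(m, n)) :=
  [set C | exists ij : 'I_m * 'I_n, exists2 A : set T,
     measurable A & C = [set M : 'M[T]_(m, n) | A (M ij.1 ij.2)]].

Let mx_set0 : <<s mx_cylinder >> set0.
Proof. exact: sigma_algebra0. Qed.

Let mx_setC A : <<s mx_cylinder >> A -> <<s mx_cylinder >> (~` A).
Proof. exact: sigma_algebraC. Qed.

Let mx_bigcup (F : (set 'M[T]_(m, n))^nat) :
  (forall i, <<s mx_cylinder >> (F i)) -> <<s mx_cylinder >> (\bigcup_i F i).
Proof. exact: sigma_algebra_bigcup. Qed.

HB.instance Definition _ := @isMeasurable.Build (measure_matrix_display d)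
  'M[T]_(m, n) <<s mx_cylinder >> mx_set0 mx_setC mx_bigcup.

End measurable_matrix.

Section lebesgue.
Context {R : realType}.

Definition rV_rcons m (p : 'rV[R]_m * measurableTypeR R) : 'rV[R]_m.+1 :=
  \row_(i < m.+1) if unlift ord_max i is Some j then p.1 0 j else p.2.

Lemma measurable_rV_rcons m : measurable_fun [set: 'rV[R]_m * R] (@rV_rcons m).
Proof.
have mE : @measurable _ 'rV[R]_m.+1 = <<s @mx_cylinder _ R 1 m.+1 >> by [].
apply: (measurability _ mE).
move=> _ [_ [[i j] [A mA ->]] <-].
rewrite setTI /= /rV_rcons.
case E : (unlift ord_max j) => [k|].
  rewrite (_ : _ @^-1` _ = fst @^-1` [set M : 'rV[R]_m | A (M 0 k)]); last first.
    by apply/seteqP; split => x /=; rewrite mxE E.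
  rewrite -[_ @^-1` _]setTI; apply: measurable_fst => //.
  by apply: sub_sigma_algebra; exists (0, k), A.
rewrite (_ : _ @^-1` _ = snd @^-1` A); last first.
  by apply/seteqP; split => x /=; rewrite mxE E.
by rewrite -[_ @^-1` _]setTI; apply: measurable_snd.
Qed.

Definition lebesgue_rV_succ m (mu : {measure set 'rV[R]_m -> \bar R}) :=
  pushforward (mu \x @lebesgue_measure R)%E (@rV_rcons m).

HB.instance Definition _ m (mu : {measure set 'rV[R]_m -> \bar R}) :=
  Measure.copy (lebesgue_rV_succ mu)
    (measure_function_pushforward__canonical__measure_function_Measure
      (mu \x @lebesgue_measure R)%E (@measurable_rV_rcons m)).

Fixpoint lebesgue_rV m : {measure set 'rV[R]_m -> \bar R} :=
  match m with
  | 0 => dirac (0 : 'rV[R]_0)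
  | m'.+1 => lebesgue_rV_succ (lebesgue_rV m')
  end.

End lebesgue.

Section complex_valued.
Context {R : realType}.

(* R[i] has no topology here: limits, derivatives, integrals and L^p membership
   of complex-valued functions are taken on real and imaginary parts. *)

Definition cexpi (t : R) : R[i] := cos t +i* sin t.

Section integration.
Context {d} {T : measurableType d}.
Variable mu : {measure set T -> \bar R}.

Definition cintegrable (f : T -> R[i]) : Prop :=
  mu.-integrable setT (EFin \o (@complex.Re R \o f)) /\
  mu.-integrable setT (EFin \o (@complex.Im R \o f)).

Definition cintegral (f : T -> R[i]) : R[i] :=
  (\int[mu]_x complex.Re (f x)) +i* (\int[mu]_x complex.Im (f x)).

Definition cLfun (p : \bar R) (f : T -> R[i]) : Prop :=
  (@complex.Re R \o f) \in Lfun mu p /\ (@complex.Im R \o f) \in Lfun mu p.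

End integration.

Section differentiation.
Context {V : normedModType R}.

Definition cderive (f : V -> R[i]) (v x : V) : R[i] :=
  'D_v (@complex.Re R \o f) x +i* 'D_v (@complex.Im R \o f) x.

(* Meant for V of finite dimension. *)
Definition is_C1 (f : V -> R) : Prop :=
  (forall x, differentiable f x) /\ (forall v, continuous ('D_v f)).

Definition is_cC1 (f : V -> R[i]) : Prop :=
  is_C1 (@complex.Re R \o f) /\ is_C1 (@complex.Im R \o f).

End differentiation.

(* Around each point, f is the sum of a power series that converges absolutely
   on a polydisc; the order of summation is then irrelevant, and the sum is
   taken as the limit of the partial sums over the cubes {0, .., N-1}^m of
   multi-indices. *)
Definition real_analytic m (f : 'rV[R]_m -> R) : Prop :=
  forall p, exists (c : {ffun 'I_m -> nat} -> R) (r : R),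
    [/\ 0 < r,
        (\esum_(a in [set: {ffun 'I_m -> nat}])
           (`|c a| * \prod_i r ^+ a i)%:E < +oo)%E &
        forall v : 'rV[R]_m, (forall i, `|v 0 i| < r) ->
          \sum_(a : {ffun 'I_m -> 'I_N})
             c [ffun i => val (a i)] * \prod_i v 0 i ^+ a i
            @[N --> \oo] --> f (p + v)].

Definition real_canalytic m (f : 'rV[R]_m -> R[i]) : Prop :=
  real_analytic (@complex.Re R \o f) /\ real_analytic (@complex.Im R \o f).

End complex_valued.

Section complex_measure.
Context {d} {T : measurableType d} {R : realType}.

Definition charge_integrable (nu : {charge set T -> \bar R}) (f : T -> R) :=
  forall P N (nuPN : hahn_decomposition nu P N),
    (jordan_pos nuPN).-integrable setT (EFin \o f) /\
    (jordan_neg nuPN).-integrable setT (EFin \o f).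

(* The Jordan decomposition does not depend on the chosen Hahn decomposition. *)
Definition charge_integral (nu : {charge set T -> \bar R}) (f : T -> R) : R :=
  let: exist P exN := cid (Hahn_decomposition nu) in
  let: exist N nuPN := cid exN in
  (\int[jordan_pos nuPN]_x f x) - (\int[jordan_neg nuPN]_x f x).

(* A finite complex measure is given by its real and imaginary parts, which are
   finite signed measures. *)
Record complex_measure := ComplexMeasure {
  cm_re : {charge set T -> \bar R};
  cm_im : {charge set T -> \bar R} }.

Definition cm_val (nu : complex_measure) (A : set T) : R[i] :=
  fine (cm_re nu A) +i* fine (cm_im nu A).

(* The mass |nu|(T), i.e. the supremum of sum_k |nu(E_k)| over countable
   measurable partitions of T. *)
Definition cm_variation (nu : complex_measure) : \bar R :=
  ereal_sup [set (\sum_(k <oo) (Normc.normc (cm_val nu (E k)))%:E)%E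
    | E in [set E : (set T)^nat | [/\ forall k, measurable (E k),
        trivIset setT E & \bigcup_k E k = setT]]].

Definition cm_integrable (nu : complex_measure) (f : T -> R[i]) : Prop :=
  [/\ charge_integrable (cm_re nu) (@complex.Re R \o f),
      charge_integrable (cm_re nu) (@complex.Im R \o f),
      charge_integrable (cm_im nu) (@complex.Re R \o f) &
      charge_integrable (cm_im nu) (@complex.Im R \o f)].

Definition cm_integral (nu : complex_measure) (f : T -> R[i]) : R[i] :=
  (charge_integral (cm_re nu) (@complex.Re R \o f)
     - charge_integral (cm_im nu) (@complex.Im R \o f)) +i*
  (charge_integral (cm_re nu) (@complex.Im R \o f)
     + charge_integral (cm_im nu) (@complex.Re R \o f)).

End complex_measure.
Arguments complex_measure {d} T R.

(* A point X = (x, xi) of R^{2n} is row_mx x xi : 'rV[R]_(n + n). *)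

Section Dh.
Context {R : realType} {n : nat}.
Local Notation phase := 'rV[R]_(n + n).
Local Notation leb := (lebesgue_rV (R := R) (n + n)).
Implicit Types (F : phase -> R[i]) (G : phase -> phase -> R[i]).

Definition dotv m (u v : 'rV[R]_m) : R := \sum_i u 0 i * v 0 i.

(* The squared Euclidean norm; `|v| on 'rV[R]_m is the sup norm. *)
Definition sqn m (v : 'rV[R]_m) : R := dotv v v.

Definition cpartial m (f : 'rV[R]_m -> R[i]) (i : 'I_m) : 'rV[R]_m -> R[i] :=
  cderive f (delta_mx 0 i).

Definition joint G (W : 'rV[R]_((n + n) + (n + n))) : R[i] :=
  G (lsubmx W) (rsubmx W).

Definition sesqui_CR G : Prop :=
  forall (X Y : phase) (j : 'I_n),
    cpartial (fun X' => G X' Y) (lshift n j) X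
      + 'i%C * cpartial (fun X' => G X' Y) (rshift n j) X = 0 /\
    cpartial (fun Y' => G X Y') (lshift n j) Y
      - 'i%C * cpartial (fun Y' => G X Y') (rshift n j) Y = 0.

Definition sesqui_extension F G : Prop :=
  [/\ real_canalytic (joint G), sesqui_CR G & forall X, G X X = F X].

(* The sesqui-holomorphic extension of F, unique if it exists. *)
Definition Fext F : phase -> phase -> R[i] :=
  xget (fun _ _ => 0) [set G | sesqui_extension F G].

Definition Dh (h : R) F : Prop :=
  exists2 G, sesqui_extension F G &
  exists psi : phase -> R,
    [/\ psi \in Lfun leb 1, psi \in Lfun leb +oo &
        forall X Y, Normc.normc (G X Y)
          <= expR (1 / (4 * h) * sqn (X - Y)) * psi (X - Y)].

(* The least function psi satisfying the bound in Dh. *)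
Definition psi_of (h : R) F (V : phase) : \bar R :=
  ereal_sup [set (Normc.normc (Fext F XY.1 XY.2)
                    * expR (- (sqn V / (4 * h))))%:E
            | XY in [set XY : phase * phase | XY.1 - XY.2 = V]].

Definition Dh_norm (h : R) F : \bar R :=
  ('N[leb]_1[psi_of h F] + 'N[leb]_+oo[psi_of h F])%E.

Definition Hh_integrand (h : R) F (T Z : phase) : R[i] :=
  Fext F (T + 2^-1 *: Z) (T - 2^-1 *: Z)
    * (expR (- (1 / (4 * h) * sqn Z)))%:C.

Definition Hh (h : R) F (T : phase) : R[i] :=
  ((4 * pi * h) ^- n)%:C * cintegral leb (Hh_integrand h F T).

Definition heat_integrand (h : R) F (X T : phase) : R[i] :=
  (expR (- (1 / h * sqn (X - T))))%:C * Hh h F T.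

Definition translate (V : phase) F : phase -> R[i] := fun X => F (X - V).

Definition plane_wave (a : phase) : phase -> R[i] := fun X => cexpi (dotv a X).

Definition linear_on (D : (phase -> R[i]) -> Prop)
    (A : (phase -> R[i]) -> phase -> R[i]) : Prop :=
  forall (c : R[i]) F1 F2, D F1 -> D F2 ->
    D (fun X => c * F1 X + F2 X) /\
    A (fun X => c * F1 X + F2 X) = (fun X => c * A F1 X + A F2 X).

Definition commutes_with_translations (D : (phase -> R[i]) -> Prop)
    (A : (phase -> R[i]) -> phase -> R[i]) : Prop :=
  forall (V : phase) F, D F ->
    D (translate V F) /\ A (translate V F) = translate V (A F).

Definition has_symbol (D : (phase -> R[i]) -> Prop)
    (A : (phase -> R[i]) -> phase -> R[i]) (phi : phase -> R[i]) : Prop :=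
  forall a : phase,
    D (plane_wave a) /\ A (plane_wave a) = (fun X => phi a * plane_wave a X).

Definition measure_convolution (nu : complex_measure phase R) F : phase -> R[i] :=
  fun X => cm_integral nu (fun T => F (X - T)).

(* Functions on C^{2n} = R^{4n}: Ft x1 x2 x3 x4 is the value of Ft at the point
   (x1 + i x2, x3 + i x4). *)
Implicit Types Ft : 'rV[R]_n -> 'rV[R]_n -> 'rV[R]_n -> 'rV[R]_n -> R[i].

Definition joint4 Ft (x : 'rV[R]_n * 'rV[R]_n * 'rV[R]_n * 'rV[R]_n) : R[i] :=
  Ft x.1.1.1 x.1.1.2 x.1.2 x.2.

(* Holomorphic in the sense of Cauchy-Riemann, for C^1 functions. *)
Definition holomorphic Ft : Prop :=
  is_cC1 (joint4 Ft) /\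
  forall (x1 x2 x3 x4 : 'rV[R]_n) (j : 'I_n),
    cpartial (fun y => Ft y x2 x3 x4) j x1
      + 'i%C * cpartial (fun y => Ft x1 y x3 x4) j x2 = 0 /\
    cpartial (fun y => Ft x1 x2 y x4) j x3
      + 'i%C * cpartial (fun y => Ft x1 x2 x3 y) j x4 = 0.

Definition holomorphic_extension F Ft : Prop :=
  holomorphic Ft /\ forall x xi, Ft x 0 xi 0 = F (row_mx x xi).

Definition sesqui_of Ft (X Y : phase) : R[i] :=
  let x := lsubmx X in let xi := rsubmx X in
  let y := lsubmx Y in let eta := rsubmx Y in
  Ft (2^-1 *: (x + y)) (2^-1 *: (xi - eta))
     (2^-1 *: (xi + eta)) (2^-1 *: (y - x)).

End Dh.

(* Main.v *)
Require Import Defs.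
From HB Require Import structures.
From mathcomp Require Import all_boot all_order all_algebra complex.
From mathcomp Require Import all_classical all_reals all_analysis.
From mathcomp Require Import measurable_realfun.
From mathcomp Require Import ring lra.

(** A point of the doubled phase space is written (X, Y), or (T, Z) with
    T = (X + Y) / 2 and Z = X - Y. Sesqui-holomorphy is holomorphy for a constant
    complex structure J on this real vector space, for which the diagonal Z = 0
    is a real form. With a linear change of variables the same structure is the
    usual one of C^2n. So the extension of F to the doubled space and the
    entire extension of F are one function in two coordinate systems, and
    everything rests on the theory of C^1 functions that satisfy the
    Cauchy-Riemann equations for J ([jholo]).

    The engine is a Gaussian mean value property. The weight
    exp(- c (|T|^2 + |Z|^2 / 4)) is invariant under the rotations cos t + sin t J.
    Averaging over t and using the mean value property on circles, one finds that
    the weighted integral of f is f at the centre times the mass of the weight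
    ([gaussian_mean], [gaussian_mean_re]). Four consequences give the theorem.

    With c = 1 / h and the centre at a point of the diagonal, the integral over Z
    is the inverse heat operator and the integral over T is the heat flow: this
    is the inversion formula ([heat_part], [Hh_heat]). The symbol is computed on
    the explicit extension of a plane wave ([Hh_symbol]).

    With c = 2 / h and the centre anywhere, an L^1 profile yields a pointwise
    bound by exp(|Z|^2 / 2h) ([subcritical_bound]). A function with this growth
    is, again by the mean value property, a Gaussian transform, hence
    real-analytic ([sesquiholo_analytic]): the power series of the Gaussian
    kernel is integrated term by term ([kernel_transform_series]). Conversely a
    real-analytic function is C^1 ([real_analytic_C1]). So membership in Dh may be
    checked on C^1 functions ([Dh_intro], [Dh_elim]), and this covers linear
    combinations, translates, plane waves and functions given on a tube.

    With c = 1 / h, the centre at (T, Z) and f multiplied by an extended plane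
    wave that cancels the mixed term of the exponent, the mean value property
    bounds f by the integral of the least profile, with the sharp constant
    ([sharp_bound], [entire_extension]).

    Uniqueness of extensions reduces to one variable ([sesquiholo_unique],
    [jholo_real_subspace_zero]): a holomorphic function that vanishes on a line
    can be glued to 0 along it, and the mean value property shows that the glued
    function is 0 ([jholo_real_line_zero]).

    For convolution, the extension of the convolution of F is the integral of
    the translates of the extension of F along the diagonal. It is
    sesqui-holomorphic because Gaussian transforms can be averaged over a finite
    measure ([sesquiholo_average]), and its profile is at most the variation of
    the measure times the profile of F, because an integral is bounded by the
    supremum of the integrand times the variation ([cm_integral_le]). *)

Set Implicit Arguments.
Unset Strict Implicit.
Unset Printing Implicit Defensive.

Import Order.TTheory GRing.Theory Num.Theory.
Import numFieldNormedType.Exports.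

Local Open Scope classical_set_scope.
Local Open Scope complex_scope.
Local Open Scope ring_scope.

(** * Lebesgue measure and Gaussian integrals on row vectors *)

Section affine_line.
Context {R : realType}.

Lemma lebesgue_measure_affine (s t : R) (A : set R) : s != 0 ->
  measurable A ->
  (lebesgue_measure ((fun x => s * x + t)%R @^-1` A)
    = (`|s|^-1)%:E * lebesgue_measure A)%E.
Proof.
move=> s0 mA.
pose f : measurableTypeR R -> measurableTypeR R := fun x => s * x + t.
have mf : measurable_fun setT f.
  by apply: measurable_funD => //; apply: measurable_funM.
pose r : {nonneg R} := NngNum (normr_ge0 s).
pose mu : {measure set (measurableTypeR R) -> \bar R} := mscale r
  (measure_function_pushforward__canonical__measure_function_Measure
    lebesgue_measure mf).
have : forall X, ocitv X -> lebesgue_measure X = mu X.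
  move=> X [[a b]] /= ab <-; rewrite /mu.
  rewrite /mscale /= /pushforward.
  have [sp|sn] := ltrP 0 s.
    rewrite (_ : f @^-1` _ = [set` `](a - t) / s, (b - t) / s]]); last first.
      apply/seteqP; split => x /=; rewrite !in_itv /= /f => /andP[h1 h2].
        by rewrite ltr_pdivrMr// ler_pdivlMr// ltrBlDr lerBrDr mulrC h1 h2.
      by move: h1 h2; rewrite ltr_pdivrMr// ler_pdivlMr// ltrBlDr lerBrDr (mulrC x) => -> ->.
    rewrite !lebesgue_measure_itv /= !lte_fin.
    rewrite ltr_pM2r ?invr_gt0// ltrD2r.
    case: ifP => _; last by rewrite mule0.
    rewrite -!EFinB -EFinM gtr0_norm//; congr EFin; field.
    exact: s0.
  have {}sn : s < 0 by rewrite lt_neqAle s0.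
  rewrite (_ : f @^-1` _ = [set` `[(b - t) / s, (a - t) / s[]); last first.
    apply/seteqP; split => x /=; rewrite !in_itv /= /f => /andP[h1 h2].
      by rewrite ltr_ndivlMr// ler_ndivrMr// ltrBlDr lerBrDr (mulrC x) h1 h2.
    by move: h1 h2; rewrite ltr_ndivlMr// ler_ndivrMr// ltrBlDr lerBrDr (mulrC x) => -> ->.
  rewrite !lebesgue_measure_itv /= !lte_fin.
  rewrite ltr_nM2r ?invr_lt0// ltrD2r.
  case: ifP => _; last by rewrite mule0.
  rewrite -!EFinB -EFinM ltr0_norm//; congr EFin; field.
  exact: s0.
move=> /lebesgue_measure_unique /(_ A mA) ->.
rewrite /mscale /= /pushforward muleA -EFinM mulVf ?mul1e//.
by rewrite normr_eq0.
Qed.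

End affine_line.

Section boxes.
Context {R : realType}.
Local Open Scope ereal_scope.

Definition box m (A : 'I_m -> set R) : set 'rV[R]_m :=
  [set v | forall i, A i (v ord0 i)].

Lemma measurable_coord m (i : 'I_m) :
  measurable_fun setT (fun v : 'rV[R]_m => v ord0 i).
Proof.
move=> _ A mA; rewrite setTI; apply: sub_sigma_algebra.
by exists (ord0, i), A.
Qed.

Lemma measurable_box m (A : 'I_m -> set R) :
  (forall i, measurable (A i)) -> measurable (box A).
Proof.
move=> mA; rewrite (_ : box A =
  \bigcap_(i in [set: 'I_m]) ((fun v : 'rV[R]_m => v ord0 i) @^-1` A i)).
  apply: fin_bigcap_measurable => // i _; rewrite -[X in measurable X]setTI.
  exact: measurable_coord.
by apply/seteqP; split=> v /=; [move=> h i _; exact: h | move=> h i; exact: h].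
Qed.

Lemma lebesgue_rV_box m (A : 'I_m -> set R) :
  (forall i, measurable (A i)) ->
  lebesgue_rV m (box A) = \prod_(i < m) lebesgue_measure (A i).
Proof.
elim: m A => [|m IH] A mA.
  by rewrite big_ord0 /= diracE mem_set// => -[].
rewrite big_ord_recr /= /lebesgue_rV_succ /= /pushforward.
rewrite (_ : _ @^-1` _ = box (fun i => A (widen_ord (leqnSn m) i)) `*` A ord_max).
  rewrite product_measure1E//; first by rewrite IH.
    exact: measurable_box.
  exact: mA.
have wE (i : 'I_m) : lift ord_max i = widen_ord (leqnSn m) i.
  by apply/val_inj => /=; rewrite /bump leqNgt ltn_ord.
apply/seteqP; split=> -[p t]; rewrite /box /=.
  move=> h; split=> [i|].
    by have := h (lift ord_max i); rewrite mxE liftK wE.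
  by have := h ord_max; rewrite mxE unlift_none.
move=> [h1 h2] i; rewrite mxE; case: unliftP => [j ->|->] //.
by rewrite wE; exact: h1.
Qed.

Lemma measurable_rV_boxes m : @measurable _ 'rV[R]_m =
  <<s [set B | exists2 A : 'I_m -> set R, (forall i, measurable (A i)) & B = box A] >>.
Proof.
apply/seteqP; split.
  apply: smallest_sub; first exact: smallest_sigma_algebra.
  move=> _ [[z i]] [A mA ->]; apply: sub_sigma_algebra => /=.
  exists (fun k => if k == i then A else setT).
    by move=> k; case: ifP.
  apply/seteqP; split=> v /=; rewrite /box /= (ord1 z).
    by move=> h k; case: eqP => // ->.
  by move=> /(_ i); rewrite eqxx.
apply: smallest_sub; first exact: sigma_algebra_measurable.
by move=> _ [A mA ->]; exact: measurable_box.
Qed.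

Definition cube m (k : nat) : set 'rV[R]_m :=
  box (fun=> `[(- k%:R)%R, k%:R%R]%classic).

Arguments cube m k : clear implicits.

Lemma lebesgue_rV_cube m k : lebesgue_rV m (cube m k) < +oo.
Proof.
rewrite lebesgue_rV_box//.
set X := \prod_(i < m) _; suff /andP[] : (0 <= X) && (X < +oo) by [].
rewrite {}/X.
elim/big_ind: _ => //.
- by rewrite lee01 ltry.
- move=> x y /andP[x0 xy] /andP[y0 yy]; rewrite mule_ge0//= lte_mul_pinfty//.
  by rewrite ge0_fin_numE.
move=> i _; rewrite measure_ge0 /= lebesgue_measure_itv /=; case: ifP => // _.
by rewrite -EFinB ltry.
Qed.

Lemma bigcup_cube m : \bigcup_k cube m k = [set: 'rV[R]_m].
Proof.
apply/seteqP; split=> // v _.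
exists (Num.truncn (\sum_i `|v ord0 i|)%R).+1 => // i /=.
rewrite in_itv /= -ler_norml.
apply: le_trans (ltW (truncnS_gt _)).
by rewrite (bigD1 i) //= lerDl sumr_ge0.
Qed.

(** Boxes are stable under intersection and generate the sigma-algebra, and the
    cubes exhaust the space with finite measure. *)
Lemma lebesgue_rV_unique m (mu : {measure set 'rV[R]_m -> \bar R}) :
  (forall A : 'I_m -> set R, (forall i, measurable (A i)) ->
     mu (box A) = \prod_(i < m) lebesgue_measure (A i)) ->
  forall B, measurable B -> mu B = lebesgue_rV m B.
Proof.
move=> muE B mB.
apply: (@measure_unique _ _ _ _ (cube m) (measurable_rV_boxes m)) => //.
- move=> _ _ [A1 m1 ->] [A2 m2 ->].
  exists (fun i => A1 i `&` A2 i); first by move=> i; exact: measurableI.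
  apply/seteqP; split=> v; rewrite /box /= => h; first by case: h => h1 h2 i.
  by split=> i; case: (h i).
- by move=> k; exists (fun=> `[(- k%:R)%R, k%:R%R]%classic).
- exact: bigcup_cube.
- by move=> _ [A mA ->]; rewrite muE// lebesgue_rV_box.
- by move=> k; rewrite muE// -lebesgue_rV_box// lebesgue_rV_cube.
Qed.

End boxes.

Section lebesgue_rV_sigma_finite.
Context {R : realType} (m : nat).

(** A name for [lebesgue_rV m] that carries its sigma-finiteness, on which
    Fubini's theorem depends. *)
Definition leb : set 'rV[R]_m -> \bar R := lebesgue_rV m.

HB.instance Definition _ := Measure.copy leb (lebesgue_rV m).

Lemma sigma_finite_leb : sigma_finite setT leb.
Proof.
exists (@cube R m); first by rewrite bigcup_cube.
move=> k; split; last exact: lebesgue_rV_cube.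
exact: measurable_box.
Qed.

HB.instance Definition _ := Measure_isSigmaFinite.Build _ _ _ leb sigma_finite_leb.

End lebesgue_rV_sigma_finite.
Arguments leb {R} m.

Section measurable_rV.
Context {R : realType}.

Lemma measurable_fun_rVP d (T : measurableType d) m (f : T -> 'rV[R]_m) :
  (forall i, measurable_fun setT (fun t => f t ord0 i)) -> measurable_fun setT f.
Proof.
move=> mf; have mE : @measurable _ 'rV[R]_m = <<s @mx_cylinder _ R 1 m >> by [].
apply: (measurability _ mE) => _ [_ [[z i] [A mA ->]] <-].
by rewrite (ord1 z); exact: mf.
Qed.

Lemma open_measurable_rV m (O : set 'rV[R]_m) : open O -> measurable O.
Proof.
move=> oO.
pose B (q : {ffun 'I_m -> rat} * nat) : set 'rV[R]_m :=
  box (fun i => ball (ratr (q.1 i) : R) (q.2.+1%:R^-1)).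
rewrite (_ : O = \bigcup_(q in [set q | B q `<=` O]) B q); last first.
  apply/seteqP; split; last by move=> v [q /= h] /h.
  move=> v Ov; have : nbhs v O by exact: open_nbhs_nbhs.
  move=> /nbhs_ballP[e /= e0 vO].
  have [k ke] : exists k : nat, k.+1%:R^-1 < e / 2.
    exists (Num.truncn (e / 2)^-1); rewrite invf_plt ?posrE ?divr_gt0//.
    exact: truncnS_gt.
  have hq i : exists q : rat, ball (v ord0 i) (k.+1%:R^-1) (ratr q : R).
    have /rat_in_itvoo[q] : v ord0 i < v ord0 i + k.+1%:R^-1 :> R.
      by rewrite ltrDl invr_gt0.
    rewrite in_itv /= => /andP[q1 q2]; exists q; rewrite /ball /= distrC.
    by rewrite gtr0_norm ?subr_gt0// ltrBlDl.
  have {hq}[q qP] := choice hq.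
  exists ([ffun i => q i], k) => /=; last first.
    by move=> i /=; rewrite ffunE; exact: ball_sym.
  move=> w; rewrite /B /box /= => qw; apply: vO; split=> // z i.
  rewrite (ord1 z); have := qw i; rewrite ffunE => qwi.
  apply: (@le_ball _ _ _ (k.+1%:R^-1 + k.+1%:R^-1)).
    by rewrite [leRHS]splitr lerD// ltW.
  by apply: ball_triangle qwi; exact: qP.
rewrite bigcup_mkcond; apply: countable_bigcupT_measurable.
  exact: countableP.
move=> q; case: ifP => // _; apply: measurable_box => i.
by apply: open_measurable; exact: ball_open.
Qed.

Lemma continuous_measurable_rV m (f : 'rV[R]_m -> R) :
  continuous f -> measurable_fun setT f.
Proof.
move=> /continuousP cf.
apply: (measurability _ (RGenOpens.measurableE R)).
move=> _ [_ [a [b ->] <-]]; rewrite setTI; apply: open_measurable_rV.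
exact/cf/interval_open.
Qed.

End measurable_rV.

Section affine_rV.
Context {R : realType} (m : nat).
Variables (sigma tau : 'I_m -> 'I_m) (s t : 'I_m -> R).
Hypotheses (sigmaK : cancel sigma tau) (tauK : cancel tau sigma).
Hypothesis s0 : forall i, s i != 0.

(** Permuting, scaling and translating the coordinates covers both the
    translations and the rotation by a right angle that relates the imaginary
    part of a point of C^2n to the difference X - Y. *)
Definition coord_affine (v : 'rV[R]_m) : 'rV[R]_m :=
  \row_i (s i * v ord0 (sigma i) + t i).

Lemma measurable_coord_affine : measurable_fun setT coord_affine.
Proof.
apply: measurable_fun_rVP => i.
under eq_fun do rewrite mxE.
apply: measurable_funD => //.
by apply: measurable_funM => //; exact: measurable_coord.
Qed.

Let c := \prod_i `|s i|.

Let c0 : 0 < c.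
Proof. by apply: prodr_gt0 => i _; rewrite normr_gt0. Qed.

Local Open Scope ereal_scope.

Lemma leb_coord_affine (A : set 'rV[R]_m) : measurable A ->
  leb m (coord_affine @^-1` A) = c^-1%:E * leb m A.
Proof.
move=> mA.
pose mu : {measure set 'rV[R]_m -> \bar R} := mscale (NngNum (ltW c0))
  (measure_function_pushforward__canonical__measure_function_Measure
    (leb m) measurable_coord_affine).
have -> : leb m A = mu A.
  apply/esym/lebesgue_rV_unique => // B mB.
  rewrite [LHS](_ : _ = c%:E * leb m (coord_affine @^-1` box B))//.
  rewrite (_ : _ @^-1` _ = box (fun j =>
      (fun x => s (tau j) * x + t (tau j))%R @^-1` B (tau j))).
    rewrite /leb lebesgue_rV_box.
      rewrite (reindex_inj (can_inj sigmaK)) /=.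
      under eq_bigr => i _ do rewrite sigmaK lebesgue_measure_affine ?s0//.
      rewrite big_split /= muleA prodEFin -EFinM.
      suff -> : (c * \prod_i `|s i|^-1 = 1)%R by rewrite mul1e.
      by rewrite prodfV mulfV// gt_eqF.
    move=> j; rewrite -[X in measurable X]setTI.
    by apply: measurable_funD => //; apply: measurable_funM.
  apply/seteqP; split => v; rewrite /box /= => h i.
    by have := h (tau i); rewrite mxE tauK.
  by have := h (sigma i); rewrite mxE sigmaK.
rewrite [X in _ * X](_ : _ = c%:E * leb m (coord_affine @^-1` A))//.
rewrite muleA -EFinM mulVf ?mul1e//.
by rewrite gt_eqF.
Qed.

Lemma ge0_integral_coord_affine (f : 'rV[R]_m -> \bar R) :
  measurable_fun setT f -> (forall v, 0 <= f v) ->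
  \int[leb m]_v f (coord_affine v) = c^-1%:E * \int[leb m]_v f v.
Proof.
move=> mf f0.
have ci : (0 <= c^-1)%R by rewrite invr_ge0 ltW.
rewrite -(@ge0_integral_mscale _ _ _ _ _ measurableT (NngNum ci))//.
rewrite -(@ge0_integral_pushforward _ _ _ _ _ _ measurable_coord_affine _ setT f)//.
apply: eq_measure_integral; first exact: measurable_coord_affine.
by move=> mphi A mA _; exact: leb_coord_affine.
Qed.

End affine_rV.

Section translation.
Context {R : realType} (m : nat).
Local Open Scope ereal_scope.

Lemma measurable_rV_add d (T : measurableType d) (f g : T -> 'rV[R]_m) :
  measurable_fun setT f -> measurable_fun setT g ->
  measurable_fun setT (fun x => f x + g x)%R.
Proof.
move=> mf mg; apply: measurable_fun_rVP => i; under eq_fun do rewrite mxE.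
by apply: measurable_funD; apply: measurableT_comp (measurable_coord i) _.
Qed.

Lemma measurable_rV_scale d (T : measurableType d) (a : T -> R) (f : T -> 'rV[R]_m) :
  measurable_fun setT a -> measurable_fun setT f ->
  measurable_fun setT (fun x => a x *: f x)%R.
Proof.
move=> ma mf; apply: measurable_fun_rVP => i; under eq_fun do rewrite mxE.
by apply: measurable_funM => //; apply: measurableT_comp (measurable_coord i) _.
Qed.

Lemma ge0_integral_translate (w : 'rV[R]_m) (f : 'rV[R]_m -> \bar R) :
  measurable_fun setT f -> (forall v, 0 <= f v) ->
  \int[leb m]_v f (v + w)%R = \int[leb m]_v f v.
Proof.
move=> mf f0.
have := @ge0_integral_coord_affine R m id id (fun=> 1%R) (fun i => w ord0 i)
  (fun=> erefl) (fun=> erefl) (fun=> oner_neq0 _) f mf f0.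
rewrite big1 ?invr1 ?mul1e; last by move=> i _; rewrite normr1.
move=> <-; apply: eq_integral => v _; congr f.
by apply/rowP => i; rewrite !mxE mul1r.
Qed.

End translation.

Section gaussian.
Context {R : realType}.
Local Open Scope ereal_scope.

Lemma ge0_integral_scale_line (s : R) (f : R -> \bar R) : s != 0%R ->
  measurable_fun setT f -> (forall v, 0 <= f v) ->
  \int[lebesgue_measure]_x f (s * x)%R =
  (`|s|^-1)%:E * \int[lebesgue_measure]_x f x.
Proof.
move=> s0 mf f0.
have ci : (0 <= `|s|^-1)%R by rewrite invr_ge0.
pose phi : measurableTypeR R -> measurableTypeR R := fun x => (s * x + 0)%R.
have mphi : measurable_fun setT phi.
  by apply: measurable_funD => //; apply: measurable_funM.
rewrite -(@ge0_integral_mscale _ _ _ _ _ measurableT (NngNum ci))//.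
transitivity (\int[pushforward lebesgue_measure phi]_y f y).
  rewrite (@ge0_integral_pushforward _ _ _ _ _ _ mphi _ setT f)//.
  by apply: eq_integral => x _; rewrite /phi /= addr0.
apply: eq_measure_integral.
by move=> A mA _; exact: lebesgue_measure_affine.
Qed.

Lemma integral_gauss_line (c : R) : (0 < c)%R ->
  \int[lebesgue_measure]_x (expR (- (c * x ^+ 2)))%:E = (Num.sqrt (pi / c))%:E.
Proof.
move=> c0; have sc0 : (Num.sqrt c != 0)%R by rewrite gt_eqF// sqrtr_gt0.
have := @ge0_integral_scale_line (Num.sqrt c) (EFin \o gauss_fun) sc0 _ _.
rewrite integralT_gauss -EFinM => h.
rewrite (_ : Num.sqrt _ = `|Num.sqrt c|^-1 * Num.sqrt pi)%R; last first.
  by rewrite sqrtrM ?pi_ge0// sqrtrV ?ltW// mulrC ger0_norm.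
rewrite -h.
- apply: eq_integral => x _; rewrite /gauss_fun /= exprMn sqr_sqrtr//.
  exact: ltW.
- by apply/measurable_EFinP; exact: measurable_gauss_fun.
- by move=> v; rewrite lee_fin gauss_fun_ge0.
Qed.

Lemma ge0_integral_leb_succ m (f : 'rV[R]_m.+1 -> \bar R) :
  measurable_fun setT f -> (forall v, 0 <= f v) ->
  \int[leb m.+1]_v f v =
  \int[leb m]_p \int[lebesgue_measure]_t f (rV_rcons (p, t)).
Proof.
move=> mf f0.
transitivity (\int[leb m \x @lebesgue_measure R]_x f (rV_rcons x)).
  have mr : measurable_fun [set: ('rV[R]_m * measurableTypeR R)%type]
    (@rV_rcons R m) by exact: measurable_rV_rcons.
  have h := @ge0_integral_pushforward _ _ _ _ R _ mr
    (leb m \x @lebesgue_measure R) setT f measurableT mf.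
  by apply: h => v _; exact: f0.
rewrite fubini_tonelli1//=.
by apply: measurableT_comp => //; exact: measurable_rV_rcons.
Qed.

Lemma integral_rV_prod m (g : R -> R) (I : R) :
  measurable_fun setT g -> (forall x, 0 <= g x)%R ->
  \int[lebesgue_measure]_x (g x)%:E = I%:E ->
  \int[leb m]_v (\prod_i g (v ord0 i))%:E = (I ^+ m)%:E.
Proof.
move=> mg g0 gI.
have mprod k : measurable_fun setT (fun v : 'rV[R]_k => (\prod_i g (v ord0 i))%:E).
  apply/measurable_EFinP; apply: measurable_prod => i _.
  by apply: measurableT_comp => //; exact: measurable_coord.
have prod0 k (v : 'rV[R]_k) : (0 <= \prod_i g (v ord0 i))%R by exact: prodr_ge0.
elim: m => [|m IH].
  rewrite (_ : leb 0 = dirac (0%R : 'rV[R]_0))// integral_dirac//; last exact: mprod.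
  by rewrite diracT mul1e big_ord0.
rewrite ge0_integral_leb_succ//; last by move=> v; rewrite lee_fin.
have prodS (p : 'rV[R]_m) t :
    (\prod_i g (rV_rcons (p, t) ord0 i) = (\prod_i g (p ord0 i)) * g t)%R.
  rewrite big_ord_recr /= mxE unlift_none /=; congr (_ * _)%R.
  apply: eq_bigr => i _; rewrite mxE.
  rewrite (_ : widen_ord _ i = lift ord_max i) ?liftK//.
  by apply/val_inj => /=; rewrite /bump leqNgt ltn_ord.
transitivity (\int[leb m]_p (I%:E * (\prod_i g (p ord0 i))%:E)).
  apply: eq_integral => p _.
  under eq_integral => t _ do rewrite prodS EFinM.
  rewrite ge0_integralZl_EFin//; first by rewrite gI muleC.
    by move=> t _; rewrite lee_fin.
  exact/measurable_EFinP.
have I0 : (0 <= I)%R by rewrite -lee_fin -gI integral_ge0// => x _; rewrite lee_fin.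
rewrite ge0_integralZl_EFin//; first by rewrite IH -EFinM exprS.
  by move=> v _; rewrite lee_fin.
exact: mprod.
Qed.

Lemma sqnE m (v : 'rV[R]_m) : (sqn v = \sum_i v ord0 i ^+ 2)%R.
Proof. by rewrite /sqn /dotv; apply: eq_bigr => i _; rewrite expr2. Qed.

Lemma measurable_sqn m : measurable_fun setT (@sqn R m).
Proof.
rewrite (_ : @sqn R m = fun v => \sum_i v ord0 i ^+ 2)%R; last first.
  by apply/funext => v; rewrite sqnE.
apply: measurable_sum => i; apply: measurable_funX.
exact: measurable_coord.
Qed.

Lemma integral_gauss_rV m (c : R) : (0 < c)%R ->
  \int[leb m]_v (expR (- (c * sqn v)))%:E = (Num.sqrt (pi / c) ^+ m)%:E.
Proof.
move=> c0; rewrite -(integral_rV_prod m _ _ (integral_gauss_line c0)).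
- apply: eq_integral => v _; rewrite sqnE mulr_sumr -sumrN.
  by rewrite -expR_sum.
- apply: measurableT_comp => //; apply: measurableT_comp => //.
  apply: measurable_funM => //; exact: measurable_funX.
- by move=> x; rewrite expR_ge0.
Qed.

End gaussian.

(** * Holomorphic functions for a constant complex structure *)

Section circle_mean_real.
Context {R : realType}.
Variables (A B D : R -> R -> R) (a b : R).
Hypothesis ab : a < b.
Hypothesis A_D : forall r t, is_derive r (1:R) (A ^~ t) (D r t).
Hypothesis B_D : forall r t, is_derive t (1:R) (B r) (r * D r t).
Hypothesis cD : continuous (fun z : R * R => D z.1 z.2).
Hypothesis Bab : forall r, B r a = B r b.

Let mu := @lebesgue_measure R.
Let I := `[a, b]%classic : set R.

Let mI : measurable I. Proof. exact: measurable_itv. Qed.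

Let cDt r : continuous (D r).
Proof.
move=> t; apply: (@continuous_comp _ _ _ (fun t => (r, t)) (fun z => D z.1 z.2)).
  by apply: (cvg_pair (cvg_cst r) cvg_id).
exact: cD.
Qed.

Let integral_D0 r : r != 0 -> (\int[mu]_(t in I) (D r t)%:E = 0)%E.
Proof.
move=> r0.
have : (\int[mu]_(t in I) (r * D r t)%:E = 0)%E.
  rewrite (@continuous_FTC2 _ _ (B r))//.
  - by rewrite Bab subee.
  - apply: continuous_subspaceT => t; apply: cvgM; first exact: cvg_cst.
    exact: cDt.
  - have cB : continuous (B r).
      move=> t; apply: differentiable_continuous; apply/derivable1_diffP.
      exact: (@ex_derive _ _ _ _ _ _ _ (B_D r t)).
    split.
    + by move=> t _; exact: (@ex_derive _ _ _ _ _ _ _ (B_D r t)).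
    + by apply: cvg_at_right_filter; exact: cB.
    + by apply: cvg_at_left_filter; exact: cB.
  - move=> t _; rewrite derive1E; exact: (@derive_val _ _ _ _ _ _ _ (B_D r t)).
under eq_integral do rewrite EFinM.
rewrite integralZl//; last first.
  apply: continuous_compact_integrable; first exact: segment_compact.
  by apply: continuous_subspaceT; exact: cDt.
by move=> /eqP; rewrite mule_eq0 eqe (negbTE r0) /= => /eqP.
Qed.

Let locally_bounded_D r : exists2 M, 0 <= M & forall x t, r - 1 < x < r + 1 -> I t -> `|D x t| <= M.
Proof.
have : compact ((fun z : R * R => D z.1 z.2) @` (`[r - 1, r + 1] `*` I)).
  apply: continuous_compact; first by apply: continuous_subspaceT => z; exact: cD.
  by apply: compact_setX; exact: segment_compact.
move=> /compact_bounded[M [_ HM]].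
exists (`|M| + 1); first by rewrite addr_ge0.
move=> x t /andP[x1 x2] It; apply: HM.
  by rewrite (le_lt_trans (ler_norm _))// ltrDl.
by exists (x, t) => //; split => //=; rewrite in_itv /= !ltW.
Qed.

Hypothesis cA : forall r, continuous (A r).

(** [r * D r t] is the angular derivative of the periodic function [B r], so its
    integral over a period vanishes; hence so does the derivative in [r] of the
    integral of [A r]. *)
Lemma circle_integral_constant r : 0 <= r ->
  \int[mu]_(t in I) A r t = \int[mu]_(t in I) A 0 t.
Proof.
rewrite le_eqVlt => /predU1P[<-//|r0].
pose F x := \int[mu]_(t in I) A x t.
have dF x : derivable F x 1 /\ F^`()%classic x = \int[mu]_(t in I) D x t.
  have [M M0 HM] := locally_bounded_D x.
  have Ix : `]x - 1, x + 1[%classic x by rewrite /= in_itv /= ltrBlDr ltrDl ltr01.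
  have iA y : mu.-integrable I (EFin \o A y).
    apply: continuous_compact_integrable; first exact: segment_compact.
    by apply: continuous_subspaceT; exact: cA.
  have dA y t : derivable (A ^~ t) y 1.
    exact: (@ex_derive _ _ _ _ _ _ _ (A_D y t)).
  have dAE y t : partial1of2 A y t = D y t.
    by rewrite partial1of2E; exact: (@derive_val _ _ _ _ _ _ _ (A_D y t)).
  have iM : mu.-integrable I (EFin \o cst M).
    apply: continuous_compact_integrable; first exact: segment_compact.
    by apply: continuous_subspaceT => ?; exact: cvg_cst.
  have bM y t : `]x - 1, x + 1[%classic y -> I t -> `|partial1of2 A y t| <= cst M t.
    by rewrite /= in_itv /= dAE; exact: HM.
  have M0' t : 0 <= cst M t :> R by [].
  split.
    exact: (@derivable_under_integral R _ _ mu A I mI x _ _ Ix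
      (fun y _ => iA y) (fun y t _ _ => dA y t) (cst M)).
  rewrite (@differentiation_under_integral R _ _ mu A I mI x _ _ Ix
      (fun y _ => iA y) (fun y t _ _ => dA y t) (cst M))//.
  by apply: eq_Rintegral => t _; exact: dAE.
have [||c] := @MVT _ F (fun=> 0) 0 r r0.
- move=> x; rewrite in_itv /= => /andP[x0 _]; apply: DeriveDef.
    exact: (dF x).1.
  by rewrite -derive1E (dF x).2 /Rintegral integral_D0 ?gt_eqF.
- apply: continuous_subspaceT => x; apply: differentiable_continuous.
  by apply/derivable1_diffP; exact: (dF x).1.
by move=> _ /eqP; rewrite mul0r subr_eq0 => /eqP.
Qed.

End circle_mean_real.

Section C1.
Context {R : realType}.
Implicit Types V W : normedModType R.

Lemma is_C1_derivable V (f : V -> R) p v : is_C1 f -> derivable f p v.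
Proof. by move=> [df _]; exact: diff_derivable. Qed.

Lemma is_C1_continuous V (f : V -> R) : is_C1 f -> continuous f.
Proof. by move=> [df _] p; exact: differentiable_continuous. Qed.

Lemma deriveDl V (f : V -> R) p (v w : V) : differentiable f p ->
  'D_(v + w) f p = 'D_v f p + 'D_w f p.
Proof. by move=> df; rewrite !deriveE// linearD. Qed.

Lemma deriveZl V (f : V -> R) p (a : R) (v : V) : differentiable f p ->
  'D_(a *: v) f p = a * 'D_v f p.
Proof. by move=> df; rewrite !deriveE// linearZ. Qed.

Lemma deriveNl V (f : V -> R) p (v : V) : differentiable f p ->
  'D_(- v) f p = - 'D_v f p.
Proof. by move=> df; rewrite !deriveE// linearN. Qed.

Lemma is_C1_cst V (c : R) : is_C1 (fun _ : V => c).
Proof.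
split=> [x|v]; first exact: differentiable_cst.
rewrite (_ : 'D_v _ = fun=> 0); last by apply/funext => x; rewrite derive_cst.
by move=> x; exact: cvg_cst.
Qed.

Lemma is_C1D V (f g : V -> R) : is_C1 f -> is_C1 g -> is_C1 (fun x => f x + g x).
Proof.
move=> fC gC; split=> [x|v].
  by apply: differentiableD; [exact: fC.1|exact: gC.1].
rewrite (_ : 'D_v _ = fun x => 'D_v f x + 'D_v g x); last first.
  by apply/funext => x; rewrite deriveD//; exact: is_C1_derivable.
by move=> x; apply: cvgD; [exact: fC.2|exact: gC.2].
Qed.

Lemma is_C1N V (f : V -> R) : is_C1 f -> is_C1 (fun x => - f x).
Proof.
move=> fC; split=> [x|v]; first by apply: differentiableN; exact: fC.1.
rewrite (_ : 'D_v _ = fun x => - 'D_v f x); last first.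
  by apply/funext => x; rewrite deriveN//; exact: is_C1_derivable.
by move=> x; apply: cvgN; exact: fC.2.
Qed.

Lemma is_C1M V (f g : V -> R) : is_C1 f -> is_C1 g -> is_C1 (fun x => f x * g x).
Proof.
move=> fC gC; split=> [x|v].
  by apply: differentiableM; [exact: fC.1|exact: gC.1].
rewrite (_ : 'D_v _ = fun x => f x * 'D_v g x + g x * 'D_v f x); last first.
  by apply/funext => x; rewrite deriveM//; exact: is_C1_derivable.
move=> x; apply: cvgD; apply: cvgM.
- exact: is_C1_continuous fC x.
- exact: gC.2.
- exact: is_C1_continuous gC x.
- exact: fC.2.
Qed.

(** Affine maps, described through their differential [L] so that chain rules
    need no matrix of coefficients. *)
Definition has_constant_diff V W (g : W -> V) (L : W -> V) :=
  forall x, differentiable g x /\ forall v, 'D_v g x = L v.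

Lemma derive_chain V W (f : V -> R) (g : W -> V) p v :
  differentiable g p -> differentiable f (g p) ->
  'D_v (f \o g) p = 'D_('D_v g p) f (g p).
Proof.
move=> dg df; rewrite deriveE; last exact: differentiable_comp.
by rewrite diff_comp//= !deriveE.
Qed.

Lemma derive_comp_affine V W (f : V -> R) (g L : W -> V) p v :
  has_constant_diff g L -> differentiable f (g p) ->
  'D_v (f \o g) p = 'D_(L v) f (g p).
Proof.
by move=> gL df; have [dg gE] := gL p; rewrite derive_chain// gE.
Qed.

Lemma is_C1_comp V W (f : V -> R) (g L : W -> V) :
  has_constant_diff g L -> is_C1 f -> is_C1 (f \o g).
Proof.
move=> gL fC; split=> [x|v].
  by apply: differentiable_comp; [exact: (gL x).1|exact: fC.1].
rewrite (_ : 'D_v _ = 'D_(L v) f \o g); last first.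
  by apply/funext => x; rewrite (derive_comp_affine _ gL)//; exact: fC.1.
move=> x; apply: continuous_comp; last exact: fC.2.
by apply: differentiable_continuous; exact: (gL x).1.
Qed.

End C1.

Section holomorphy.
Context {R : realType}.
Implicit Types V W : normedModType R.
Local Notation re := (@complex.Re R).
Local Notation im := (@complex.Im R).

(** Complex differentiability when multiplication by i is the linear map [J].
    Testing every direction instead of a basis makes the notion stable under
    all affine maps that intertwine two structures ([jholo_comp]). *)
Definition jholo V (J : V -> V) (f : V -> R[i]) : Prop :=
  is_cC1 f /\ forall p v,
    'D_(J v) (re \o f) p = - 'D_v (im \o f) p /\
    'D_(J v) (im \o f) p = 'D_v (re \o f) p.

Lemma jholo_comp V W (J : V -> V) (J' : W -> W) (f : V -> R[i]) (g L : W -> V) :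
  has_constant_diff g L -> (forall v, L (J' v) = J (L v)) ->
  jholo J f -> jholo J' (f \o g).
Proof.
move=> gL LJ [[f1 f2] CR]; split.
  by split; [exact: (is_C1_comp gL f1)|exact: (is_C1_comp gL f2)].
move=> p v.
have d1 w := derive_comp_affine w gL (f1.1 (g p)).
have d2 w := derive_comp_affine w gL (f2.1 (g p)).
by have := CR (g p) (L v); rewrite -LJ -!d1 -!d2.
Qed.

Lemma jholoM V (J : V -> V) (f g : V -> R[i]) :
  jholo J f -> jholo J g -> jholo J (fun x => f x * g x).
Proof.
move=> [[f1 f2] fCR] [[g1 g2] gCR].
have reM : re \o (fun x => f x * g x) =
    fun x => (re \o f) x * (re \o g) x + - ((im \o f) x * (im \o g) x).
  by apply/funext => x /=; case: (f x) => a b; case: (g x).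
have imM : im \o (fun x => f x * g x) =
    fun x => (re \o f) x * (im \o g) x + (im \o f) x * (re \o g) x.
  by apply/funext => x /=; case: (f x) => a b; case: (g x).
split; first split.
- by rewrite reM; apply: is_C1D; [|apply: is_C1N]; exact: is_C1M.
- by rewrite imM; apply: is_C1D; exact: is_C1M.
move=> p v; rewrite reM imM.
have dM (a b : V -> R) w : is_C1 a -> is_C1 b ->
  'D_w (fun x => a x * b x) p = a p * 'D_w b p + b p * 'D_w a p.
  by move=> aC bC; rewrite deriveM//; exact: is_C1_derivable.
have drM (a b : V -> R) w : is_C1 a -> is_C1 b -> derivable (fun x => a x * b x) p w.
  by move=> aC bC; apply: derivableM; exact: is_C1_derivable.
have dD (a b c d : V -> R) w : is_C1 a -> is_C1 b -> is_C1 c -> is_C1 d ->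
    'D_w (fun x => a x * b x + c x * d x) p =
    a p * 'D_w b p + b p * 'D_w a p + (c p * 'D_w d p + d p * 'D_w c p).
  move=> aC bC cC dC.
  by rewrite (@deriveD _ _ _ _ _ _ _ (drM a b w aC bC) (drM c d w cC dC)) !dM.
have dB (a b c d : V -> R) w : is_C1 a -> is_C1 b -> is_C1 c -> is_C1 d ->
    'D_w (fun x => a x * b x + - (c x * d x)) p =
    a p * 'D_w b p + b p * 'D_w a p - (c p * 'D_w d p + d p * 'D_w c p).
  move=> aC bC cC dC.
  by rewrite (@deriveB _ _ _ _ _ _ _ (drM a b w aC bC) (drM c d w cC dC)) !dM.
rewrite !dD// !dB//.
have [-> ->] := fCR p v; have [-> ->] := gCR p v.
by split; ring.
Qed.

End holomorphy.

Section constant_differential.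
Context {R : realType}.
Implicit Types U V W : normedModType R.

Lemma constant_diff_linear V W (L : W -> V) :
  linear L -> continuous L -> has_constant_diff L L.
Proof.
move=> lL cL x; pose LM := GRing.isLinear.Build _ _ _ _ _ lL.
pose LL : {linear W -> V} := HB.pack L LM.
have dL : differentiable LL x by exact: linear_differentiable.
by split => // v; rewrite (deriveE _ dL) (diff_lin (f := LL)).
Qed.

Lemma constant_diff_cst V W (c : V) : has_constant_diff (fun _ : W => c) (fun=> 0).
Proof. by move=> x; split; [exact: differentiable_cst|move=> v; rewrite derive_cst]. Qed.

Lemma constant_diff_id V : has_constant_diff (@id V) id.
Proof. by apply: constant_diff_linear => [a u v|x] //; exact: cvg_id. Qed.

Lemma constant_diffD V W (f g F G : W -> V) :
  has_constant_diff f F -> has_constant_diff g G ->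
  has_constant_diff (fun x => f x + g x) (fun v => F v + G v).
Proof.
move=> fF gG x; have [df fE] := fF x; have [dg gE] := gG x.
split; first exact: differentiableD.
by move=> v; rewrite deriveD ?fE ?gE//; exact: diff_derivable.
Qed.

Lemma constant_diffZ V W (a : R) (f F : W -> V) :
  has_constant_diff f F -> has_constant_diff (fun x => a *: f x) (fun v => a *: F v).
Proof.
move=> fF x; have [df fE] := fF x; split; first exact: differentiableZ.
by move=> v; rewrite deriveZ ?fE//; exact: diff_derivable.
Qed.

Lemma constant_diffN V W (f F : W -> V) :
  has_constant_diff f F -> has_constant_diff (fun x => - f x) (fun v => - F v).
Proof.
move=> fF x; have [df fE] := fF x; split; first exact: differentiableN.
by move=> v; rewrite deriveN ?fE//; exact: diff_derivable.
Qed.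

Lemma constant_diffB V W (f g F G : W -> V) :
  has_constant_diff f F -> has_constant_diff g G ->
  has_constant_diff (fun x => f x - g x) (fun v => F v - G v).
Proof. by move=> fF gG; apply: constant_diffD => //; exact: constant_diffN. Qed.

Lemma constant_diffZl V W (a A : W -> R) (u : V) :
  has_constant_diff a A -> has_constant_diff (fun x => a x *: u) (fun v => A v *: u).
Proof.
move=> aA x; have [da aE] := aA x; split; first exact: differentiableZl.
by move=> v; rewrite deriveE ?diffZl//=; [rewrite -deriveE// aE|exact: differentiableZl].
Qed.

Lemma constant_diff_pair U V W (f F : W -> V) (g G : W -> U) :
  has_constant_diff f F -> has_constant_diff g G ->
  has_constant_diff (fun x => (f x, g x)) (fun v => (F v, G v)).
Proof.
move=> fF gG x; have [df fE] := fF x; have [dg gE] := gG x.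
split; first exact: differentiable_pair.
move=> v; rewrite deriveE; last exact: differentiable_pair.
by rewrite diff_pair//= -!deriveE// fE gE.
Qed.

Lemma constant_diff_fst U V : has_constant_diff (@fst V U) fst.
Proof. by apply: constant_diff_linear => [a u v|x] //; exact: cvg_fst. Qed.

Lemma constant_diff_snd U V : has_constant_diff (@snd V U) snd.
Proof. by apply: constant_diff_linear => [a u v|x] //; exact: cvg_snd. Qed.

Lemma constant_diff_comp U V W (f F : V -> U) (g G : W -> V) :
  has_constant_diff f F -> has_constant_diff g G ->
  has_constant_diff (f \o g) (F \o G).
Proof.
move=> fF gG x; have [dg gE] := gG x; have [df fE] := fF (g x).
split; first exact: differentiable_comp.
move=> v; rewrite deriveE; last exact: differentiable_comp.
by rewrite diff_comp//= -!deriveE// gE fE.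
Qed.

Lemma constant_diff_sum V W I (r : seq I) (f F : I -> W -> V) :
  (forall i, has_constant_diff (f i) (F i)) ->
  has_constant_diff (fun x => \sum_(i <- r) f i x) (fun v => \sum_(i <- r) F i v).
Proof.
move=> fF; elim: r => [|i r IH].
  have E (h : I -> W -> V) : (fun x => \sum_(i <- [::]) h i x) = fun=> 0.
    by apply/funext => x; rewrite big_nil.
  by rewrite !E; exact: constant_diff_cst.
have E (h : I -> W -> V) :
    (fun x => \sum_(j <- i :: r) h j x) = fun x => h i x + \sum_(j <- r) h j x.
  by apply/funext => x; rewrite big_cons.
by rewrite !E; exact: constant_diffD.
Qed.

Lemma constant_diff_coord m (i : 'I_m) :
  has_constant_diff (fun v : 'rV[R]_m => v 0 i) (fun v : 'rV[R]_m => v 0 i).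
Proof.
apply: constant_diff_linear; first by move=> a u v; rewrite !mxE.
exact: coord_continuous.
Qed.

Lemma constant_diff_row W m (a A : 'I_m -> W -> R) :
  (forall i, has_constant_diff (a i) (A i)) ->
  has_constant_diff (fun x => \row_i a i x) (fun v => \row_i A i v).
Proof.
move=> aA.
have rowE (b : 'I_m -> W -> R) :
    (fun x => \row_i b i x) = fun x => \sum_i b i x *: delta_mx 0 i.
  by apply/funext => x; rewrite [LHS]row_sum_delta; apply: eq_bigr => i _; rewrite mxE.
by rewrite !rowE; apply: constant_diff_sum => i; exact: constant_diffZl.
Qed.

Lemma constant_diff_rowP W m (f F : W -> 'rV[R]_m) :
  (forall i, has_constant_diff (fun x => f x 0 i) (fun v => F v 0 i)) ->
  has_constant_diff f F.
Proof.
move=> /constant_diff_row.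
have rowE (b : W -> 'rV[R]_m) : (fun x => \row_i b x 0 i) = b.
  by apply/funext => x; apply/rowP => i; rewrite mxE.
by rewrite !rowE.
Qed.

Lemma constant_diff_lsubmx m k :
  has_constant_diff (@lsubmx R 1 m k) (@lsubmx R 1 m k).
Proof.
apply: constant_diff_rowP => i.
rewrite (_ : (fun x => _) = fun v : 'rV[R]_(m + k) => v 0 (lshift k i)).
  exact: constant_diff_coord.
by apply/funext => v; rewrite mxE.
Qed.

Lemma constant_diff_rsubmx m k :
  has_constant_diff (@rsubmx R 1 m k) (@rsubmx R 1 m k).
Proof.
apply: constant_diff_rowP => i.
rewrite (_ : (fun x => _) = fun v : 'rV[R]_(m + k) => v 0 (rshift m i)).
  exact: constant_diff_coord.
by apply/funext => v; rewrite mxE.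
Qed.

Lemma constant_diff_row_mx W m k (f F : W -> 'rV[R]_m) (g G : W -> 'rV[R]_k) :
  has_constant_diff f F -> has_constant_diff g G ->
  has_constant_diff (fun x => row_mx (f x) (g x)) (fun v => row_mx (F v) (G v)).
Proof.
move=> fF gG; apply: constant_diff_rowP => i.
have E (a : W -> 'rV[R]_m) (b : W -> 'rV[R]_k) : (fun x => row_mx (a x) (b x) 0 i) =
    fun x => match fintype.split i with inl j => a x 0 j | inr j => b x 0 j end.
  by apply/funext => x; rewrite mxE.
rewrite !E; case: fintype.split => j.
  exact: (constant_diff_comp (@constant_diff_coord _ j) fF).
exact: (constant_diff_comp (@constant_diff_coord _ j) gG).
Qed.

End constant_differential.

Section circle_mean.
Context {R : realType}.
Local Notation re := (@complex.Re R).
Local Notation im := (@complex.Im R).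

Definition rot2 (z : R * R) : R * R := (- z.2, z.1).

Definition polar (r t : R) : R * R := (r * cos t, r * sin t).

Lemma derive_pair_map (V : normedModType R) (a b : V -> R) (p v : V) :
  differentiable a p -> differentiable b p ->
  'D_v (fun x => (a x, b x)) p = ('D_v a p, 'D_v b p).
Proof.
move=> da db; rewrite deriveE; last exact: differentiable_pair.
by rewrite diff_pair//= !deriveE.
Qed.

Lemma differentiable_sin (t : R) : differentiable (@sin R) t.
Proof. by apply/derivable1_diffP; exact: derivable_sin. Qed.

Lemma differentiable_cos (t : R) : differentiable (@cos R) t.
Proof. by apply/derivable1_diffP; exact: derivable_cos. Qed.

Section conjugate_pair.
Variables (a b : R * R -> R).
Hypotheses (aC : is_C1 a) (bC : is_C1 b).
Hypothesis CR : forall p v, 'D_(rot2 v) b p = 'D_v a p.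

Let D r t := 'D_(cos t, sin t) a (polar r t).

Let DE r t : D r t = cos t * 'D_(1, 0) a (polar r t) + sin t * 'D_(0, 1) a (polar r t).
Proof.
rewrite /D -!deriveZl; try exact: aC.1.
rewrite -deriveDl; last exact: aC.1.
congr ('D_ _ a _).
by congr pair; rewrite /= /GRing.scale /=; ring.
Qed.

Let dpolar_r r t : differentiable (polar^~ t) r /\ 'D_1 (polar^~ t) r = (cos t, sin t).
Proof.
have d (c : R) : differentiable (fun r : R => r * c) r.
  by apply: differentiableM; [by apply/derivable1_diffP; exact: derivable_id|exact: differentiable_cst].
split; first by apply: differentiable_pair; exact: d.
rewrite derive_pair_map//.
have dE (c : R) : 'D_1 (fun r : R => r * c) r = c.
  by rewrite -derive1E derive1Mr ?derive1_id ?mul1r//; exact: derivable_id.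
by rewrite !dE.
Qed.

Let dpolar_t r t : differentiable (polar r) t /\
  'D_1 (polar r) t = r *: rot2 (cos t, sin t).
Proof.
have ds : differentiable (fun t : R => r * sin t) t.
  by apply: differentiableM; [exact: differentiable_cst|exact: differentiable_sin].
have dc : differentiable (fun t : R => r * cos t) t.
  by apply: differentiableM; [exact: differentiable_cst|exact: differentiable_cos].
split; first exact: differentiable_pair.
rewrite derive_pair_map//; congr pair; rewrite -derive1E derive1Ml ?derive1E.
- by rewrite (@derive_val _ _ _ _ _ _ _ (is_derive_cos t)).
- by apply/derivable1_diffP; exact: differentiable_cos.
- by rewrite (@derive_val _ _ _ _ _ _ _ (is_derive_sin t)).
- by apply/derivable1_diffP; exact: differentiable_sin.
Qed.

Let continuous_polar : continuous (fun z : R * R => polar z.1 z.2).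
Proof.
have cc : continuous (fun z : R * R => z.1 * cos z.2).
  move=> z; apply: cvgM; first exact: cvg_fst.
  by apply: continuous_comp; [exact: cvg_snd|exact: continuous_cos].
have cs : continuous (fun z : R * R => z.1 * sin z.2).
  move=> z; apply: cvgM; first exact: cvg_fst.
  by apply: continuous_comp; [exact: cvg_snd|exact: continuous_sin].
by move=> z; exact: (cvg_pair (cc z) (cs z)).
Qed.

(** A harmonic function [a] with conjugate [b]: the polar form of the
    Cauchy-Riemann equations is the hypothesis of [circle_integral_constant]. *)
Lemma circle_mean_pair r : 0 <= r ->
  \int[@lebesgue_measure R]_(t in `[- pi, pi]) a (polar r t) = 2 * pi * a (0, 0).
Proof.
move=> r0.
have hA s t : is_derive s (1:R) (fun s => a (polar s t)) (D s t).
  have [dp dpE] := dpolar_r s t; apply: DeriveDef.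
    by apply/derivable1_diffP; apply: differentiable_comp => //; exact: aC.1.
  by rewrite derive_chain ?dpE//; exact: aC.1.
have hB s t : is_derive t (1:R) (fun t => b (polar s t)) (s * D s t).
  have [dp dpE] := dpolar_t s t; apply: DeriveDef.
    by apply/derivable1_diffP; apply: differentiable_comp => //; exact: bC.1.
  by rewrite derive_chain ?dpE ?deriveZl ?CR//; exact: bC.1.
have cD : continuous (fun z : R * R => D z.1 z.2).
  rewrite (_ : (fun z => _) = fun z : R * R => cos z.2 * 'D_(1, 0) a (polar z.1 z.2)
      + sin z.2 * 'D_(0, 1) a (polar z.1 z.2)); last by apply/funext => z; rewrite DE.
  have cpD v : continuous (fun z : R * R => 'D_v a (polar z.1 z.2)).
    by move=> z; exact: (@continuous_comp _ _ _ (fun z : R * R => polar z.1 z.2) ('D_v a) z (@continuous_polar z) (aC.2 v (polar z.1 z.2))).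
  move=> z; apply: cvgD; apply: cvgM; try exact: cpD.
    by apply: continuous_comp; [exact: cvg_snd|exact: continuous_cos].
  by apply: continuous_comp; [exact: cvg_snd|exact: continuous_sin].
have per s : b (polar s (- pi)) = b (polar s pi).
  by rewrite /polar cosN sinN cospi sinpi oppr0.
have cA s : continuous (fun t => a (polar s t)).
  move=> t; apply: continuous_comp.
    by apply: differentiable_continuous; exact: (dpolar_t s t).1.
  by apply: differentiable_continuous; exact: aC.1.
have pipi : - pi < pi :> R by rewrite gtrN ?pi_gt0.
rewrite (@circle_integral_constant _ _ _ _ _ _ pipi hA hB cD per cA r r0).
under eq_Rintegral => t _ do rewrite /polar !mul0r.
rewrite Rintegral_cst//= lebesgue_measure_itv/= lte_fin pipi /=.
ring.
Qed.

End conjugate_pair.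

Lemma circle_mean (f : R * R -> R[i]) r : jholo rot2 f -> 0 <= r ->
  \int[@lebesgue_measure R]_(t in `[- pi, pi]) re (f (polar r t)) = 2 * pi * re (f (0, 0)) /\
  \int[@lebesgue_measure R]_(t in `[- pi, pi]) im (f (polar r t)) = 2 * pi * im (f (0, 0)).
Proof.
move=> [[f1 f2] CR] r0; split.
  by apply: (circle_mean_pair f1 f2) => // p v; exact: (CR p v).2.
apply: (circle_mean_pair f2 (is_C1N f1)) => // p v.
rewrite deriveN; last exact: is_C1_derivable.
by rewrite (CR p v).1 opprK.
Qed.

End circle_mean.

Section differentiability_criterion.
Context {R : realType} {V : normedModType R}.

Lemma differentiable_near (f : V -> R) x : differentiable f x ->
  forall e : R, 0 < e -> exists2 d : R, 0 < d &
    forall w, `|w| < d -> `|f (w + x) - f x - 'd f x w| <= e * `|w|.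
Proof.
move=> /diff_locally /eqaddoP h e e0.
have /nbhs_ballP[d d0 hd] := h e e0.
exists d => // w wd; have := hd w; rewrite /= -ball_normE /= sub0r normrN.
by move=> /(_ wd); rewrite opprD addrA.
Qed.

(** The definition of the differential, with the candidate [L] given and the
    little-o spelled out. *)
Lemma near_differentiable (f : V -> R) (L : {linear V -> R}) x :
  continuous L ->
  (forall e : R, 0 < e -> exists2 d : R, 0 < d &
    forall w, `|w| < d -> `|f (w + x) - f x - L w| <= e * `|w|) ->
  differentiable f x /\ forall v, 'D_v f x = L v.
Proof.
move=> cL h.
have e : f \o shift x = cst (f x) + L +o_ 0 id.
  apply/eqaddoP => e e0; have [d d0 hd] := h e e0.
  apply/nbhs_ballP; exists d => // w; rewrite -ball_normE /= sub0r normrN => wd.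
  by have := hd w wd; rewrite [X in _ -> X <= _](_ : _ = `|f (w + x) - f x - L w|)// opprD addrA.
have dE := diff_unique cL e.
have df : differentiable f x.
  by apply/diff_locallyP; rewrite dE.
by split => // v; rewrite deriveE// dE.
Qed.

End differentiability_criterion.

Section identity.
Context {R : realType}.
Local Notation re := (@complex.Re R).
Local Notation im := (@complex.Im R).

(** Gluing [f] on the upper half-plane to 0 on the lower one. *)
Definition upper_part (T : zmodType) (f : R * R -> T) (z : R * R) : T :=
  if 0 < z.2 then f z else 0.

Lemma is_C1_upper_part (a : R * R -> R) : is_C1 a ->
  (forall s, a (s, 0) = 0) -> (forall s v, 'D_v a (s, 0) = 0) ->
  is_C1 (upper_part a) /\ forall v, 'D_v (upper_part a) = upper_part ('D_v a).
Proof.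
move=> aC a0 Da0.
have h z : differentiable (upper_part a) z /\
    forall v, 'D_v (upper_part a) z = upper_part ('D_v a) z.
  have [z0|z0] := ltP 0 z.2.
    have [|e e0|dz Dz] := @near_differentiable R _ (upper_part a) ('d a z) z.
    - by apply: diff_continuous; exact: aC.1.
    - have [d d0 hd] := differentiable_near (aC.1 z) e0.
      exists (Num.min d z.2); first by rewrite lt_min d0.
      move=> w; rewrite lt_min => /andP[wd wz].
      have zw : 0 < (w + z).2.
        rewrite /= addrC -ltrBlDl sub0r ltrNl (le_lt_trans _ wz)// (le_trans (ler_norm _))//.
        by rewrite normrN prod_normE le_max lexx orbT.
      by rewrite /upper_part z0 zw; exact: hd.
    by split => // v; rewrite Dz /upper_part z0 deriveE//; exact: aC.1.
  have [|e e0|dz Dz] := @near_differentiable R _ (upper_part a) \0 z.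
  - by move=> ?; exact: cvg_cst.
  - move: z0; rewrite le_eqVlt => /predU1P[z0|z0].
      have zE : z = (z.1, 0) by rewrite -z0; case: (z).
      have [d d0 hd] := differentiable_near (aC.1 z) e0.
      exists d => // w wd; rewrite /upper_part z0 ltxx !subr0.
      case: ifP => _; last by rewrite normr0 mulr_ge0// ltW.
      have := hd w wd; rewrite -deriveE; last exact: aC.1.
      by rewrite [in a z]zE a0 [in 'D_w a z]zE Da0 !subr0.
    exists (- z.2); first by rewrite oppr_gt0.
    move=> w wz; rewrite /upper_part /= [0 < z.2]ltNge (ltW z0) /=.
    suff -> : 0 < w.2 + z.2 = false by rewrite !subr0 normr0 mulr_ge0// ltW.
    apply/negbTE; rewrite -leNgt -lerBrDr sub0r.
    rewrite (le_trans _ (ltW wz))// (le_trans (ler_norm _))//.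
    by rewrite prod_normE le_max lexx orbT.
  split => // v; rewrite Dz /upper_part /=.
  by rewrite ltNge z0.
have DE v : 'D_v (upper_part a) = upper_part ('D_v a).
  by apply/funext => z; exact: (h z).2.
split => //; split=> [z|v]; first exact: (h z).1.
rewrite DE.
have -> : upper_part ('D_v a) =
    'D_v a \o (fun z => (z.1, (z.2 + `|z.2|) / 2)).
  apply/funext => z; rewrite /upper_part /=; case: ltP => z0.
    by rewrite gtr0_norm// mulrDl -splitr; case: (z).
  by rewrite ler0_norm// subrr mul0r Da0.
have cc : continuous (fun z : R * R => (z.2 + `|z.2|) / 2).
  move=> z; apply: cvgM; last exact: cvg_cst.
  by apply: cvgD; [exact: cvg_snd|apply: cvg_norm; exact: cvg_snd].
move=> z; apply: (@continuous_comp _ _ _ (fun z : R * R => (z.1, (z.2 + `|z.2|) / 2))).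
  by have := cvg_pair (@cvg_fst _ _ (nbhs z.1) (nbhs z.2) _) (cc z); exact.
exact: aC.2.
Qed.

(** On the real line the tangential derivative of [f] vanishes with [f], hence by
    the Cauchy-Riemann equations so does its gradient, and the gluing is C^1. *)
Lemma jholo_upper_part (f : R * R -> R[i]) : jholo rot2 f ->
  (forall s, f (s, 0) = 0) -> jholo rot2 (upper_part f).
Proof.
move=> [[f1 f2] CR] f0.
have re0 s : (re \o f) (s, 0) = 0 by rewrite /= f0.
have im0 s : (im \o f) (s, 0) = 0 by rewrite /= f0.
have D10 (a : R * R -> R) s : (forall s, a (s, 0) = 0) -> 'D_(1, 0) a (s, 0) = 0.
  move=> a0; rewrite /derive.
  rewrite (_ : (fun _ => _) = fun=> 0); first exact: lim_cst.
  apply/funext => h /=; rewrite (_ : (_ + _)%R = (h * 1 + s, 0)).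
    by rewrite !a0 subrr scaler0.
  by congr pair; rewrite /= /GRing.scale /= ?mulr0 ?addr0.
have vE (v : R * R) : v = v.1 *: (1, 0) + v.2 *: rot2 (1, 0).
  case: v => a b; congr pair; rewrite /= /GRing.scale /= ?mulr0 ?mulr1; ring.
have Dre0 s v : 'D_v (re \o f) (s, 0) = 0.
  rewrite (vE v) deriveDl ?deriveZl; try exact: f1.1.
  by rewrite (CR _ _).1 !D10//; ring.
have Dim0 s v : 'D_v (im \o f) (s, 0) = 0.
  rewrite (vE v) deriveDl ?deriveZl; try exact: f2.1.
  by rewrite (CR _ _).2 !D10//; ring.
have [u1 Du1] := is_C1_upper_part f1 re0 Dre0.
have [u2 Du2] := is_C1_upper_part f2 im0 Dim0.
have reE : re \o upper_part f = upper_part (re \o f).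
  by apply/funext => z; rewrite /upper_part /=; case: ifP.
have imE : im \o upper_part f = upper_part (im \o f).
  by apply/funext => z; rewrite /upper_part /=; case: ifP.
split; first by rewrite /is_cC1 reE imE.
have D1 p v := congr1 (fun g => g p) (Du1 v).
have D2 p v := congr1 (fun g => g p) (Du2 v).
move=> p v; rewrite reE imE [X in X = _ /\ _]D1 [X in _ = - X /\ _]D2.
rewrite [X in _ /\ X = _]D2 [X in _ /\ _ = X]D1 /upper_part.
by case: ifP => _; [exact: CR|rewrite oppr0].
Qed.

(** The gluing [g] of [f] with 0 is holomorphic on the whole plane and vanishes
    below the real line. Every point of the circle of radius 2 about i is moved
    below that line by one of the four rotations by right angles about i, so
    the product of the four rotated copies of [g] vanishes on the circle; its
    mean there is its value at i, the fourth power of [f (0, 1)]. *)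
Lemma jholo_real_line_zero (f : R * R -> R[i]) : jholo rot2 f ->
  (forall s, f (s, 0) = 0) -> f (0, 1) = 0.
Proof.
move=> fJ f0; have gJ := jholo_upper_part fJ f0; set g := upper_part f in gJ.
(* rotations about i *)
pose g_ (c s : R) (z : R * R) := g (c * z.1 - s * z.2, 1 + (s * z.1 + c * z.2)).
have gJ_ c s : jholo rot2 (g_ c s).
  apply: (@jholo_comp R _ _ rot2 rot2 g
    (fun z : R * R => (c * z.1 - s * z.2, 1 + (s * z.1 + c * z.2)))
    (fun v : R * R => (c * v.1 - s * v.2, 0 + (s * v.1 + c * v.2)))) => //.
    apply: constant_diff_pair.
      by apply: constant_diffB; apply: constant_diffZ; [exact: constant_diff_fst|exact: constant_diff_snd].
    apply: constant_diffD; first exact: constant_diff_cst.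
    by apply: constant_diffD; apply: constant_diffZ; [exact: constant_diff_fst|exact: constant_diff_snd].
  by move=> [a b]; congr pair => /=; ring.
pose P z := g_ 1 0 z * g_ 0 1 z * (g_ (- 1) 0 z * g_ 0 (- 1) z).
have PJ : jholo rot2 P by apply: jholoM; exact: jholoM.
have P0 t : P (polar 2 t) = 0.
  have gz c s z : s * z.1 + c * z.2 <= - 1 -> g_ c s z = 0.
    by move=> h; rewrite /g_ /g /upper_part /=; case: ltP => // h'; exfalso; lra.
  have := cos2Dsin2 t; rewrite /P /polar.
  set x := 2 * cos t; set y := 2 * sin t => cs.
  have xy : x ^+ 2 + y ^+ 2 = 4.
    by rewrite /x /y !exprMn -mulrDr cs; ring.
  have [y1|y1] := lerP y (- 1).
    by rewrite (gz 1 0) ?mul0r//=; lra.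
  have [y2|y2] := lerP 1 y.
    by rewrite (gz (- 1) 0) ?mul0r ?mulr0//=; lra.
  have [x1|x1] := lerP x (- 1).
    by rewrite (gz 0 1) ?mul0r ?mulr0 ?mul0r//=; lra.
  have [x2|x2] := lerP 1 x.
    by rewrite (gz 0 (- 1)) ?mulr0//=; lra.
  by exfalso; nra.
have g1 c s : g_ c s (0, 0) = f (0, 1).
  by rewrite /g_ /= !mulr0 subr0 !addr0 /g /upper_part /= ltr01.
have [] := circle_mean PJ (ler0n _ 2).
have i0 : \int[@lebesgue_measure R]_(t in `[- pi, pi]) 0 = 0 :> R.
  by rewrite /Rintegral integral0.
under eq_Rintegral => t _ do rewrite P0 /=.
rewrite i0 => /esym/eqP.
rewrite !mulf_eq0 pnatr_eq0 (gt_eqF (pi_gt0 R)) /= => /eqP reP.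
under eq_Rintegral => t _ do rewrite P0 /=.
rewrite i0 => /esym/eqP.
rewrite !mulf_eq0 pnatr_eq0 (gt_eqF (pi_gt0 R)) /= => /eqP imP.
have : P (0, 0) = 0 by apply/eqP; rewrite eq_complex /= reP imP !eqxx.
by rewrite /P !g1 => /eqP; rewrite !mulf_eq0 !orbb => /eqP.
Qed.

End identity.

(** * Gaussian means in the coordinates (T, Z) *)

Section dot_product.
Context {R : realType}.

Lemma dotvC m (u v : 'rV[R]_m) : dotv u v = dotv v u.
Proof. by apply: eq_bigr => i _; rewrite mulrC. Qed.

Lemma dotvDl m (u v w : 'rV[R]_m) : dotv (u + v) w = dotv u w + dotv v w.
Proof. by rewrite /dotv -big_split; apply: eq_bigr => i _; rewrite mxE mulrDl. Qed.

Lemma dotvDr m (u v w : 'rV[R]_m) : dotv w (u + v) = dotv w u + dotv w v.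
Proof. by rewrite !(dotvC w) dotvDl. Qed.

Lemma dotvZl m a (u w : 'rV[R]_m) : dotv (a *: u) w = a * dotv u w.
Proof. by rewrite /dotv mulr_sumr; apply: eq_bigr => i _; rewrite mxE mulrA. Qed.

Lemma dotvZr m a (u w : 'rV[R]_m) : dotv w (a *: u) = a * dotv w u.
Proof. by rewrite !(dotvC w) dotvZl. Qed.

Lemma dotvNl m (u w : 'rV[R]_m) : dotv (- u) w = - dotv u w.
Proof. by rewrite -scaleN1r dotvZl mulN1r. Qed.

Lemma dotvNr m (u w : 'rV[R]_m) : dotv w (- u) = - dotv w u.
Proof. by rewrite !(dotvC w) dotvNl. Qed.

Lemma dotv0l m (w : 'rV[R]_m) : dotv 0 w = 0.
Proof. by rewrite -(scale0r 0) dotvZl mul0r. Qed.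

Lemma sqn_ge0 m (v : 'rV[R]_m) : 0 <= sqn v.
Proof. by rewrite sqnE sumr_ge0// => i _; exact: sqr_ge0. Qed.

Lemma sqnD m (u v : 'rV[R]_m) : sqn (u + v) = sqn u + 2 * dotv u v + sqn v.
Proof. by rewrite /sqn !dotvDl !dotvDr (dotvC v u); ring. Qed.

Lemma sqnZ m a (u : 'rV[R]_m) : sqn (a *: u) = a ^+ 2 * sqn u.
Proof. by rewrite /sqn dotvZl dotvZr; ring. Qed.

Lemma sqnN m (u : 'rV[R]_m) : sqn (- u) = sqn u.
Proof. by rewrite -scaleN1r sqnZ; ring. Qed.

Lemma sqnB m (u v : 'rV[R]_m) : sqn (u - v) = sqn u - 2 * dotv u v + sqn v.
Proof. by rewrite sqnD dotvNr sqnN; ring. Qed.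

Lemma dotv_row_mx m k (a b : 'rV[R]_m) (c d : 'rV[R]_k) :
  dotv (row_mx a c) (row_mx b d) = dotv a b + dotv c d.
Proof.
rewrite /dotv big_split_ord /=; congr (_ + _); apply: eq_bigr => i _.
  by rewrite !row_mxEl.
by rewrite !row_mxEr.
Qed.

Lemma dotv_ge m (u v : 'rV[R]_m) (e : R) : 0 < e ->
  dotv u v <= e * sqn u + (4 * e)^-1 * sqn v.
Proof.
move=> e0; rewrite !sqnE /dotv !mulr_sumr -big_split /=.
apply: ler_sum => i _; rewrite -subr_ge0.
set a := u _ _; set b := v _ _.
have -> : e * a ^+ 2 + (4 * e)^-1 * b ^+ 2 - a * b = e^-1 * (e * a - b / 2) ^+ 2.
  by field; rewrite gt_eqF.
by rewrite mulr_ge0 ?sqr_ge0// invr_ge0 ltW.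
Qed.

(** Multiplication by i for x + i xi. *)
Definition jrot {n} (X : 'rV[R]_(n + n)) : 'rV[R]_(n + n) :=
  row_mx (- rsubmx X) (lsubmx X).

Lemma jrotD n (X Y : 'rV[R]_(n + n)) : jrot (X + Y) = jrot X + jrot Y.
Proof. by rewrite /jrot !linearD /= add_row_mx. Qed.

Lemma jrotZ n a (X : 'rV[R]_(n + n)) : jrot (a *: X) = a *: jrot X.
Proof. by rewrite /jrot !linearZ /= scale_row_mx. Qed.

Lemma jrotN n (X : 'rV[R]_(n + n)) : jrot (- X) = - jrot X.
Proof. by rewrite -scaleN1r jrotZ scaleN1r. Qed.

Lemma jrotK n (X : 'rV[R]_(n + n)) : jrot (jrot X) = - X.
Proof.
by rewrite /jrot row_mxKl row_mxKr -[X in RHS]hsubmxK opp_row_mx.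
Qed.

Lemma dotv_jrot n (X Y : 'rV[R]_(n + n)) : dotv X (jrot Y) = - dotv (jrot X) Y.
Proof.
rewrite -[X in LHS](hsubmxK X) -[Y in RHS](hsubmxK Y) /jrot !dotv_row_mx.
by rewrite dotvNr dotvNl; ring.
Qed.

Lemma sqn_jrot n (X : 'rV[R]_(n + n)) : sqn (jrot X) = sqn X.
Proof. by rewrite /sqn dotv_jrot jrotK dotvNl opprK. Qed.

Lemma measurable_row_mx d (T : measurableType d) m k
    (f : T -> 'rV[R]_m) (g : T -> 'rV[R]_k) :
  measurable_fun setT f -> measurable_fun setT g ->
  measurable_fun setT (fun x => row_mx (f x) (g x)).
Proof.
move=> mf mg; apply: measurable_fun_rVP => i.
rewrite -(splitK i); case: fintype.split => j /=.
  under eq_fun do rewrite row_mxEl.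
  by apply: measurableT_comp (measurable_coord _) _.
under eq_fun do rewrite row_mxEr.
by apply: measurableT_comp (measurable_coord _) _.
Qed.

Lemma measurable_lsubmx d (T : measurableType d) m k (f : T -> 'rV[R]_(m + k)) :
  measurable_fun setT f -> measurable_fun setT (fun x => lsubmx (f x)).
Proof.
move=> mf; apply: measurable_fun_rVP => i; under eq_fun do rewrite mxE.
by apply: measurableT_comp (measurable_coord _) _.
Qed.

Lemma measurable_rsubmx d (T : measurableType d) m k (f : T -> 'rV[R]_(m + k)) :
  measurable_fun setT f -> measurable_fun setT (fun x => rsubmx (f x)).
Proof.
move=> mf; apply: measurable_fun_rVP => i; under eq_fun do rewrite mxE.
by apply: measurableT_comp (measurable_coord _) _.
Qed.

Lemma measurable_rV_opp d (T : measurableType d) m (f : T -> 'rV[R]_m) :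
  measurable_fun setT f -> measurable_fun setT (fun x => - f x).
Proof.
move=> mf; apply: measurable_fun_rVP => i; under eq_fun do rewrite mxE.
by apply: measurableT_comp => //; apply: measurableT_comp (measurable_coord _) _.
Qed.

Lemma measurable_jrot d (T : measurableType d) n (f : T -> 'rV[R]_(n + n)) :
  measurable_fun setT f -> measurable_fun setT (jrot \o f).
Proof.
move=> mf; apply: measurable_row_mx; last exact: measurable_lsubmx.
by apply: measurable_rV_opp; exact: measurable_rsubmx.
Qed.

End dot_product.

Section rotation.
Context {R : realType} {n : nat}.
Local Notation phase := 'rV[R]_(n + n).
Local Notation mu := (leb (n + n) \x leb (R := R) (n + n))%E.
Local Open Scope ereal_scope.

(** Multiplication by i for the sesqui-holomorphic structure, in the coordinates
    T = (X + Y) / 2 and Z = X - Y. The diagonal is the real subspace Z = 0. *)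
Definition jTZ (p : phase * phase) : phase * phase :=
  (2^-1 *: jrot p.2, 2 *: jrot p.1)%R.

Definition rotTZ (c s : R) (p : phase * phase) : phase * phase :=
  (c *: p.1 + s *: (2^-1 *: jrot p.2), c *: p.2 + s *: (2 *: jrot p.1))%R.

Lemma rotTZE c s p : rotTZ c s p = (c *: p + s *: jTZ p)%R.
Proof. by []. Qed.

Let shear1 (a : R) (p : phase * phase) : phase * phase :=
  (p.1 + a *: jrot p.2, p.2)%R.

Let shear2 (a : R) (p : phase * phase) : phase * phase :=
  (p.1, p.2 + a *: jrot p.1)%R.

Let measurable_shear1 a : measurable_fun setT (shear1 a).
Proof.
apply/measurable_fun_pairP; split => /=; last exact: measurable_snd.
apply: measurable_rV_add; first exact: measurable_fst.
apply: measurable_rV_scale => //; apply: measurable_jrot; exact: measurable_snd.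
Qed.

Let measurable_shear2 a : measurable_fun setT (shear2 a).
Proof.
apply/measurable_fun_pairP; split => /=; first exact: measurable_fst.
apply: measurable_rV_add; first exact: measurable_snd.
apply: measurable_rV_scale => //; apply: measurable_jrot; exact: measurable_fst.
Qed.

Let ge0_integral_shear1 a (F : phase * phase -> \bar R) :
  measurable_fun setT F -> (forall p, 0 <= F p) ->
  \int[mu]_p F (shear1 a p) = \int[mu]_p F p.
Proof.
move=> mF F0.
have mF1 Z : measurable_fun setT (fun T => F (T, Z)).
  by apply: measurableT_comp mF _; exact: pair2_measurable.
rewrite fubini_tonelli2//; last by apply: measurableT_comp mF _; exact: measurable_shear1.
rewrite fubini_tonelli2//; apply: eq_integral => Z _; rewrite /fubini_G /shear1 /=.
by rewrite (ge0_integral_translate (a *: jrot Z)%R (mF1 Z)).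
Qed.

Let ge0_integral_shear2 a (F : phase * phase -> \bar R) :
  measurable_fun setT F -> (forall p, 0 <= F p) ->
  \int[mu]_p F (shear2 a p) = \int[mu]_p F p.
Proof.
move=> mF F0.
have mF1 T : measurable_fun setT (fun Z => F (T, Z)).
  by apply: measurableT_comp mF _; exact: pair1_measurable.
rewrite fubini_tonelli1//; last by apply: measurableT_comp mF _; exact: measurable_shear2.
rewrite fubini_tonelli1//; apply: eq_integral => T _; rewrite /fubini_F /shear2 /=.
by rewrite (ge0_integral_translate (a *: jrot T)%R (mF1 T)).
Qed.

Lemma measurable_rotTZ d (S : measurableType d) (c s : S -> R) (p : S -> phase * phase) :
  measurable_fun setT c -> measurable_fun setT s -> measurable_fun setT p ->
  measurable_fun setT (fun x => rotTZ (c x) (s x) (p x)).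
Proof.
move=> mc ms mp.
have m1 : measurable_fun setT (fun x => (p x).1) by apply: measurableT_comp mp.
have m2 : measurable_fun setT (fun x => (p x).2) by apply: measurableT_comp mp.
by apply/measurable_fun_pairP; split => /=; apply: measurable_rV_add;
  apply: measurable_rV_scale => //; apply: measurable_rV_scale => //; exact: measurable_jrot.
Qed.

(** A rotation is a product of three shears, and a shear is a translation of one
    variable by an amount that depends on the other. *)
Lemma ge0_integral_rotTZ c s (F : phase * phase -> \bar R) :
  (c ^+ 2 + s ^+ 2 = 1)%R ->
  measurable_fun setT F -> (forall p, 0 <= F p) ->
  \int[mu]_p F (rotTZ c s p) = \int[mu]_p F p.
Proof.
have main c' s' (G : phase * phase -> \bar R) :
  (c' ^+ 2 + s' ^+ 2 = 1)%R -> s' != 0%R -> measurable_fun setT G -> (forall p, 0 <= G p) ->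
  \int[mu]_p G (rotTZ c' s' p) = \int[mu]_p G p.
  move=> cs s0 mG G0; pose a := ((1 - c') / s' / 2)%R; pose b := (2 * s')%R.
  rewrite -(ge0_integral_shear1 a mG G0).
  have m1 : measurable_fun setT (G \o shear1 a).
    by apply: measurableT_comp mG _; exact: measurable_shear1.
  rewrite -(@ge0_integral_shear2 b (G \o shear1 a))//; last by move=> p; exact: G0.
  have m2 : measurable_fun setT (G \o shear1 a \o shear2 b).
    by apply: measurableT_comp m1 _; exact: measurable_shear2.
  rewrite -(@ge0_integral_shear1 a (G \o shear1 a \o shear2 b))//; last by move=> p; exact: G0.
  apply: eq_integral => -[T Z] _ /=; congr G.
  rewrite /shear1 /shear2 /rotTZ /=.
  have E : (a * b = 1 - c')%R by rewrite /a /b; field.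
  have E2 : (a * (1 + c') = s' / 2)%R.
    rewrite /a (_ : _ * (1 + c') = (1 - c' ^+ 2) / s' / 2)%R; last by field.
    have -> : (1 - c' ^+ 2 = s' ^+ 2)%R by lra.
    by field.
  have Z2 : (Z + b *: jrot (T + a *: jrot Z) = c' *: Z + s' *: (2 *: jrot T))%R.
    rewrite jrotD jrotZ jrotK scalerDr !scalerA scalerN mulrC E scalerBl scale1r.
    by rewrite opprB [X in X = _]addrC -addrA [(_ - Z + Z)%R]subrK [(s' * 2)%R]mulrC addrC.
  congr pair; last by rewrite Z2.
  rewrite Z2 jrotD !jrotZ jrotK; apply/rowP => i; move: (jrot Z) => jZ.
  rewrite !mxE; set t := T _ _; set z := jZ _ _.
  symmetry; transitivity (t + (a * (1 + c')) * z - (a * b) * t)%R; first by rewrite /b; ring.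
  by rewrite E E2; field.
move=> cs mF F0.
have [s0|s0] := eqVneq s 0%R; last exact: main.
have /orP[/eqP->|/eqP->] : (c == 1)%R || (c == -1)%R.
  by rewrite -eqf_sqr expr1n -cs s0 expr0n addr0.
  rewrite s0; apply: eq_integral => -[T Z] _.
  by rewrite /rotTZ /= !scale0r !addr0 !scale1r.
rewrite -[RHS](main 0%R 1%R)//; last by rewrite expr0n expr1n add0r.
have mF' : measurable_fun setT (fun p => F (rotTZ 0 1 p)).
  by apply: measurableT_comp mF _; apply: measurable_rotTZ => //; exact: measurable_id.
have h01 : (0 ^+ 2 + 1 ^+ 2 = 1 :> R)%R by rewrite expr0n expr1n add0r.
apply: etrans (main _ _ _ h01 (oner_neq0 _) mF' _); last by move=> p; exact: F0.
apply: eq_integral => -[T Z] _; congr F; rewrite s0 /rotTZ /= !scale0r !scale1r !addr0 !add0r.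
by rewrite !jrotZ !jrotK !scalerA !scaleN1r mulVf ?mulfV// !scale1r.
Qed.

Lemma integral_rotTZ c s (F : phase * phase -> \bar R) :
  (c ^+ 2 + s ^+ 2 = 1)%R -> measurable_fun setT F ->
  \int[mu]_p F (rotTZ c s p) = \int[mu]_p F p.
Proof.
move=> cs mF; rewrite integralE [RHS]integralE; congr (_ - _).
  rewrite -(ge0_integral_rotTZ cs (measurable_funepos mF))//.
  by apply: eq_integral => p _; rewrite funeposE funeposE.
rewrite -(ge0_integral_rotTZ cs (measurable_funeneg mF))//.
by apply: eq_integral => p _; rewrite funenegE funenegE.
Qed.

End rotation.

Section gaussian_weight.
Context {R : realType} {n : nat}.
Local Notation phase := 'rV[R]_(n + n).
Local Notation mu := (leb (n + n) \x leb (R := R) (n + n))%E.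

(** The exponent is half of |X|^2 + |Y|^2 for X = T + Z / 2 and Y = T - Z / 2, so
    the weight is both invariant under [rotTZ] and a product over coordinates. *)
Definition gweight (c : R) (p : phase * phase) : R :=
  expR (- (c * (sqn p.1 + sqn p.2 / 4))).

Lemma gweight_gt0 c p : 0 < gweight c p.
Proof. exact: expR_gt0. Qed.

Lemma measurable_gweight c : measurable_fun setT (gweight c).
Proof.
apply: measurableT_comp => //; apply: measurableT_comp => //.
apply: measurable_funM => //; apply: measurable_funD.
  by apply: measurableT_comp; [exact: measurable_sqn|exact: measurable_fst].
apply: measurable_funM => //.
by apply: measurableT_comp; [exact: measurable_sqn|exact: measurable_snd].
Qed.

Lemma sqn_rotTZ c s (p : phase * phase) : c ^+ 2 + s ^+ 2 = 1 ->
  sqn (rotTZ c s p).1 + sqn (rotTZ c s p).2 / 4 = sqn p.1 + sqn p.2 / 4.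
Proof.
move=> cs; rewrite /rotTZ /= !sqnD !sqnZ !dotvZl !dotvZr !sqn_jrot (dotvC p.2).
rewrite dotv_jrot; set T := sqn p.1; set Z := sqn p.2.
transitivity ((c ^+ 2 + s ^+ 2) * T + (c ^+ 2 + s ^+ 2) * Z / 4); first by field.
by rewrite cs !mul1r.
Qed.

Lemma gweight_rotTZ k c s p : c ^+ 2 + s ^+ 2 = 1 ->
  gweight k (rotTZ c s p) = gweight k p.
Proof. by move=> cs; rewrite /gweight sqn_rotTZ. Qed.

Lemma gweightE c T Z : gweight c (T, Z) = expR (- (c * sqn T)) * expR (- (c / 4 * sqn Z)).
Proof. by rewrite -expRD /gweight /=; congr expR; ring. Qed.

Lemma sqrt_exprnn (x : R) : 0 <= x -> Num.sqrt x ^+ (n + n) = x ^+ n.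
Proof. by move=> x0; rewrite exprD -exprMn -expr2 sqr_sqrtr. Qed.

Definition gmass (c : R) : R := (pi / c) ^+ n * (4 * pi / c) ^+ n.

Lemma integral_gweight c : 0 < c -> (\int[mu]_p (gweight c p)%:E = (gmass c)%:E)%E.
Proof.
move=> c0; have mw := measurable_gweight c.
rewrite fubini_tonelli1//; last 2 first.
  exact/measurable_EFinP.
  by move=> p; rewrite lee_fin ltW// gweight_gt0.
transitivity (\int[leb (n + n)]_T (((4 * pi / c) ^+ n)%:E * (expR (- (c * sqn T)))%:E))%E.
  apply: eq_integral => T _; rewrite /fubini_F.
  under eq_integral => Z _ do rewrite gweightE EFinM.
  rewrite ge0_integralZl_EFin//.
  - rewrite integral_gauss_rV ?divr_gt0// sqrt_exprnn; last first.
      by rewrite divr_ge0 ?pi_ge0// divr_ge0// ltW.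
    rewrite muleC; congr ((_ ^+ _)%:E * _)%E.
    by field; rewrite gt_eqF.
  - apply/measurable_EFinP; apply: measurableT_comp => //; apply: measurableT_comp => //.
    by apply: measurable_funM => //; exact: measurable_sqn.
rewrite ge0_integralZl_EFin//.
- rewrite integral_gauss_rV// sqrt_exprnn; last by rewrite divr_ge0 ?pi_ge0// ltW.
  by rewrite -EFinM mulrC.
- apply/measurable_EFinP; apply: measurableT_comp => //; apply: measurableT_comp => //.
  by apply: measurable_funM => //; exact: measurable_sqn.
- by rewrite exprn_ge0// divr_ge0 ?mulr_ge0 ?pi_ge0// ltW.
Qed.

End gaussian_weight.

Section sigma_finite_product.
Context d1 d2 (T1 : measurableType d1) (T2 : measurableType d2) (R : realType).
Variable m1 : {sigma_finite_measure set T1 -> \bar R}.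
Variable m2 : {sigma_finite_measure set T2 -> \bar R}.
Local Open Scope ereal_scope.

(** The product measure, given a name that carries its sigma-finiteness. *)
Definition sfprod : set (T1 * T2) -> \bar R := m1 \x m2.

HB.instance Definition _ := Measure.copy sfprod (m1 \x m2).

Let sigma_finite_sfprod : sigma_finite setT sfprod.
Proof.
have /sigma_finiteP[F [FT Fnd Ffin]] := sigma_finiteT m1.
have /sigma_finiteP[G [GT Gnd Gfin]] := sigma_finiteT m2.
exists (fun k => F k `*` G k).
  apply/seteqP; split=> // -[x y] _.
  have [i _ Fi] : (\bigcup_k F k) x by rewrite -FT.
  have [j _ Gj] : (\bigcup_k G k) y by rewrite -GT.
  exists (maxn i j) => //; split => /=.
    exact: (subsetPset _ _ (Fnd _ _ (leq_maxl i j))).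
  exact: (subsetPset _ _ (Gnd _ _ (leq_maxr i j))).
move=> k; have [mF Fk] := Ffin k; have [mG Gk] := Gfin k.
split; first exact: measurableX.
by rewrite /sfprod product_measure1E// lte_mul_pinfty// ge0_fin_numE.
Qed.

HB.instance Definition _ := Measure_isSigmaFinite.Build _ _ _ sfprod sigma_finite_sfprod.

End sigma_finite_product.

Section gaussian_mean.
Context {R : realType} {n : nat}.
Local Notation phase := 'rV[R]_(n + n).
Local Notation mu := (leb (n + n) \x leb (R := R) (n + n))%E.
Local Notation lam := (@lebesgue_measure R).
Local Open Scope ereal_scope.

Variables (a : phase * phase -> R) (c : R).
Hypothesis c0 : (0 < c)%R.
Hypothesis ma : measurable_fun setT a.
Hypothesis circ : forall p, (\int[lam]_(t in `[(- pi)%R, pi%R]) a (rotTZ (cos t) (sin t) p) =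
  2 * pi * a (0, 0))%R.
Hypothesis circ_int : forall p,
  lam.-integrable `[(- pi)%R, pi%R] (fun t => (a (rotTZ (cos t) (sin t) p))%:E).
Hypothesis int_a : mu.-integrable setT (fun p => (a p * gweight c p)%:E).

Let I : set R := `[(- pi)%R, pi%R]%classic.

Let mI : measurable I. Proof. exact: measurable_itv. Qed.

Let lamI : lam I = (2 * pi)%:E.
Proof.
rewrite lebesgue_measure_itv /= lte_fin gtrN ?pi_gt0//= -EFinB.
by congr EFin; ring.
Qed.

Let H (z : R * (phase * phase)) : R :=
  (\1_I z.1 * (a (rotTZ (cos z.1) (sin z.1) z.2) * gweight c z.2))%R.

Let mH : measurable_fun setT H.
Proof.
apply: measurable_funM.
  apply: (@measurableT_comp _ _ _ _ _ _ (\1_I : R -> R)); last exact: measurable_fst.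
  exact: measurable_indic.
apply: measurable_funM; last first.
  by apply: measurableT_comp; [exact: measurable_gweight|exact: measurable_snd].
apply: measurableT_comp => //; apply: measurable_rotTZ.
- apply: measurableT_comp; last exact: measurable_fst.
  by apply: continuous_measurable_fun; exact: continuous_cos.
- apply: measurableT_comp; last exact: measurable_fst.
  by apply: continuous_measurable_fun; exact: continuous_sin.
- exact: measurable_snd.
Qed.

Let HE t p : H (t, p) =
  (\1_I t * (a (rotTZ (cos t) (sin t) p) * gweight c (rotTZ (cos t) (sin t) p)))%R.
Proof. by rewrite gweight_rotTZ//; exact: cos2Dsin2. Qed.

Let maw : measurable_fun setT (fun p => (a p * gweight c p)%:E).
Proof. exact: (measurable_int _ int_a). Qed.

Let H_rot (G : R -> R) t : measurable_fun setT G -> (G 0 = 0)%R ->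
  \int[mu]_p (G (H (t, p)))%:E =
  (\1_I t)%:E * \int[mu]_p (G (a p * gweight c p)%R)%:E.
Proof.
move=> mG G0; have mGa : measurable_fun setT (fun p => (G (a p * gweight c p)%R)%:E).
  apply/measurable_EFinP; apply: measurableT_comp => //.
  exact/measurable_EFinP.
rewrite -(integral_rotTZ (cos2Dsin2 t) mGa) indicE; case: (boolP (t \in I)) => tI.
  by rewrite mul1e; apply: eq_integral => p _; rewrite HE indicE tI mul1r.
rewrite mul0e; under eq_integral do rewrite HE indicE (negbTE tI) mul0r G0.
exact: integral0.
Qed.

Let int_indic : \int[lam]_t (\1_I t)%:E = (2 * pi)%:E.
Proof. by rewrite integral_indic// setIT; exact: lamI. Qed.

Local Notation mus := (sfprod (leb (n + n)) (leb (R := R) (n + n))).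

Let intH : (lam \x mus).-integrable setT (EFin \o H).
Proof.
apply/integrable12ltyP; first exact/measurable_EFinP.
pose C := \int[mu]_p `|(a p * gweight c p)%:E|.
have Cfin : C < +oo by move: int_a => /integrableP[].
have C0 : 0 <= C by apply: integral_ge0 => p _; exact: abse_ge0.
have -> : \int[lam]_t \int[mus]_p `|(H (t, p))%:E| = \int[lam]_t (C * (\1_I t)%:E).
  apply: eq_integral => t _; rewrite muleC.
  by have := @H_rot Num.norm t (@normr_measurable R setT) (normr0 _).
rewrite ge0_integralZl//; first 1 last.
- by apply/measurable_EFinP; exact: measurable_indic.
- rewrite [X in C * X]int_indic lte_mul_pinfty ?ltry//.
  by rewrite ge0_fin_numE.
Qed.

(** The weight is invariant under rotations, so the integral is the mean of its
    rotated copies; by Fubini the mean over the angle may be taken first, where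
    it produces the value at the centre. *)
Lemma gaussian_mean : \int[mu]_p (a p * gweight c p)%:E = (a (0, 0) * @gmass R n c)%:E.
Proof.
set K := LHS.
have Kfin : K \is a fin_num by exact: integrable_fin_num int_a.
have e1 : \int[lam \x mus]_z (H z)%:E = K * (2 * pi)%:E.
  rewrite -(integral12_prod_meas1 intH) -int_indic -(fineK Kfin).
  rewrite -integralZl//; last first.
    apply/integrableP; split; first by apply/measurable_EFinP; exact: measurable_indic.
    under eq_integral => t _ do rewrite /= ger0_norm//.
    by rewrite int_indic ltry.
  apply: eq_integral => t _; rewrite muleC fineK//.
  exact: (@H_rot id t).
have e2 : \int[lam \x mus]_z (H z)%:E = (2 * pi * a (0, 0)%R * @gmass R n c)%:E.
  rewrite -(integral21_prod_meas1 intH) EFinM -integral_gweight//.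
  rewrite -integralZl//; last first.
    apply/integrableP; split; first by apply/measurable_EFinP; exact: measurable_gweight.
    under eq_integral => p _ do rewrite /= gtr0_norm ?gweight_gt0//.
    by rewrite integral_gweight// ltry.
  apply: eq_integral => p _; rewrite /fubini_G /= -(circ p).
  rewrite /Rintegral fineK; last exact: integrable_fin_num.
  rewrite muleC -integralZl// integral_mkcond; apply: eq_integral => t _.
  rewrite /H patchE indicE /=; case: ifPn => _; last by rewrite mul0r.
  by rewrite mul1r EFinM muleC.
move: e1; rewrite e2 -(fineK Kfin) -EFinM => -[E]; congr EFin.
have pi0 : (2 * pi != 0 :> R)%R by rewrite mulf_neq0// gt_eqF// pi_gt0.
by apply: (mulIf pi0); rewrite -E; ring.
Qed.

End gaussian_mean.

Section gaussian_mean_holomorphic.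
Context {R : realType} {n : nat}.
Local Notation phase := 'rV[R]_(n + n).
Local Notation mu := (leb (n + n) \x leb (R := R) (n + n))%E.
Local Notation re := (@complex.Re R).
Local Notation im := (@complex.Im R).

Lemma continuous_measurable_pair (a : phase * phase -> R) :
  continuous a -> measurable_fun setT a.
Proof.
move=> ca.
have c1 : continuous (fun w : 'rV[R]_((n + n) + (n + n)) => a (lsubmx w, rsubmx w)).
  move=> w; apply: continuous_comp; last exact: ca.
  have l := differentiable_continuous (constant_diff_lsubmx w).1.
  have r := differentiable_continuous (constant_diff_rsubmx w).1.
  exact: (cvg_pair l r).
have -> : a = (fun w => a (lsubmx w, rsubmx w)) \o (fun p => row_mx p.1 p.2).
  by apply/funext => -[T Z] /=; rewrite row_mxKl row_mxKr.
apply: measurableT_comp; first exact: continuous_measurable_rV.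
by apply: measurable_row_mx; [exact: measurable_fst|exact: measurable_snd].
Qed.

Lemma jTZK (p : phase * phase) : jTZ (jTZ p) = - p.
Proof.
case: p => T Z; rewrite /jTZ /= !jrotZ !jrotK !scalerA.
by rewrite mulVf ?mulfV// !scale1r.
Qed.

Lemma jTZD (p q : phase * phase) : jTZ (p + q) = jTZ p + jTZ q.
Proof. by rewrite /jTZ /= !jrotD !scalerDr. Qed.

Lemma jTZZ a (p : phase * phase) : jTZ (a *: p) = a *: jTZ p.
Proof.
by rewrite /jTZ /= !jrotZ; congr pair; rewrite /= !scalerA mulrC.
Qed.

Definition cline (p0 p : phase * phase) (z : R * R) : phase * phase :=
  p0 + (z.1 *: p + z.2 *: jTZ p).

Lemma constant_diff_cline p0 p :
  has_constant_diff (cline p0 p) (fun z : R * R => 0 + (z.1 *: p + z.2 *: jTZ p)).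
Proof.
apply: constant_diffD; first exact: constant_diff_cst.
by apply: constant_diffD; apply: constant_diffZl; [exact: constant_diff_fst|exact: constant_diff_snd].
Qed.

Lemma jholo_cline (f : phase * phase -> R[i]) p0 p :
  jholo jTZ f -> jholo rot2 (f \o cline p0 p).
Proof.
apply: (jholo_comp (J := jTZ) (constant_diff_cline p0 p)).
by move=> v; rewrite !add0r jTZD !jTZZ jTZK scalerN /= scaleNr addrC.
Qed.

Lemma cline_polar p0 p t : cline p0 p (polar 1 t) = p0 + rotTZ (cos t) (sin t) p.
Proof. by rewrite /cline /polar /= !mul1r rotTZE. Qed.

Section at_point.
Variables (f : phase * phase -> R[i]) (c : R).
Hypothesis c0 : 0 < c.
Hypothesis fJ : jholo jTZ f.

Let polar_continuous (p0 p : phase * phase) :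
  continuous (fun t : R => p0 + rotTZ (cos t) (sin t) p).
Proof.
have -> : (fun t : R => p0 + rotTZ (cos t) (sin t) p) = cline p0 p \o polar 1.
  by apply/funext => t /=; rewrite cline_polar.
move=> t; apply: continuous_comp; last first.
  by apply: differentiable_continuous; exact: (constant_diff_cline p0 p _).1.
have c1 : {for t, continuous (fun t : R => 1 * cos t)}.
  by apply: cvgM; [exact: cvg_cst|exact: continuous_cos].
have c2 : {for t, continuous (fun t : R => 1 * sin t)}.
  by apply: cvgM; [exact: cvg_cst|exact: continuous_sin].
exact: (cvg_pair c1 c2).
Qed.

Lemma gaussian_mean_re p0 :
  mu.-integrable setT (fun p => (re (f (p0 + p)) * gweight c p)%:E) ->
  (\int[mu]_p (re (f (p0 + p)) * gweight c p)%:E = (re (f p0) * @gmass R n c)%:E)%E.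
Proof.
move=> int_f; have cf : continuous (re \o f) by apply: is_C1_continuous; exact: fJ.1.1.
have cfp : continuous (fun p => re (f (p0 + p))).
  move=> p; apply: (@continuous_comp _ _ _ (fun p => p0 + p) (re \o f)); last exact: cf.
  by apply: cvgD; [exact: cvg_cst|exact: cvg_id].
rewrite (@gaussian_mean R n (fun p => re (f (p0 + p))) c)// ?addr0//.
- exact: continuous_measurable_pair.
- move=> p; have [+ _] := circle_mean (jholo_cline p0 p fJ) ler01.
  rewrite /cline /= !scale0r !addr0 => <-.
  by apply: eq_Rintegral => t _; rewrite -cline_polar.
- move=> p; apply: continuous_compact_integrable; first exact: segment_compact.
  apply: continuous_subspaceT => t.
  by apply: (@continuous_comp _ _ _ (fun t : R => p0 + rotTZ (cos t) (sin t) p) (re \o f)); [exact: polar_continuous|exact: cf].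
Qed.

Lemma gaussian_mean_im p0 :
  mu.-integrable setT (fun p => (im (f (p0 + p)) * gweight c p)%:E) ->
  (\int[mu]_p (im (f (p0 + p)) * gweight c p)%:E = (im (f p0) * @gmass R n c)%:E)%E.
Proof.
move=> int_f; have cf : continuous (im \o f) by apply: is_C1_continuous; exact: fJ.1.2.
have cfp : continuous (fun p => im (f (p0 + p))).
  move=> p; apply: (@continuous_comp _ _ _ (fun p => p0 + p) (im \o f)); last exact: cf.
  by apply: cvgD; [exact: cvg_cst|exact: cvg_id].
rewrite (@gaussian_mean R n (fun p => im (f (p0 + p))) c)// ?addr0//.
- exact: continuous_measurable_pair.
- move=> p; have [_ +] := circle_mean (jholo_cline p0 p fJ) ler01.
  rewrite /cline /= !scale0r !addr0 => <-.
  by apply: eq_Rintegral => t _; rewrite -cline_polar.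
- move=> p; apply: continuous_compact_integrable; first exact: segment_compact.
  apply: continuous_subspaceT => t.
  by apply: (@continuous_comp _ _ _ (fun t : R => p0 + rotTZ (cos t) (sin t) p) (im \o f)); [exact: polar_continuous|exact: cf].
Qed.

End at_point.

(** A function of one complex variable that vanishes on a line is 0; the complex
    lines that meet the real subspace in a real line cover the whole space. *)
Lemma jholo_real_subspace_zero (f : phase * phase -> R[i]) :
  jholo jTZ f -> (forall T, f (T, 0) = 0) -> f = fun=> 0.
Proof.
move=> fJ f0; apply/funext => -[T Z].
(* the point (T, Z) is (T, 0) + i (U, 0) with J (U, 0) = (0, Z) *)
pose U : phase := - (2^-1 *: jrot Z).
have := jholo_real_line_zero (jholo_cline (T, 0) (U, 0) fJ).
have jU : jTZ (U, 0) = (0, Z).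
  rewrite /jTZ /U /= jrotN jrotZ jrotK !scalerN opprK scalerA mulfV// scale1r.
  by rewrite -(scale0r 0) jrotZ !scale0r scaler0.
move=> h; transitivity ((f \o cline (T, 0) (U, 0)) (0, 1)).
  congr f; rewrite /cline jU; congr pair; rewrite /= ?scale0r ?scale1r ?scaler0 ?addr0 ?add0r//.
apply: h => s; rewrite /= /cline jU -(f0 (T + s *: U)); congr f.
by congr pair; rewrite /= ?scale0r ?scaler0 ?addr0.
Qed.

End gaussian_mean_holomorphic.

(** * Real-analytic functions are continuously differentiable *)

Section cube_sums.
Context {R : realType} (m : nat).
Local Notation multi := {ffun 'I_m -> nat}.
Local Open Scope ereal_scope.

Definition of_cube N (a : {ffun 'I_m -> 'I_N}) : multi := [ffun i => val (a i)].

Lemma of_cube_inj N : injective (@of_cube N).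
Proof.
move=> a b /ffunP ab; apply/ffunP => i; apply/val_inj.
by have := ab i; rewrite !ffunE.
Qed.

Lemma fsbig_cube N (g : multi -> \bar R) :
  \sum_(x \in range (@of_cube N)) g x = \sum_(a : {ffun 'I_m -> 'I_N}) g (of_cube a).
Proof.
rewrite fsbig_image; last by move=> a b _ _; exact: of_cube_inj.
rewrite -[RHS]big_enum /= [RHS](fsbig_seq _ _ (enum_uniq _)).
by apply: eq_fsbigl; apply/seteqP; split=> a //= _; rewrite mem_enum.
Qed.

Lemma finite_range_cube N : finite_set (range (@of_cube N)).
Proof. by apply: finite_image. Qed.

Lemma cube_sum_le_esum N (g : multi -> \bar R) : (forall a, 0 <= g a) ->
  \sum_(a : {ffun 'I_m -> 'I_N}) g (of_cube a) <= \esum_(a in [set: multi]) g a.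
Proof.
move=> g0; rewrite -fsbig_cube; apply: ereal_sup_ubound.
by exists (range (@of_cube N)) => //; split; [exact: finite_range_cube|].
Qed.

Lemma esum_le_cube_sums (g : multi -> \bar R) (S : \bar R) : (forall a, 0 <= g a) ->
  (forall N, \sum_(a : {ffun 'I_m -> 'I_N}) g (of_cube a) <= S) ->
  \esum_(a in [set: multi]) g a <= S.
Proof.
move=> g0 gS; apply: ub_ereal_sup => _ [A [finA _] <-].
pose N := (\max_(x <- finmap.enum_fset (fset_set A)) \max_i x i).+1.
apply: le_trans (gS N); rewrite -fsbig_cube.
apply: lee_fsum_nneg_subset => //; first exact: finite_range_cube.
move=> x; rewrite !inE => Ax.
have xN i : (x i < N)%N.
  rewrite ltnS; apply: leq_trans (leq_bigmax i) _.
  by apply: (leq_bigmax_seq x) => //; rewrite in_fset_set// inE.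
exists [ffun i => Ordinal (xN i)] => //.
by apply/ffunP => i; rewrite !ffunE.
Qed.

End cube_sums.

Section sup_norm.
Context {R : realType} (m : nat).

Lemma coord_le_norm (v : 'rV[R]_m) i : `|v 0 i| <= `|v|.
Proof.
rewrite [leRHS]/Num.norm /= mx_normrE.
exact: (le_bigmax _ (fun ij : 'I_1 * 'I_m => `|v ij.1 ij.2|) (ord0, i)).
Qed.

End sup_norm.

Section monomials.
Context {R : realType} (m : nat).
Local Notation multi := {ffun 'I_m -> nat}.

Definition mon (v : 'rV[R]_m) (a : multi) : R := \prod_i v 0 i ^+ a i.

Definition rmon (r : R) (a : multi) : R := \prod_i r ^+ a i.

Definition unit_index (j : 'I_m) : multi := [ffun i => (i == j) : nat].

Lemma rmon_ge0 r a : 0 <= r -> 0 <= rmon r a.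
Proof. by move=> r0; apply: prodr_ge0 => i _; rewrite exprn_ge0. Qed.

Lemma rmonE r a : rmon r a = r ^+ (\sum_i a i).
Proof. by rewrite /rmon -expr_sum. Qed.

Lemma mon_le_rmon (v : 'rV[R]_m) r a : (forall i, `|v 0 i| <= r) -> `|mon v a| <= rmon r a.
Proof.
move=> vr; rewrite /mon normr_prod; apply: ler_prod => i _.
by rewrite normr_ge0 normrX /= lerXn2r ?nnegrE ?normr_ge0// (le_trans _ (vr i)).
Qed.

Lemma mon0 v : mon v [ffun=> 0%N] = 1.
Proof. by rewrite /mon big1// => i _; rewrite ffunE. Qed.

Lemma mon_unit v j : mon v (unit_index j) = v 0 j.
Proof.
rewrite /mon (bigD1 j)//= ffunE eqxx expr1 big1 ?mulr1// => i ij.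
by rewrite ffunE (negbTE ij).
Qed.

Lemma unit_index_inj : injective unit_index.
Proof.
move=> i j /ffunP /(_ i); rewrite !ffunE eqxx.
by case: eqP.
Qed.

Variant multi_spec (b : multi) : Type :=
  | MultiZero of b = [ffun=> 0%N]
  | MultiUnit k of b = unit_index k
  | MultiHigh of (1 < \sum_i b i)%N & b != [ffun=> 0%N] & (forall j, b != unit_index j).

Lemma multiP b : multi_spec b.
Proof.
have [|b0] := eqVneq b [ffun=> 0%N]; first exact: MultiZero.
have [k /eqP|bu] := pickP (fun k => b == unit_index k); first exact: MultiUnit.
apply: MultiHigh => //; last by move=> j; rewrite bu.
rewrite ltn_neqAle lt0n; apply/andP; split.
  apply/negP; rewrite eq_sym => /eqP /esym/eqP; rewrite eq_sym => /sum_nat_eq1[k [_ bk bj]].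
  have := bu k; rewrite (_ : b = unit_index k) ?eqxx//.
  by apply/ffunP => i; rewrite ffunE; case: eqP => [->//|/eqP ik]; rewrite bj.
apply: contra b0; rewrite sum_nat_eq0 => /forallP b0.
by apply/eqP/ffunP => i; rewrite ffunE; apply/eqP; exact: (implyP (b0 i)).
Qed.

Definition affine_part (v : 'rV[R]_m) (b : multi) : R :=
  (b == [ffun=> 0%N])%:R + \sum_j (b == unit_index j)%:R * v 0 j.

(** A monomial of degree 0 or 1 is equal to its affine part; the others have
    degree at least 2 and gain a factor s^2 when the polydisc shrinks by s. *)
Lemma mon_affine_remainder (v : 'rV[R]_m) b r s : 0 <= r -> 0 <= s <= 1 ->
  (forall i, `|v 0 i| <= s * r) ->
  `|mon v b - affine_part v b| <= s ^+ 2 * rmon r b.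
Proof.
move=> r0 /andP[s0 s1] vr.
have s2r : 0 <= s ^+ 2 * rmon r b by rewrite mulr_ge0 ?rmon_ge0// sqr_ge0.
have u0 j : ([ffun=> 0%N] : multi) == unit_index j = false.
  by apply/eqP => /ffunP /(_ j); rewrite !ffunE eqxx.
rewrite /affine_part; case: (multiP b) s2r => [->|k ->|bh b0 bu] s2r.
- rewrite mon0 eqxx big1 ?addr0 ?subrr ?normr0// => j _.
  by rewrite u0 mul0r.
- rewrite mon_unit eq_sym u0 add0r (bigD1 k)//= eqxx mul1r big1; last first.
    by move=> j jk; rewrite (inj_eq unit_index_inj) eq_sym (negbTE jk) mul0r.
  by rewrite addr0 subrr normr0.
rewrite (negbTE b0) add0r big1; last by move=> j _; rewrite (negbTE (bu j)) mul0r.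
rewrite subr0; apply: le_trans (mon_le_rmon _ vr) _.
rewrite !rmonE exprMn ler_wpM2r ?exprn_ge0//.
exact: ler_wiXn2l.
Qed.

Lemma cube_pick N (b : multi) (F : multi -> R) : (forall i, (b i < N)%N) ->
  \sum_(a : {ffun 'I_m -> 'I_N}) F (of_cube a) * (of_cube a == b)%:R = F b.
Proof.
move=> bN; pose a : {ffun 'I_m -> 'I_N} := [ffun i => Ordinal (bN i)].
have ab : of_cube a = b by apply/ffunP => i; rewrite !ffunE.
rewrite (bigD1 a)//= ab eqxx mulr1 big1 ?addr0// => a' a'a.
by rewrite -ab (inj_eq (@of_cube_inj m N)) (negbTE a'a) mulr0.
Qed.

Lemma cube_affine_part N (F : multi -> R) (v : 'rV[R]_m) : (1 < N)%N ->
  \sum_(a : {ffun 'I_m -> 'I_N}) F (of_cube a) * affine_part v (of_cube a) =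
  F [ffun=> 0%N] + \sum_j F (unit_index j) * v 0 j.
Proof.
move=> N1; have N0 := ltnW N1.
under eq_bigr do rewrite mulrDr mulr_sumr.
rewrite big_split /= cube_pick; last by move=> i; rewrite ffunE.
congr (_ + _); rewrite exchange_big /=; apply: eq_bigr => j _.
under eq_bigr do rewrite mulrA.
rewrite -mulr_suml cube_pick// => i; rewrite ffunE.
by case: eqP.
Qed.

End monomials.

Section second_order_class.
Context {R : realType} (s : R).
Hypothesis s1 : 1 <= s.

(** Functions with a second-order expansion at 0 whose coefficients, weighted
    by powers of [s], add up to at most [A]. These majorants multiply
    ([quadraticM]), so the majorant of a monomial along a segment is the
    monomial of the majorants of its coordinates. *)
Definition quadratic (phi : R -> R) (A : R) : Prop :=
  exists phi0 phi1 A0 A1 A2, [/\ `|phi0| <= A0, `|phi1| <= A1, 0 <= A2,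
    forall t, `|t| <= 1 -> `|phi t - phi0 - t * phi1| <= t ^+ 2 * A2 &
    A0 + s * A1 + s ^+ 2 * A2 <= A].

Let s0 : 0 <= s. Proof. exact: le_trans s1. Qed.

Lemma quadratic_affine x y : quadratic (fun t => x + t * y) (`|x| + s * `|y|).
Proof.
exists x, y, `|x|, `|y|, 0; split => // [t _|]; last by rewrite mulr0 addr0.
by rewrite (_ : x + t * y - x - t * y = 0) ?normr0 ?mulr0//; ring.
Qed.

Lemma quadratic_cst x : quadratic (fun=> x) `|x|.
Proof.
exists x, 0, `|x|, 0, 0; split => // [|t _|]; first by rewrite normr0.
  by rewrite subrr mulr0 subr0 normr0 mulr0.
by rewrite !mulr0 !addr0.
Qed.

Lemma quadraticD phi psi A B : quadratic phi A -> quadratic psi B ->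
  quadratic (fun t => phi t + psi t) (A + B).
Proof.
move=> [x0 [x1 [A0 [A1 [A2 [hx0 hx1 A20 hx hA]]]]]].
move=> [y0 [y1 [B0 [B1 [B2 [hy0 hy1 B20 hy hB]]]]]].
exists (x0 + y0), (x1 + y1), (A0 + B0), (A1 + B1), (A2 + B2); split.
- by rewrite (le_trans (ler_normD _ _))// lerD.
- by rewrite (le_trans (ler_normD _ _))// lerD.
- by rewrite addr_ge0.
- move=> t t1; rewrite (_ : _ - _ = (phi t - x0 - t * x1) + (psi t - y0 - t * y1)); last by ring.
  by rewrite (le_trans (ler_normD _ _))// mulrDr lerD ?hx ?hy.
- by apply: le_trans (lerD hA hB); rewrite le_eqVlt; apply/orP; left; apply/eqP; ring.
Qed.

Lemma quadraticM phi psi A B : quadratic phi A -> quadratic psi B ->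
  quadratic (fun t => phi t * psi t) (A * B).
Proof.
move=> [x0 [x1 [A0 [A1 [A2 [hx0 hx1 A20 hx hA]]]]]].
move=> [y0 [y1 [B0 [B1 [B2 [hy0 hy1 B20 hy hB]]]]]].
have A00 := le_trans (normr_ge0 _) hx0.
have A10 := le_trans (normr_ge0 _) hx1.
have B00 := le_trans (normr_ge0 _) hy0.
have B10 := le_trans (normr_ge0 _) hy1.
exists (x0 * y0), (x0 * y1 + x1 * y0), (A0 * B0), (A0 * B1 + A1 * B0),
  (A1 * B1 + A0 * B2 + A2 * B0 + A1 * B2 + A2 * B1 + A2 * B2); split.
- by rewrite normrM ler_pM.
- by rewrite (le_trans (ler_normD _ _))// !normrM lerD// ler_pM.
- by rewrite !addr_ge0 ?mulr_ge0.
- move=> t t1; have {}hx := hx t t1; have {}hy := hy t t1.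
  set rx := phi t - x0 - t * x1 in hx *; set ry := psi t - y0 - t * y1 in hy *.
  have -> : phi t * psi t - x0 * y0 - t * (x0 * y1 + x1 * y0) =
    t ^+ 2 * (x1 * y1) + x0 * ry + rx * y0 + t * x1 * ry + rx * (t * y1) + rx * ry.
    by rewrite /rx /ry; ring.
  have t2 : 0 <= t ^+ 2 by exact: sqr_ge0.
  have t21 : t ^+ 2 <= 1 by rewrite -real_normK ?num_real// expr_le1.
  clearbody rx ry; have ry2 : `|ry| <= B2 by rewrite (le_trans hy)// ler_piMl.
  have ty1 : `|t * y1| <= B1 by rewrite normrM (le_trans _ hy1)// ler_piMl.
  have tx1 : `|t * x1| <= A1 by rewrite normrM (le_trans _ hx1)// ler_piMl.
  rewrite [leRHS](_ : _ = t ^+ 2 * (A1 * B1) + A0 * (t ^+ 2 * B2) + (t ^+ 2 * A2) * B0 +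
    A1 * (t ^+ 2 * B2) + (t ^+ 2 * A2) * B1 + (t ^+ 2 * A2) * B2); last by ring.
  do 5 (apply: le_trans (ler_normD _ _) _; apply: lerD; last by rewrite normrM ler_pM).
  by rewrite normrM (ger0_norm t2) ler_wpM2l// normrM ler_pM.
apply: le_trans (ler_pM _ _ hA hB); first last.
- by rewrite !addr_ge0 ?mulr_ge0 ?exprn_ge0.
- by rewrite !addr_ge0 ?mulr_ge0 ?exprn_ge0.
rewrite -subr_ge0.
have -> : (A0 + s * A1 + s ^+ 2 * A2) * (B0 + s * B1 + s ^+ 2 * B2) -
  (A0 * B0 + s * (A0 * B1 + A1 * B0) +
   s ^+ 2 * (A1 * B1 + A0 * B2 + A2 * B0 + A1 * B2 + A2 * B1 + A2 * B2)) =
  s ^+ 2 * ((s - 1) * (A1 * B2) + (s - 1) * (A2 * B1) + (s ^+ 2 - 1) * (A2 * B2)) by ring.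
have s2 : 0 <= s ^+ 2 - 1 by rewrite subr_ge0 exprn_ege1.
have s1' : 0 <= s - 1 by rewrite subr_ge0.
by rewrite mulr_ge0 ?sqr_ge0// !addr_ge0// !mulr_ge0.
Qed.

Lemma quadraticX phi A k : quadratic phi A -> quadratic (fun t => phi t ^+ k) (A ^+ k).
Proof.
move=> q; elim: k => [|k IH].
  by have := quadratic_cst 1; rewrite normr1.
under eq_fun do rewrite exprS; rewrite exprS.
exact: quadraticM.
Qed.

Lemma quadratic_prod I (r : seq I) (phi : I -> R -> R) A :
  (forall i, quadratic (phi i) (A i)) ->
  quadratic (fun t => \prod_(i <- r) phi i t) (\prod_(i <- r) A i).
Proof.
move=> q; elim: r => [|i r IH].
  by under eq_fun do rewrite big_nil; have := quadratic_cst 1; rewrite normr1 big_nil.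
under eq_fun do rewrite big_cons; rewrite big_cons.
exact: quadraticM.
Qed.

Lemma quadratic_sum I (r : seq I) (phi : I -> R -> R) A :
  (forall i, quadratic (phi i) (A i)) ->
  quadratic (fun t => \sum_(i <- r) phi i t) (\sum_(i <- r) A i).
Proof.
move=> q; elim: r => [|i r IH].
  by under eq_fun do rewrite big_nil; have := quadratic_cst 0; rewrite normr0 big_nil.
under eq_fun do rewrite big_cons; rewrite big_cons.
exact: quadraticD.
Qed.

Lemma quadratic_secant phi A t : quadratic phi A -> `|t| <= 1 ->
  `|t * (phi 1 - phi 0) - (phi t - phi 0)| <= `|t| * (2 * (A / s ^+ 2)).
Proof.
move=> [x0 [x1 [A0 [A1 [A2 [hx0 hx1 A20 hx hA]]]]]] t1.
have p0 : phi 0 = x0.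
  have := hx 0; rewrite normr0 expr0n !mul0r subr0 => /(_ ler01).
  by rewrite normr_le0 subr_eq0 => /eqP.
have A2A : A2 <= A / s ^+ 2.
  rewrite ler_pdivlMr ?exprn_gt0 ?(lt_le_trans ltr01)// mulrC (le_trans _ hA)// lerDr.
  by rewrite addr_ge0 ?mulr_ge0// ?(le_trans _ hx0) ?(le_trans _ hx1).
have h1 := hx 1; have ht := hx t t1; rewrite normr1 in h1.
rewrite p0 (_ : _ - _ = t * (phi 1 - x0 - 1 * x1) - (phi t - x0 - t * x1)); last by ring.
apply: le_trans (ler_normB _ _) _.
move: (A / s ^+ 2) A2A => q A2A.
rewrite normrM [leRHS](_ : _ = `|t| * q + `|t| * q); last by ring.
apply: lerD.
  by rewrite ler_wpM2l// (le_trans (h1 _))// expr1n mul1r.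
apply: le_trans ht _; apply: le_trans (_ : `|t| * A2 <= _); last by rewrite ler_wpM2l.
by rewrite ler_wpM2r// -real_normK ?num_real// expr2 ler_piMl.
Qed.

End second_order_class.

Section power_series.
Context {R : realType} (m : nat).
Local Notation multi := {ffun 'I_m -> nat}.

Definition cube_partial_sum (c : multi -> R) (v : 'rV[R]_m) (N : nat) : R :=
  \sum_(a : {ffun 'I_m -> 'I_N}) c (of_cube a) * mon v (of_cube a).

Definition power_series_at (f : 'rV[R]_m -> R) (p : 'rV[R]_m) (c : multi -> R) (r : R) :=
  [/\ 0 < r, (\esum_(a in [set: multi]) (`|c a| * rmon r a)%:E < +oo)%E &
    forall v : 'rV[R]_m, (forall i, `|v 0 i| < r) ->
      cube_partial_sum c v N @[N --> \oo] --> f (p + v)].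

Lemma real_analyticP (f : 'rV[R]_m -> R) :
  real_analytic f <-> forall p, exists c r, power_series_at f p c r.
Proof.
have E c v : (fun N => cube_partial_sum c v N) = (fun N => \sum_(a : {ffun 'I_m -> 'I_N})
    c [ffun i => val (a i)] * \prod_i v 0 i ^+ a i).
  apply/funext => N; apply: eq_bigr => a _; congr (_ * _).
  by apply: eq_bigr => i _; rewrite ffunE.
split=> h p; have [c [r [r0 fin cv]]] := h p; exists c, r; split=> // v vr.
  by rewrite E; exact: cv.
by rewrite -E; exact: cv.
Qed.

Section at_point.
Variables (f : 'rV[R]_m -> R) (p : 'rV[R]_m) (c : multi -> R) (r : R).
Hypothesis pf : power_series_at f p c r.

Let r0 : 0 < r. Proof. by case: pf. Qed.

Definition abs_sum : R := fine (\esum_(a in [set: multi]) (`|c a| * rmon r a)%:E)%E.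

Lemma cube_abs_sum_le N :
  \sum_(a : {ffun 'I_m -> 'I_N}) `|c (of_cube a)| * rmon r (of_cube a) <= abs_sum.
Proof.
have g0 (a : multi) : (0 <= (`|c a| * rmon r a)%:E)%E.
  by rewrite lee_fin mulr_ge0// rmon_ge0// ltW.
have [_ fin _] := pf.
have := @cube_sum_le_esum R m N (fun a => (`|c a| * rmon r a)%:E) g0.
rewrite sumEFin -[X in (_ <= X)%E]fineK; last first.
  by rewrite ge0_fin_numE// esum_ge0.
by rewrite lee_fin.
Qed.

Lemma abs_sum_ge0 : 0 <= abs_sum.
Proof. by rewrite fine_ge0// esum_ge0// => a _; rewrite lee_fin mulr_ge0// rmon_ge0// ltW. Qed.

Lemma power_series_centre0 : c [ffun=> 0%N] = f p.
Proof.
have [_ _ cv] := pf.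
have h0 : forall i, `|(0 : 'rV[R]_m) 0 i| < r by move=> i; rewrite mxE normr0.
have := cv 0 h0; rewrite addr0 => cv0.
have cv1 : cube_partial_sum c 0 N @[N --> \oo] --> c [ffun=> 0%N].
  apply: cvg_near_cst; near=> N.
  have N1 : (1 < N)%N by near: N; exact: nbhs_infty_gt.
  transitivity (c [ffun=> 0%N] + \sum_j c (unit_index j) * (0 : 'rV[R]_m) 0 j).
    rewrite -(@cube_affine_part _ _ N)//; apply: eq_bigr => a _; congr (_ * _).
    apply/eqP; rewrite -subr_eq0 -normr_le0.
    have := @mon_affine_remainder R m 0 (of_cube a) r 0 (ltW r0).
    move=> h; apply: le_trans (h _ _) _; first by rewrite lexx ler01.
      by move=> i; rewrite mxE normr0 mul0r.
    by rewrite expr0n mul0r.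
  by rewrite big1 ?addr0// => j _; rewrite mxE mulr0.
exact: (cvg_unique _ cv1 cv0).
Unshelve. all: by end_near. Qed.

Lemma power_series_centre s (v : 'rV[R]_m) : 0 <= s < 1 -> (forall i, `|v 0 i| <= s * r) ->
  `|f (p + v) - f p - \sum_j c (unit_index j) * v 0 j| <= s ^+ 2 * abs_sum.
Proof.
move=> /andP[s0 s1] vs; have [_ _ cv] := pf.
have vr i : `|v 0 i| < r.
  by rewrite (le_lt_trans (vs i))// gtr_pMl.
have cv1 : (`|cube_partial_sum c v N - f p - \sum_j c (unit_index j) * v 0 j|)
    @[N --> \oo] --> `|f (p + v) - f p - \sum_j c (unit_index j) * v 0 j|.
  apply: cvg_norm; apply: cvgB; last exact: cvg_cst.
  by apply: cvgB; [exact: cv|exact: cvg_cst].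
apply: (cvgr_to_le cv1); near=> N.
have N1 : (1 < N)%N by near: N; exact: nbhs_infty_gt.
rewrite -power_series_centre0 -addrA -opprD -(@cube_affine_part _ _ N)// -sumrB.
apply: le_trans (ler_norm_sum _ _ _) _.
apply: (@le_trans _ _ (s ^+ 2 * \sum_(a : {ffun 'I_m -> 'I_N}) `|c (of_cube a)| * rmon r (of_cube a))).
  rewrite mulr_sumr; apply: ler_sum => a _.
  rewrite -mulrBr normrM mulrCA ler_wpM2l// mon_affine_remainder//; first exact: ltW.
  by rewrite s0 ltW.
by rewrite ler_wpM2l ?sqr_ge0// cube_abs_sum_le.
Unshelve. all: by end_near. Qed.

Definition linear_part (v : 'rV[R]_m) : R := \sum_j c (unit_index j) * v 0 j.

Lemma power_series_differentiable :
  differentiable f p /\ forall v, 'D_v f p = linear_part v.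
Proof.
have lL : linear linear_part.
  move=> a u v; rewrite /linear_part scaler_sumr -big_split /=.
  by apply: eq_bigr => j _; rewrite !mxE mulrDr [in RHS]/GRing.scale /= mulrCA.
pose LM := GRing.isLinear.Build _ _ _ _ _ lL.
pose L : {linear 'rV[R]_m -> R} := HB.pack linear_part LM.
apply: (@near_differentiable R _ f L).
  have cd : has_constant_diff linear_part linear_part.
    by apply: constant_diff_sum => j; apply: constant_diffZ; exact: constant_diff_coord.
  by move=> v; apply: differentiable_continuous; exact: (cd v).1.
move=> e e0; have S0 := abs_sum_ge0.
exists (Num.min r (e * r ^+ 2 / (abs_sum + 1))).
  by rewrite lt_min r0 divr_gt0 ?mulr_gt0 ?exprn_gt0// ltr_pwDr.
move=> w; rewrite lt_min => /andP[wr we].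
have h := @power_series_centre (`|w| / r) w.
rewrite [w + p]addrC (le_trans (h _ _))//.
- by rewrite divr_ge0 ?(ltW r0)//= ltr_pdivrMr// mul1r.
- by move=> i; rewrite divfK ?gt_eqF// coord_le_norm.
rewrite expr_div_n mulrAC expr2 -!mulrA [leRHS]mulrC ler_wpM2l//.
rewrite mulrA ler_pdivrMr ?exprn_gt0//.
move: we; rewrite ltr_pdivlMr ?ltr_pwDr// => /ltW; apply: le_trans.
by rewrite ler_wpM2l// lerDl.
Qed.

(** The majorants of the monomials along the segment from u to u + w are taken
    with the largest weight [s] that the polydisc allows. Their sum is then the
    absolute sum of the series, which makes the estimate uniform in u. *)
Lemma power_series_secant u w t : `|u| <= r / 4 -> `|w| <= r / 2 -> `|t| <= 1 ->
  `|t * (f (p + (u + w)) - f (p + u)) - (f (p + (u + t *: w)) - f (p + u))|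
    <= `|t| * (8 * abs_sum / r ^+ 2 * `|w| ^+ 2).
Proof.
move=> ur wr t1; have [_ _ cv] := pf.
have [->|w0] := eqVneq w 0.
  rewrite scaler0 addr0 subrr mulr0 subr0 normr0.
  by rewrite mulr_ge0// normr0 expr0n mulr0.
have wp : 0 < `|w| by rewrite normr_gt0.
pose s := r / 2 / `|w|.
have s1 : 1 <= s by rewrite /s ler_pdivlMr// mul1r.
have inr k : `|k| <= 1 -> forall i, `|(u + k *: w) 0 i| < r.
  move=> k1 i; rewrite !mxE (le_lt_trans (ler_normD _ _))// normrM.
  have hu := le_trans (coord_le_norm u i) ur.
  have hw := le_trans (coord_le_norm w i) wr.
  have : `|k| * `|w 0 i| <= r / 2 by rewrite (le_trans _ hw)// ler_piMl.
  by move: r0 hu; lra.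
pose P k N := cube_partial_sum c (u + k *: w) N.
have cvP k : `|k| <= 1 -> P k N @[N --> \oo] --> f (p + (u + k *: w)).
  by move=> k1; apply: cv; exact: inr.
have cv1 := cvP 1 (eq_ind_r (fun x => x <= 1) (lexx _) (normr1 _)).
have cv0 := cvP 0 (eq_ind_r (fun x => x <= 1) ler01 (normr0 _)).
rewrite scale1r in cv1; rewrite scale0r addr0 in cv0.
have cvt := cvP t t1.
have cvl : (`|t * (P 1 N - P 0 N) - (P t N - P 0 N)|) @[N --> \oo] -->
    `|t * (f (p + (u + w)) - f (p + u)) - (f (p + (u + t *: w)) - f (p + u))|.
  apply: cvg_norm; apply: cvgB; last exact: cvgB.
  by apply: cvgM; [exact: cvg_cst|exact: cvgB].
apply: (cvgr_to_le cvl); near=> N.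
have q (a : {ffun 'I_m -> 'I_N}) : quadratic s
    (fun k => c (of_cube a) * mon (u + k *: w) (of_cube a))
    (`|c (of_cube a)| * \prod_i (`|u 0 i| + s * `|w 0 i|) ^+ of_cube a i).
  apply: (quadraticM s1); first exact: quadratic_cst.
  rewrite /mon; apply: (quadratic_prod s1) => i; apply: (quadraticX s1).
  rewrite (_ : (fun k => _) = fun k => u 0 i + k * w 0 i); first exact: quadratic_affine.
  by apply/funext => k; rewrite !mxE.
have := quadratic_sum (index_enum _) q => {}q.
apply: le_trans (quadratic_secant s1 q t1) _.
rewrite ler_wpM2l// /s.
set A := \sum_(a <- _) _.
have AS : A <= abs_sum.
  apply: le_trans (cube_abs_sum_le N); apply: ler_sum => a _.
  rewrite ler_wpM2l// /rmon; apply: ler_prod => i _.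
  have ui := le_trans (coord_le_norm u i) ur.
  have wi : s * `|w 0 i| <= r / 2.
    by rewrite /s mulrAC ler_pdivrMr// ler_wpM2l ?coord_le_norm// divr_ge0// ltW.
  rewrite exprn_ge0 /=; last by rewrite addr_ge0// mulr_ge0// (le_trans ler01).
  apply: lerXn2r; rewrite ?nnegrE; [|exact: ltW|by move: r0 ui wi; rewrite /s; lra].
  by rewrite addr_ge0// mulr_ge0// (le_trans ler01).
rewrite [leRHS](_ : _ = 2 * (abs_sum / (r / 2 / `|w|) ^+ 2)); last first.
  by field; rewrite !gt_eqF.
by rewrite ler_wpM2l// ler_wpM2r// invr_ge0 exprn_ge0// (le_trans ler01).
Unshelve. all: by end_near. Qed.

Let K := 8 * abs_sum / r ^+ 2.

Let K0 : 0 <= K. Proof. by rewrite divr_ge0 ?mulr_ge0 ?abs_sum_ge0 ?exprn_ge0 ?(ltW r0). Qed.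

Hypothesis df : forall x, differentiable f x.

Lemma power_series_taylor2 u w : `|u| <= r / 4 -> `|w| <= r / 2 ->
  `|f (p + (u + w)) - f (p + u) - 'D_w f (p + u)| <= K * `|w| ^+ 2.
Proof.
move=> ur wr; have dv : derivable f (p + u) w by exact: diff_derivable.
have cv1 : (`|f (p + (u + w)) - f (p + u) -
     h^-1 *: ((f \o shift (p + u)) (h *: w) - f (p + u))|) @[h --> 0^'] -->
   `|f (p + (u + w)) - f (p + u) - 'D_w f (p + u)|.
  by apply: cvg_norm; apply: cvgB; [exact: cvg_cst|exact: dv].
apply: (cvgr_to_le cv1); near=> h.
have h0 : h != 0 by near: h; exact: nbhs_dnbhs_neq.
have h1 : `|h| <= 1 by near: h; apply: dnbhs0_le; exact: ltr01.
have H := power_series_secant ur wr h1; rewrite -/K in H.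
have hp : 0 < `|h| by rewrite normr_gt0.
rewrite -(ler_pM2l hp) -normrM; apply: le_trans H; rewrite le_eqVlt; apply/orP; left.
rewrite mulrBr [h^-1 *: _]/GRing.scale /= mulrA mulfV// mul1r.
by rewrite (addrC (h *: w)) -addrA.
Unshelve. all: by end_near. Qed.

(** The uniform Taylor estimate at p and at p + u is applied to an increment
    along [v] of the same length as [u]. *)
Lemma power_series_derive_lipschitz u v : `|u| <= r / 8 ->
  `|'D_v f (p + u) - 'D_v f p| <= 6 * K * `|u| * `|v|.
Proof.
move=> ur; have [->|v0] := eqVneq v 0; first by rewrite !derive0 subrr !normr0 mulr0.
have [->|u0] := eqVneq u 0; first by rewrite addr0 subrr !normr0 mulr0 mul0r.
have vp : 0 < `|v| by rewrite normr_gt0.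
have up : 0 < `|u| by rewrite normr_gt0.
pose k := `|u| / `|v|; have kp : 0 < k by rewrite divr_gt0.
have yn : `|k *: v| = `|u| by rewrite normrZ gtr0_norm// divfK// gt_eqF.
have h0 : `|(0 : 'rV[R]_m)| <= r / 4 by rewrite normr0 divr_ge0// ltW.
have E1 : `|f (p + (u + k *: v)) - f (p + u) - 'D_(k *: v) f (p + u)| <= K * `|u| ^+ 2.
  by have := @power_series_taylor2 u (k *: v); rewrite yn; apply; move: r0 ur; lra.
have E2 : `|f (p + (u + k *: v)) - f p - 'D_(u + k *: v) f p| <= K * (2 * `|u|) ^+ 2.
  have uv : `|u + k *: v| <= 2 * `|u|.
    by rewrite (le_trans (ler_normD _ _))// yn; lra.
  have := @power_series_taylor2 0 (u + k *: v) h0; rewrite add0r addr0 => H.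
  apply: le_trans (H _) _; first by move: r0 ur uv; lra.
  by rewrite ler_wpM2l// lerXn2r ?nnegrE// mulr_ge0.
have E3 : `|f (p + u) - f p - 'D_u f p| <= K * `|u| ^+ 2.
  have := @power_series_taylor2 0 u h0; rewrite add0r addr0; apply.
  by move: r0 ur; lra.
have : k * `|'D_v f (p + u) - 'D_v f p| <= K * 6 * `|u| ^+ 2.
  rewrite -[k in X in X <= _]gtr0_norm// -normrM mulrBr -!deriveZl//.
  have -> : 'D_(k *: v) f p = 'D_(u + k *: v) f p - 'D_u f p.
    by rewrite deriveDl// addrAC subrr add0r.
  set D1 := 'D_(k *: v) _ _ in E1 *; set D2 := 'D_(u + k *: v) _ _ in E2 *.
  set D3 := 'D_u _ _ in E3 *.
  rewrite (_ : _ - _ = (f (p + (u + k *: v)) - f p - D2) -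
    (f (p + (u + k *: v)) - f (p + u) - D1) - (f (p + u) - f p - D3)); last by ring.
  apply: le_trans (ler_normB _ _) _.
  apply: le_trans (lerD (le_trans (ler_normB _ _) (lerD E2 E1)) E3) _.
  by rewrite le_eqVlt; apply/orP; left; apply/eqP; ring.
rewrite /k mulrAC ler_pdivrMr// => H.
rewrite -(ler_pM2l up) (le_trans H)// le_eqVlt; apply/orP; left; apply/eqP; ring.
Qed.

End at_point.

Lemma real_analytic_C1 (f : 'rV[R]_m -> R) : real_analytic f -> is_C1 f.
Proof.
move=> /real_analyticP fa.
have df p : differentiable f p.
  by have [c [r pf]] := fa p; have [] := power_series_differentiable pf.
split=> // v p; have [c [r pf]] := fa p.
have r0 : 0 < r by case: pf.
set L := 6 * (8 * abs_sum c r / r ^+ 2) * `|v|.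
have L0 : 0 <= L.
  by rewrite mulr_ge0// mulr_ge0// divr_ge0 ?exprn_ge0 ?(ltW r0)// mulr_ge0// (abs_sum_ge0 pf).
apply/(@cvgrPdist_le R R 'rV[R]_m (nbhs p)) => e e0; apply/nbhs_ballP.
exists (Num.min (r / 8) (e / (L + 1))).
  by rewrite /= lt_min !divr_gt0// ltr_pwDr.
move=> x; rewrite -ball_normE /= lt_min => /andP[xr xe].
have := @power_series_derive_lipschitz f p c r pf df (x - p) v.
rewrite [p + _]addrC subrK distrC [`|'D_v f x - _|]distrC => h.
apply: le_trans (h (ltW xr)) _.
rewrite mulrAC -/L; move: xe; rewrite ltr_pdivlMr ?ltr_pwDr// => /ltW; apply: le_trans.
by rewrite mulrC ler_wpM2l// lerDl.
Qed.

Lemma real_analytic_derive_unit (f : 'rV[R]_m -> R) p c r j :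
  power_series_at f p c r -> 'D_(delta_mx 0 j) f p = c (unit_index j).
Proof.
move=> /power_series_differentiable[_ ->]; rewrite /linear_part (bigD1 j)//=.
rewrite mxE !eqxx mulr1 big1 ?addr0// => i ij.
by rewrite mxE eqxx (negbTE ij) mulr0.
Qed.

End power_series.

(** * Gaussian transforms are real-analytic *)

Section cauchy_product.
Context {R : realType}.
Implicit Types (a b : nat -> R) (x y A B : R).

(** The triangle i + j < N, summed by diagonals or by rows. *)
Lemma triangle_sum a b N :
  \sum_(k < N) \sum_(i < k.+1) a i * b (k - i)%N = \sum_(i < N) a i * \sum_(j < N - i) b j.
Proof.
elim: N => [|N IH]; first by rewrite !big_ord0.
rewrite big_ord_recr /= IH.
transitivity (\sum_(i < N.+1) (a i * \sum_(j < N - i) b j + a i * b (N - i)%N)).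
  rewrite big_split /=; congr (_ + _).
  by rewrite big_ord_recr /= subnn big_ord0 mulr0 addr0.
apply: eq_bigr => i _; rewrite -mulrDr; congr (_ * _).
by rewrite subSn ?big_ord_recr// -ltnS.
Qed.

Lemma ler_sum_ord a (N M : nat) : (N <= M)%N -> (forall k, 0 <= a k) ->
  \sum_(k < N) a k <= \sum_(k < M) a k.
Proof.
move=> NM a0; rewrite -(subnKC NM) big_split_ord /= lerDl.
by apply: sumr_ge0.
Qed.

Lemma abs_triangle_sum_le a b A B N : 0 <= A -> 0 <= B ->
  (forall N, \sum_(k < N) `|a k| <= A) -> (forall N, \sum_(k < N) `|b k| <= B) ->
  \sum_(k < N) `|\sum_(i < k.+1) a i * b (k - i)%N| <= A * B.
Proof.
move=> A0 B0 aA bB.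
apply: (@le_trans _ _ (\sum_(k < N) \sum_(i < k.+1) `|a i| * `|b (k - i)%N|)).
  apply: ler_sum => k _; apply: le_trans (ler_norm_sum _ _ _) _.
  by apply: ler_sum => i _; rewrite normrM.
rewrite (triangle_sum (fun i => `|a i|) (fun i => `|b i|)).
apply: le_trans (_ : \sum_(i < N) `|a i| * B <= _).
  by apply: ler_sum => i _; rewrite ler_wpM2l.
by rewrite -mulr_suml ler_wpM2r.
Qed.

Lemma abs_partial_sums_cvg a A : (forall N, \sum_(k < N) `|a k| <= A) ->
  exists S : R, (\sum_(k < N) `|a k| : R) @[N --> \oo] --> S.
Proof.
move=> aA; have : cvgn (fun N => \sum_(k < N) `|a k|).
  apply: nondecreasing_is_cvgn.
    by move=> N M NM; apply: (@ler_sum_ord (fun k => `|a k|)).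
  by exists A => _ [N _ <-].
by move=> c; exists (limn (fun N => \sum_(k < N) `|a k|)).
Qed.

(** The terms missing from the triangle have an index at least N / 2, so they are
    bounded by the difference of two products of absolute partial sums, at N
    and at N / 2, with the same limit. *)
Lemma cauchy_product a b x y A B :
  (forall N, \sum_(k < N) `|a k| <= A) -> (forall N, \sum_(k < N) `|b k| <= B) ->
  (\sum_(k < N) a k) @[N --> \oo] --> x -> (\sum_(k < N) b k) @[N --> \oo] --> y ->
  (\sum_(k < N) \sum_(i < k.+1) a i * b (k - i)%N) @[N --> \oo] --> x * y.
Proof.
move=> aA bB ax bY.
have [SA cA] := abs_partial_sums_cvg aA; have [SB cB] := abs_partial_sums_cvg bB.
pose sa N := \sum_(k < N) a k; pose sb N := \sum_(k < N) b k.
pose A' N := \sum_(k < N) `|a k|; pose B' N := \sum_(k < N) `|b k|.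
have half : (fun N => N./2) @ \oo --> \oo.
  move=> P [N _ NP]; exists N.*2 => // k /= Nk; apply: NP => /=.
  by rewrite -(doubleK N) half_leq.
have bound N : `|sa N * sb N - \sum_(k < N) \sum_(i < k.+1) a i * b (k - i)%N| <=
    A' N * B' N - A' N./2 * B' N./2.
  have A'0 k : 0 <= A' k by apply: sumr_ge0.
  have B'0 k : 0 <= B' k by apply: sumr_ge0.
  rewrite triangle_sum /sa mulr_suml -sumrB.
  apply: le_trans (ler_norm_sum _ _ _) _.
  apply: (@le_trans _ _ (\sum_(i < N) `|a i| * (B' N - B' (N - i)%N))).
    apply: ler_sum => i _; rewrite -mulrBr normrM ler_wpM2l//.
    have := leq_subr i N; move: (N - i)%N => M MN.
    rewrite /sb /B' -(subnKC MN) !big_split_ord /= addrAC subrr add0r addrAC subrr add0r.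
    exact: ler_norm_sum.
  under eq_bigr do rewrite mulrBr.
  rewrite sumrB -mulr_suml lerB//.
  have hN : (N./2 <= N)%N by rewrite -[X in (_ <= X)%N]odd_double_half -addnn addnA leq_addl.
  apply: (@le_trans _ _ (\sum_(i < N./2) `|a i| * B' (N - i)%N)).
    rewrite /A' mulr_suml; apply: ler_sum => i _; rewrite ler_wpM2l//.
    apply: (@ler_sum_ord (fun k => `|b k|)) => //.
    rewrite leq_subRL ?(leq_trans (ltnW (ltn_ord i)))//.
    rewrite -[X in (_ <= X)%N](odd_double_half N) -addnn -[X in (X <= _)%N]add0n.
    by rewrite leq_add// leq_add2r ltnW.
  apply: (@ler_sum_ord (fun i => `|a i| * B' (N - i)%N)) => // k.
  by rewrite mulr_ge0.
have c0 : (A' N * B' N - A' N./2 * B' N./2) @[N --> \oo] --> 0.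
  rewrite -(subrr (SA * SB)); apply: cvgB; first exact: cvgM.
  by apply: cvgM; [exact: (cvg_comp _ _ half cA)|exact: (cvg_comp _ _ half cB)].
rewrite -[x * y]subr0.
rewrite (_ : (fun N => _) = fun N => sa N * sb N -
   (sa N * sb N - \sum_(k < N) \sum_(i < k.+1) a i * b (k - i)%N)); last first.
  by apply/funext => N; rewrite opprB addrC subrK.
apply: cvgB; first exact: cvgM.
apply/norm_cvg0P; apply: (squeeze_cvgr _ (cvg_cst 0) c0).
by apply: nearW => N; rewrite normr_ge0 bound.
Qed.

End cauchy_product.

Section gaussian_kernel.
Context {R : realType}.

Lemma exp_partial_sums (x : R) :
  (\sum_(k < N) (x ^+ k / k`!%:R)) @[N --> \oo] --> expR x.
Proof.
have := @is_cvg_series_exp_coeff R x; rewrite /expR.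
rewrite /series /= => h; have := h.
by rewrite (_ : (fun n => _) = fun N => \sum_(k < N) (x ^+ k / k`!%:R))//; apply/funext => N; rewrite big_mkord.
Qed.

Lemma exp_abs_sums_le (x : R) N : \sum_(k < N) `|x ^+ k / k`!%:R| <= expR `|x|.
Proof.
have E k : `|x ^+ k / k`!%:R| = `|x| ^+ k / k`!%:R.
  by rewrite normrM normrX normfV normr_nat.
under eq_bigr do rewrite E.
have cx := @exp_partial_sums `|x|.
apply: (@cvgr_to_ge _ \oo _ R _ _ _ cx).
exists N => // M /= NM; apply: (@ler_sum_ord _ (fun k => `|x| ^+ k / k`!%:R)) => // k; rewrite divr_ge0.
Qed.

(** The even power series of [v |-> expR (x * v ^+ 2)]. *)
Definition even_coeff (x : R) k := if odd k then 0 else x ^+ k./2 / (k./2)`!%:R.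

Lemma even_partial_sum (x v : R) N :
  \sum_(k < N) even_coeff x k * v ^+ k =
  \sum_(j < uphalf N) (x * v ^+ 2) ^+ j / j`!%:R.
Proof.
elim: N => [|N IH]; first by rewrite !big_ord0.
rewrite big_ord_recr /= IH /even_coeff uphalf_half.
case: ifPn => oN; first by rewrite mul0r addr0.
rewrite big_ord_recr /=; congr (_ + _).
rewrite exprMn -exprM -[in v ^+ N](even_halfK oN) -mul2n; ring.
Qed.

Lemma even_partial_sum_cvg (x v : R) :
  (\sum_(k < N) even_coeff x k * v ^+ k) @[N --> \oo] --> expR (x * v ^+ 2).
Proof.
under eq_fun do rewrite even_partial_sum.
apply: (cvg_comp _ _ _ (@exp_partial_sums (x * v ^+ 2))).
move=> P [N _ NP]; exists N.*2 => // k /= Nk; apply: NP => /=.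
by rewrite uphalf_half (leq_trans _ (leq_addl _ _))// -(doubleK N) half_leq.
Qed.

Lemma even_coeff_abs_le (x : R) N : \sum_(k < N) `|even_coeff x k| <= expR `|x|.
Proof.
have -> : \sum_(k < N) `|even_coeff x k| = \sum_(k < N) even_coeff `|x| k * 1 ^+ k.
  apply: eq_bigr => k _; rewrite expr1n mulr1 /even_coeff.
  case: ifP => _; first by rewrite normr0.
  by rewrite normrM normrX normfV normr_nat.
rewrite even_partial_sum expr1n mulr1.
apply: le_trans (exp_abs_sums_le x (uphalf N)).
by apply: ler_sum => k _; rewrite [leRHS]normrM normrX normfV normr_nat.
Qed.

Variables (c c' : R).
Hypotheses (c'0 : 0 < c') (c'c : c' < c).

Let c0 : 0 < c. Proof. exact: lt_trans c'c. Qed.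

(** The damping factor [expR (- c' * w ^+ 2)] of the weight is moved out of the
    kernel so that the coefficients of its expansion are bounded in [w]. *)
Definition gkernel (p w : R) := expR (c' * w ^+ 2 - c * (w - p) ^+ 2).

Definition gkernel_coeff (p : R) k (w : R) : R :=
  gkernel p w * \sum_(i < k.+1) (2 * c * (w - p)) ^+ i / i`!%:R * even_coeff (- c) (k - i).

(** The exponent left after completing the square in [w]; finiteness comes from
    [c' < c]. *)
Definition gkernel_bound (p : R) : R := expR ((c * (`|p| + 1)) ^+ 2 / (c - c') + c * p ^+ 2 + c).

Lemma measurable_gkernel p : measurable_fun setT (gkernel p).
Proof.
apply: continuous_measurable_fun => w.
apply: (@continuous_comp R R R (fun w => c' * w ^+ 2 - c * (w - p) ^+ 2) expR); last exact: continuous_expR.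
apply: cvgB; apply: cvgM; try exact: cvg_cst.
  exact: exprn_continuous.
apply: (@continuous_comp R R R (fun w => w - p) (fun w => w ^+ 2)); last exact: exprn_continuous.
by apply: cvgB; [exact: cvg_id|exact: cvg_cst].
Qed.

Lemma measurable_gkernel_coeff p k : measurable_fun setT (gkernel_coeff p k).
Proof.
apply: measurable_funM; first exact: measurable_gkernel.
apply: measurable_sum => i; apply: measurable_funM => //.
apply: measurable_funM => //; apply: measurable_funX.
by apply: measurable_funM => //; apply: measurable_funB.
Qed.

Lemma gkernel_coeff_abs_le p w N : \sum_(k < N) `|gkernel_coeff p k w| <= gkernel_bound p.
Proof.
under eq_bigr do rewrite /gkernel_coeff normrM.
rewrite -mulr_sumr ger0_norm ?expR_ge0//.
have := @abs_triangle_sum_le R (fun k => (2 * c * (w - p)) ^+ k / k`!%:R) _ _ _ N (expR_ge0 _) (expR_ge0 _)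
  (exp_abs_sums_le (2 * c * (w - p))) (even_coeff_abs_le (- c)).
move=> /(ler_wpM2l (expR_ge0 (c' * w ^+ 2 - c * (w - p) ^+ 2))) h.
apply: le_trans h _.
rewrite -!expRD ler_expR normrN !normrM ger0_norm// (ger0_norm (ltW c0)).
have d0 : 0 < c - c' by rewrite subr_gt0.
set d := c - c' in d0 *; set t := c * (`|p| + 1); set u := w - p.
have E : c' * w ^+ 2 - c * u ^+ 2 + 2 * c * `|u| + c =
   - d * `|u| ^+ 2 + 2 * c' * (p * u) + c' * p ^+ 2 + 2 * c * `|u| + c.
  by rewrite real_normK ?num_real// /d /u; ring.
rewrite addrA E.
have h1 : p * u <= `|p| * `|u| by rewrite -normrM ler_norm.
have h2 : c' * p ^+ 2 <= c * p ^+ 2 by rewrite ler_wpM2r ?sqr_ge0// ltW.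
have h3 : c' * (p * u) <= c * (`|p| * `|u|).
  by apply: le_trans (_ : c' * (`|p| * `|u|) <= _); [rewrite ler_wpM2l// ltW|rewrite ler_wpM2r ?mulr_ge0// ltW].
have h4 : 0 <= d * (`|u| - t / d) ^+ 2 by rewrite mulr_ge0 ?sqr_ge0// ltW.
have h5 : d * (`|u| - t / d) ^+ 2 = d * `|u| ^+ 2 - 2 * (t * `|u|) + t ^+ 2 / d.
  by field; rewrite gt_eqF.
rewrite h5 in h4.
have h6 : t * `|u| = c * (`|p| * `|u|) + c * `|u| by rewrite /t; ring.
move: h2 h3 h4; rewrite h6; lra.
Qed.

(** The exponential of 2 c (w - p) v - c v^2 is the product of two exponentials
    whose power series in [v] are explicit. *)
Lemma gkernel_series p w v :
  (\sum_(k < N) gkernel_coeff p k w * v ^+ k) @[N --> \oo] --> gkernel (p + v) w.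
Proof.
have -> : gkernel (p + v) w =
    gkernel p w * (expR (2 * c * (w - p) * v) * expR (- c * v ^+ 2)).
  by rewrite /gkernel -!expRD; congr expR; ring.
have E : (fun N => \sum_(k < N) gkernel_coeff p k w * v ^+ k) =
  (fun N => gkernel p w * \sum_(k < N) \sum_(i < k.+1) (2 * c * (w - p) * v) ^+ i / i`!%:R *
     (even_coeff (- c) (k - i) * v ^+ (k - i))).
  apply/funext => N; rewrite mulr_sumr; apply: eq_bigr => k _.
  rewrite /gkernel_coeff -mulrA; congr (_ * _); rewrite mulr_suml.
  apply: eq_bigr => i _; rewrite -[in v ^+ k](@subnK i k) -1?ltnS//.
  by rewrite exprD [(_ * v) ^+ i]exprMn; ring.
rewrite E; apply: cvgM; first exact: cvg_cst.
apply: (@cauchy_product R (fun i => (2 * c * (w - p) * v) ^+ i / i`!%:R)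
  (fun j => even_coeff (- c) j * v ^+ j) _ _ (expR `|2 * c * (w - p) * v|) (expR `|- c * v ^+ 2|)).
- exact: exp_abs_sums_le.
- move=> N.
  have := even_coeff_abs_le (- c * v ^+ 2) N; apply: le_trans.
  apply: ler_sum => k _; rewrite /even_coeff.
  case: ifPn => ok; first by rewrite mul0r normr0.
  rewrite le_eqVlt; apply/orP; left; apply/eqP; congr (`| _ |).
  rewrite exprMn -exprM -[in v ^+ k](even_halfK ok) -mul2n; ring.
- exact: exp_partial_sums.
- exact: even_partial_sum_cvg.
Qed.

End gaussian_kernel.

Section kernel_transform.
Context {R : realType} {d} {Omega : measurableType d} (mu : {measure set Omega -> \bar R}).
Variables (m : nat) (c c' : R) (U : Omega -> R) (w : Omega -> 'rV[R]_m).
Hypotheses (c'0 : 0 < c') (c'c : c' < c).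
Hypothesis iU : mu.-integrable setT (EFin \o U).
Hypothesis mw : forall j, measurable_fun setT (fun x => w x 0 j).
Local Notation multi := {ffun 'I_m -> nat}.

Lemma integrable_mul_bounded (V : Omega -> R) (M : R) : measurable_fun setT V ->
  (forall x, `|V x| <= M) -> mu.-integrable setT (EFin \o (fun x => U x * V x)).
Proof.
move=> mV VM; have mU : measurable_fun setT U.
  by apply/measurable_EFinP; exact: measurable_int iU.
apply: (@le_integrable _ _ _ mu setT _ _ (EFin \o (fun x => M * U x))) => //.
- by apply/measurable_EFinP; exact: measurable_funM.
- move=> x _ /=; rewrite lee_fin !normrM mulrC ler_wpM2r//.
  by rewrite (le_trans (VM x))// ler_norm.
- have -> : EFin \o (fun x => M * U x) = (fun x => M%:E * (EFin \o U) x)%E by [].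
  exact: integrableZl.
Qed.

Definition kernel_transform (p : 'rV[R]_m) : R :=
  \int[mu]_x (U x * \prod_j gkernel c c' (p 0 j) (w x 0 j)).

Definition kernel_coeff (p : 'rV[R]_m) (b : multi) : R :=
  \int[mu]_x (U x * \prod_j gkernel_coeff c c' (p 0 j) (b j) (w x 0 j)).

Let B (p : 'rV[R]_m) := \prod_j gkernel_bound c c' (p 0 j).

Let q (p : 'rV[R]_m) j k x := gkernel_coeff c c' (p 0 j) k (w x 0 j).

Let mq p j k : measurable_fun setT (q p j k).
Proof.
exact: (measurableT_comp (measurable_gkernel_coeff c c' (p 0 j) k) (mw j)).
Qed.

Lemma measurable_bigprod (I : Type) (r : seq I) (F : I -> Omega -> R) :
  (forall i, measurable_fun setT (F i)) ->
  measurable_fun setT (fun x => \prod_(i <- r) F i x).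
Proof.
move=> mF; elim: r => [|i r IH].
  by under eq_fun do rewrite big_nil; exact: measurable_cst.
by under eq_fun do rewrite big_cons; exact: measurable_funM.
Qed.

Let q_le p j k x : `|q p j k x| <= gkernel_bound c c' (p 0 j).
Proof.
apply: le_trans (gkernel_coeff_abs_le c'0 c'c (p 0 j) (w x 0 j) k.+1).
by rewrite big_ord_recr /= lerDr sumr_ge0.
Qed.

Lemma integrable_kernel_coeff p (b : multi) :
  mu.-integrable setT (EFin \o (fun x => U x * \prod_j q p j (b j) x)).
Proof.
apply: (@integrable_mul_bounded _ (B p)).
  by apply: measurable_bigprod => j; exact: mq.
by move=> x; rewrite normr_prod; apply: ler_prod => j _; rewrite normr_ge0 q_le.
Qed.

Let cube_prod p N (t : R -> R) (s : 'I_m -> R) x :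
  \prod_j \sum_(k < N) (t (q p j k x) * s j ^+ k) =
  \sum_(a : {ffun 'I_m -> 'I_N}) (\prod_j t (q p j (of_cube a j) x)) * \prod_j s j ^+ of_cube a j.
Proof.
rewrite bigA_distr_bigA; apply: eq_bigr => a _.
by rewrite -big_split /=; apply: eq_bigr => j _; rewrite ffunE.
Qed.

Lemma kernel_coeff_summable p :
  (\esum_(b in [set: multi]) (`|kernel_coeff p b| * rmon 1 b)%:E < +oo)%E.
Proof.
have mU : measurable_fun setT U by apply/measurable_EFinP; exact: measurable_int iU.
have iBU : mu.-integrable setT (EFin \o (fun x => U x * B p)).
  exact: (@integrable_mul_bounded _ `|B p|).
apply: le_lt_trans (_ : (\int[mu]_x (`|U x * B p|)%:E < +oo)%E); last first.
  by have /integrableP[_] := iBU.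
apply: esum_le_cube_sums => [b|N].
  by rewrite lee_fin mulr_ge0// rmon_ge0.
have mqb (a : {ffun 'I_m -> 'I_N}) :
    measurable_fun setT (fun x => (`|U x * \prod_j q p j (of_cube a j) x|)%:E).
  apply/measurable_EFinP/measurableT_comp => //; apply: measurable_funM => //.
  by apply: measurable_bigprod => j; exact: mq.
apply: (@le_trans _ _ (\sum_(a : {ffun 'I_m -> 'I_N})
    \int[mu]_x (`|U x * \prod_j q p j (of_cube a j) x|)%:E)%E).
  apply: lee_sum => a _; rewrite /rmon big1 ?mulr1; last by move=> j _; rewrite expr1n.
  have ia := integrable_kernel_coeff p (of_cube a).
  apply: le_trans (le_abse_integral mu measurableT (measurable_int mu ia)).
  rewrite /kernel_coeff /Rintegral -abse_EFin fineK//.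
  exact: integrable_fin_num.
rewrite -ge0_integral_sum//.
apply: ge0_le_integral => //.
- by move=> x _; apply: sume_ge0 => a _; rewrite lee_fin.
- exact: emeasurable_sum.
- by apply/measurable_EFinP/measurableT_comp => //; exact: measurable_funM.
move=> x _; rewrite sumEFin lee_fin.
under eq_bigr do rewrite normrM normr_prod.
rewrite -mulr_sumr normrM ler_wpM2l//.
apply: le_trans (_ : \prod_j \sum_(k < N) (`|q p j k x| * 1 ^+ k) <= _).
  rewrite (cube_prod p N (fun y => `|y|) (fun=> 1)); apply: ler_sum => a _.
  by rewrite [X in _ * X]big1 ?mulr1// => j _; rewrite expr1n.
apply: le_trans (ler_norm _); apply: ler_prod => j _.
rewrite sumr_ge0 /=; last by move=> k _; rewrite mulr_ge0// exprn_ge0.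
under eq_bigr do rewrite expr1n mulr1.
exact: gkernel_coeff_abs_le.
Qed.

Lemma cube_partial_sum_kernel p (v : 'rV[R]_m) N : cube_partial_sum (kernel_coeff p) v N =
  \int[mu]_x (U x * \prod_j \sum_(k < N) (q p j k x * v 0 j ^+ k)).
Proof.
have ik (a : {ffun 'I_m -> 'I_N}) : mu.-integrable setT
    (EFin \o (fun x => mon v (of_cube a) * (U x * \prod_j q p j (of_cube a j) x))).
  exact: (integrableZl measurableT (mon v (of_cube a)) (integrable_kernel_coeff p (of_cube a))).
apply: EFin_inj; rewrite -sumEFin.
transitivity (\sum_(a : {ffun 'I_m -> 'I_N}) \int[mu]_x
    (mon v (of_cube a) * (U x * \prod_j q p j (of_cube a j) x))%:E)%E.
  apply: eq_bigr => a _; rewrite mulrC -RintegralZl//; last exact: integrable_kernel_coeff.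
  exact: fineK (integrable_fin_num measurableT (ik a)).
rewrite -integral_sum//.
rewrite /Rintegral (_ : (fun x => \sum_(a : {ffun 'I_m -> 'I_N})
    (mon v (of_cube a) * (U x * \prod_j q p j (of_cube a j) x))%:E)%E = fun x =>
    (U x * \prod_j \sum_(k < N) (q p j k x * v 0 j ^+ k))%:E); last first.
  apply/funext => x; rewrite sumEFin; congr EFin.
  rewrite (cube_prod p N id (fun j => v 0 j)) mulr_sumr; apply: eq_bigr => a _.
  by rewrite /mon; ring.
rewrite fineK//.
rewrite (_ : (fun x => _) = fun x => (\sum_(a : {ffun 'I_m -> 'I_N})
    (mon v (of_cube a) * (U x * \prod_j q p j (of_cube a j) x))%:E)%E); last first.
  apply/funext => x; rewrite sumEFin; congr EFin.
  rewrite (cube_prod p N id (fun j => v 0 j)) mulr_sumr; apply: eq_bigr => a _.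
  by rewrite /mon; ring.
apply: (integrable_fin_num measurableT); apply: (integrable_sum measurableT) => a _.
exact: ik.
Qed.

(** The kernel is expanded in each coordinate separately. A partial sum over a
    cube of multi-indices is then a product of one-variable partial sums, which
    [gkernel_bound] bounds uniformly, and dominated convergence applies. *)
Theorem kernel_transform_series p :
  power_series_at kernel_transform p (kernel_coeff p) 1.
Proof.
have mU : measurable_fun setT U by apply/measurable_EFinP; exact: measurable_int iU.
split=> // [|v v1]; first exact: kernel_coeff_summable.
have pB : 0 <= B p by apply: prodr_ge0 => j _; exact: expR_ge0.
pose f N x := U x * \prod_j \sum_(k < N) (q p j k x * v 0 j ^+ k).
pose g x := U x * \prod_j gkernel c c' ((p + v) 0 j) (w x 0 j).
have mf N : measurable_fun setT (f N).
  apply: measurable_funM => //; apply: measurable_bigprod => j.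
  by apply: measurable_sum => k; apply: measurable_funM.
have mg : measurable_fun setT g.
  apply: measurable_funM => //; apply: measurable_bigprod => j.
  exact: (measurableT_comp (measurable_gkernel c c' _) (mw j)).
have fg x : f N x @[N --> \oo] --> g x.
  apply: cvgM; first exact: cvg_cst.
  have h j : (\sum_(k < N) (q p j k x * v 0 j ^+ k)) @[N --> \oo] -->
      gkernel c c' ((p + v) 0 j) (w x 0 j).
    by rewrite mxE; exact: gkernel_series.
  move: (index_enum _) => r; elim: r => [|j r IH].
    by under eq_fun do rewrite big_nil; rewrite big_nil; exact: cvg_cst.
  under eq_fun do rewrite big_cons; rewrite big_cons.
  exact: cvgM.
have fB N x : `|f N x| <= `|U x * B p|.
  rewrite !normrM ler_wpM2l// (ger0_norm pB) normr_prod; apply: ler_prod => j _.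
  rewrite normr_ge0 /=; apply: le_trans (ler_norm_sum _ _ _) _.
  apply: le_trans (gkernel_coeff_abs_le c'0 c'c (p 0 j) (w x 0 j) N).
  apply: ler_sum => k _; rewrite normrM ler_piMr// normrX exprn_ile1//.
  exact: ltW.
have iBU : mu.-integrable setT (EFin \o (fun x => U x * B p)).
  exact: (@integrable_mul_bounded _ `|B p|).
have [] := @dominated_convergence _ _ _ mu setT measurableT
  (fun N => EFin \o f N) (EFin \o g) (abse \o (EFin \o (fun x => U x * B p)%R)).
- by move=> N; apply/measurable_EFinP.
- exact/measurable_EFinP.
- apply: aeW => x _ /=; apply: cvg_EFin; last exact: fg.
  by apply: nearW.
- exact: integrable_abse.
- by apply: aeW => x N _; rewrite /= lee_fin fB.
move=> ig _ cf.
rewrite (_ : (fun N => _) = fun N => \int[mu]_x f N x); last first.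
  by apply/funext => N; rewrite cube_partial_sum_kernel.
have E : (kernel_transform (p + v))%:E = (\int[mu]_x (EFin \o g) x)%E.
  exact: fineK (integrable_fin_num measurableT ig).
by apply: fine_cvg; rewrite E; exact: cf.
Qed.

Lemma kernel_transform_analytic : real_analytic kernel_transform.
Proof.
apply/real_analyticP => p; exists (kernel_coeff p), 1.
exact: kernel_transform_series.
Qed.

Lemma derive_kernel_transform p j :
  'D_(delta_mx 0 j) kernel_transform p = kernel_coeff p (unit_index j).
Proof. exact: real_analytic_derive_unit (kernel_transform_series p). Qed.

End kernel_transform.

(** * Sesqui-holomorphic functions on the doubled phase space *)

Section cauchy_riemann_directions.
Context {R : realType} {V : normedModType R}.
Local Notation re := (@complex.Re R).
Local Notation im := (@complex.Im R).

Lemma ReD (z w : R[i]) : re (z + w) = re z + re w.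
Proof. by case: z w => [a b] [c d]. Qed.

Lemma ImD (z w : R[i]) : im (z + w) = im z + im w.
Proof. by case: z w => [a b] [c d]. Qed.

Variables (J : V -> V).

Lemma jholoD (f g : V -> R[i]) : jholo J f -> jholo J g -> jholo J (fun x => f x + g x).
Proof.
move=> [[f1 f2] fCR] [[g1 g2] gCR].
have rE : re \o (fun x => f x + g x) = fun x => (re \o f) x + (re \o g) x.
  by apply/funext => x; rewrite /= ReD.
have iE : im \o (fun x => f x + g x) = fun x => (im \o f) x + (im \o g) x.
  by apply/funext => x; rewrite /= ImD.
split; first by rewrite /is_cC1 rE iE; split; exact: is_C1D.
move=> p v; have [fr fi] := fCR p v; have [gr gi] := gCR p v; rewrite rE iE.
by rewrite !deriveD ?fr ?fi ?gr ?gi ?opprD//; exact: is_C1_derivable.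
Qed.

Lemma jholo_cst (c : R[i]) : jholo J (fun=> c).
Proof.
split; first by split; exact: is_C1_cst.
move=> p v; rewrite (_ : re \o _ = cst (re c))// (_ : im \o _ = cst (im c))//.
by rewrite !derive_cst oppr0.
Qed.

Lemma jholo_linear (c : R[i]) (f g : V -> R[i]) :
  jholo J f -> jholo J g -> jholo J (fun x => c * f x + g x).
Proof. by move=> fJ gJ; apply: jholoD => //; apply: jholoM => //; exact: jholo_cst. Qed.

Definition CR_at (f : V -> R[i]) (v : V) : Prop := forall p,
  'D_(J v) (re \o f) p = - 'D_v (im \o f) p /\
  'D_(J v) (im \o f) p = 'D_v (re \o f) p.

Hypothesis JD : forall u v, J (u + v) = J u + J v.
Hypothesis JZ : forall a v, J (a *: v) = a *: J v.
Variable f : V -> R[i].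
Hypothesis fC : is_cC1 f.

Let dr p : differentiable (re \o f) p. Proof. exact: fC.1.1. Qed.
Let di p : differentiable (im \o f) p. Proof. exact: fC.2.1. Qed.

Lemma CR_atD u v : CR_at f u -> CR_at f v -> CR_at f (u + v).
Proof.
move=> hu hv p; have [ur ui] := hu p; have [vr vi] := hv p.
by rewrite JD !deriveDl// ur ui vr vi opprD.
Qed.

Lemma CR_atZ a v : CR_at f v -> CR_at f (a *: v).
Proof.
by move=> hv p; have [vr vi] := hv p; rewrite JZ !deriveZl// vr vi mulrN.
Qed.

Lemma CR_at_J v : J (J v) = - v -> CR_at f v -> CR_at f (J v).
Proof.
by move=> JJ hv p; have [vr vi] := hv p; rewrite JJ !deriveNl// vr vi.
Qed.

(** The directions that satisfy the Cauchy-Riemann equations form a subspace. *)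
Lemma CR_at_embedding m (iota : 'rV[R]_m -> V) :
  (forall u v, iota (u + v) = iota u + iota v) ->
  (forall a v, iota (a *: v) = a *: iota v) ->
  (forall i, CR_at f (iota (delta_mx 0 i))) -> forall v, CR_at f (iota v).
Proof.
move=> iD iZ h v; rewrite (row_sum_delta v).
have i0 : iota 0 = 0 by rewrite -(scale0r 0) iZ scale0r.
elim/big_rec: _ => [|i u _ hu].
  by rewrite i0 -(scale0r 0); apply: CR_atZ; rewrite -i0 -(scale0r 0) iZ => p; rewrite JZ !scale0r !derive0 oppr0.
by rewrite iD; apply: CR_atD => //; rewrite iZ; exact: CR_atZ.
Qed.

End cauchy_riemann_directions.

(** The two difference quotients are equal. *)
Lemma derive_slice {R : realType} (V W : normedModType R) (f : V -> R) (g : W -> V) x e l :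
  (forall a : R, g (a *: e + x) = a *: l + g x) -> 'D_e (f \o g) x = 'D_l f (g x).
Proof.
move=> gE; rewrite /derive.
by under eq_fun do rewrite /= gE.
Qed.

Section phase_coordinates.
Context {R : realType} {n : nat}.
Local Notation phase := 'rV[R]_(n + n).
Local Notation jspace := 'rV[R]_((n + n) + (n + n)).
Local Notation re := (@complex.Re R).
Local Notation im := (@complex.Im R).

(** Multiplication by i in X and by - i in Y. *)
Definition jW (W : jspace) : jspace :=
  row_mx (jrot (lsubmx W)) (- jrot (rsubmx W)).

Lemma jWD (u v : jspace) : jW (u + v) = jW u + jW v.
Proof. rewrite /jW (linearD lsubmx) (linearD rsubmx) !jrotD opprD.
by rewrite [RHS]add_row_mx. Qed.

Lemma jWZ a (v : jspace) : jW (a *: v) = a *: jW v.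
Proof. rewrite /jW !linearZ /= !jrotZ.
by rewrite [RHS]scale_row_mx scalerN. Qed.

Lemma jWK (v : jspace) : jW (jW v) = - v.
Proof.
rewrite /jW row_mxKl row_mxKr jrotN !jrotK opprK -[v in RHS]hsubmxK.
by rewrite [RHS]opp_row_mx.
Qed.

Definition sesquiholo (G : phase -> phase -> R[i]) : Prop := jholo jW (joint G).

Lemma jrot_delta (j : 'I_n) :
  jrot (delta_mx 0 (lshift n j)) = delta_mx 0 (rshift n j) :> phase.
Proof.
apply/rowP => k; rewrite /jrot mxE; case: splitP => i ki.
  rewrite !mxE (_ : k = lshift n i); last exact/val_inj.
  by rewrite /= eq_rlshift eq_lrshift oppr0.
rewrite !mxE (_ : k = rshift n i); last exact/val_inj.
by rewrite eq_lshift eq_rshift.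
Qed.

Lemma CR_plus (a b c d : R) : (a +i* b) + 'i%C * (c +i* d) = 0 <-> c = - b /\ d = a.
Proof.
split=> [/eqP|[-> ->]]; last by apply/eqP; rewrite eq_complex /=; apply/andP; split; apply/eqP; ring.
by rewrite eq_complex /= => /andP[/eqP h1 /eqP h2]; split; lra.
Qed.

Lemma CR_minus (a b c d : R) : (a +i* b) - 'i%C * (c +i* d) = 0 <-> c = b /\ d = - a.
Proof.
split=> [/eqP|[-> ->]]; last by apply/eqP; rewrite eq_complex /=; apply/andP; split; apply/eqP; ring.
by rewrite eq_complex /= => /andP[/eqP h1 /eqP h2]; split; lra.
Qed.

Lemma sesqui_CR_derive (G : phase -> phase -> R[i]) : sesqui_CR G <->
  forall (X Y : phase) (j : 'I_n),
    [/\ 'D_(row_mx (delta_mx 0 (rshift n j)) 0) (re \o joint G) (row_mx X Y) =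
        - 'D_(row_mx (delta_mx 0 (lshift n j)) 0) (im \o joint G) (row_mx X Y),
      'D_(row_mx (delta_mx 0 (rshift n j)) 0) (im \o joint G) (row_mx X Y) =
        'D_(row_mx (delta_mx 0 (lshift n j)) 0) (re \o joint G) (row_mx X Y),
      'D_(row_mx 0 (delta_mx 0 (rshift n j))) (re \o joint G) (row_mx X Y) =
        'D_(row_mx 0 (delta_mx 0 (lshift n j))) (im \o joint G) (row_mx X Y) &
      'D_(row_mx 0 (delta_mx 0 (rshift n j))) (im \o joint G) (row_mx X Y) =
        - 'D_(row_mx 0 (delta_mx 0 (lshift n j))) (re \o joint G) (row_mx X Y)].
Proof.
have DX (X Y : phase) i : cpartial (fun X' => G X' Y) i X =
    'D_(row_mx (delta_mx 0 i) 0) (re \o joint G) (row_mx X Y) +i*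
    'D_(row_mx (delta_mx 0 i) 0) (im \o joint G) (row_mx X Y).
  rewrite /cpartial /cderive.
  have sl a : row_mx (a *: delta_mx 0 i + X) Y = a *: row_mx (delta_mx 0 i) 0 + row_mx X Y.
    by rewrite scale_row_mx add_row_mx scaler0 add0r.
  have E (k : R[i] -> R) : k \o (fun X' => G X' Y) = (k \o joint G) \o (fun X' => row_mx X' Y).
    by apply/funext => X'; rewrite /= /joint row_mxKl row_mxKr.
  by rewrite (E re) (E im) !(derive_slice _ sl).
have DY (X Y : phase) i : cpartial (fun Y' => G X Y') i Y =
    'D_(row_mx 0 (delta_mx 0 i)) (re \o joint G) (row_mx X Y) +i*
    'D_(row_mx 0 (delta_mx 0 i)) (im \o joint G) (row_mx X Y).
  rewrite /cpartial /cderive.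
  have sl a : row_mx X (a *: delta_mx 0 i + Y) = a *: row_mx 0 (delta_mx 0 i) + row_mx X Y.
    by rewrite scale_row_mx add_row_mx scaler0 add0r.
  have E (k : R[i] -> R) : k \o (fun Y' => G X Y') = (k \o joint G) \o (fun Y' => row_mx X Y').
    by apply/funext => Y'; rewrite /= /joint row_mxKl row_mxKr.
  by rewrite (E re) (E im) !(derive_slice _ sl).
split=> h X Y j; have := h X Y j; rewrite !DX !DY.
  by move=> [/CR_plus[h1 h2] /CR_minus[h3 h4]].
by move=> [h1 h2 h3 h4]; split; [apply/CR_plus|apply/CR_minus].
Qed.

(** The direction x_j determines the direction xi_j, which is its image by the
    complex structure, and likewise for Y with the opposite sign. *)
Lemma sesquiholoP (G : phase -> phase -> R[i]) :
  sesquiholo G <-> is_cC1 (joint G) /\ sesqui_CR G.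
Proof.
have jl (X : phase) : jW (row_mx X 0) = row_mx (jrot X) 0.
  by rewrite /jW row_mxKl row_mxKr -(scale0r 0) jrotZ !scale0r oppr0.
have jr (Y : phase) : jW (row_mx 0 Y) = row_mx 0 (- jrot Y).
  by rewrite /jW row_mxKl row_mxKr -(scale0r 0) jrotZ !scale0r.
split=> [[GC CR]|[GC /sesqui_CR_derive CR]].
  split=> //; apply/sesqui_CR_derive => X Y j; rewrite -!jrot_delta.
  have [h1 h2] := CR (row_mx X Y) (row_mx (delta_mx 0 (lshift n j)) 0).
  have [h3 h4] := CR (row_mx X Y) (row_mx 0 (delta_mx 0 (lshift n j))).
  rewrite jl in h1 h2; rewrite jr in h3 h4; split; [exact: h1|exact: h2| |].
    rewrite -[RHS]opprK -h3 -deriveNl; last exact: GC.1.1.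
    by rewrite opp_row_mx oppr0 opprK.
  rewrite -h4 -deriveNl; last exact: GC.2.1.
  by rewrite opp_row_mx oppr0 opprK.
suff H v : CR_at jW (joint G) v by split=> // p v; exact: H.
have HX j : CR_at jW (joint G) (row_mx (delta_mx 0 (lshift n j)) 0).
  move=> p; rewrite jl jrot_delta -[p]hsubmxK.
  by have [] := CR (lsubmx p) (rsubmx p) j.
have HY j : CR_at jW (joint G) (row_mx 0 (delta_mx 0 (lshift n j))).
  move=> p; rewrite jr jrot_delta -[p]hsubmxK.
  have [_ _ h1 h2] := CR (lsubmx p) (rsubmx p) j.
  rewrite -[X in row_mx X (- _)]oppr0 -opp_row_mx !deriveNl ?h1 ?h2 ?opprK//; [exact: GC.2.1|exact: GC.1.1].
have EX X : CR_at jW (joint G) (row_mx X 0).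
  apply: (CR_at_embedding jWD jWZ GC (iota := fun X => row_mx X 0)).
  - by move=> u v'; rewrite add_row_mx addr0.
  - by move=> a v'; rewrite scale_row_mx scaler0.
  move=> i; rewrite -(splitK i); case: (fintype.split i) => j; first exact: HX.
  rewrite /= -jrot_delta -jl; apply: (CR_at_J GC); [exact: jWK|exact: HX].
have EY Y : CR_at jW (joint G) (row_mx 0 Y).
  apply: (CR_at_embedding jWD jWZ GC (iota := fun X => row_mx 0 X)).
  - by move=> u v'; rewrite add_row_mx addr0.
  - by move=> a v'; rewrite scale_row_mx scaler0.
  move=> i; rewrite -(splitK i); case: (fintype.split i) => j; first exact: HY.
  rewrite /= -jrot_delta -[jrot _]opprK -[X in row_mx X]oppr0 -opp_row_mx -jr -scaleN1r.
  by apply: (CR_atZ jWZ GC); apply: (CR_at_J GC); [exact: jWK|exact: HY].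
rewrite -[v]hsubmxK -[lsubmx v]addr0 -[rsubmx v]add0r -add_row_mx.
exact: (CR_atD jWD GC).
Qed.

Definition toXY (p : phase * phase) : jspace :=
  row_mx (p.1 + 2^-1 *: p.2) (p.1 - 2^-1 *: p.2).

Definition TZ (G : phase -> phase -> R[i]) (p : phase * phase) : R[i] :=
  G (p.1 + 2^-1 *: p.2) (p.1 - 2^-1 *: p.2).

Lemma constant_diff_toXY : has_constant_diff toXY toXY.
Proof.
have h1 := constant_diff_fst (R := R) (U := phase) (V := phase).
have h2 := constant_diffZ 2^-1 (constant_diff_snd (R := R) (U := phase) (V := phase)).
by apply: constant_diff_row_mx; [exact: constant_diffD|exact: constant_diffB].
Qed.

Lemma TZE G : TZ G = joint G \o toXY.
Proof. by apply/funext => p; rewrite /TZ /joint /= /toXY row_mxKl row_mxKr. Qed.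

Lemma TZ_shift G (X Y : phase) : G X Y = TZ G (2^-1 *: (X + Y), X - Y).
Proof.
have h : 2^-1 + 2^-1 = 1 :> R by field.
rewrite /TZ /= -scalerDr -scalerBr; congr G.
  by rewrite addrACA subrr addr0 scalerDr -scalerDl h scale1r.
by rewrite opprB [Y - X]addrC addrACA subrr add0r scalerDr -scalerDl h scale1r.
Qed.

Lemma jholo_TZ G : sesquiholo G -> jholo jTZ (TZ G).
Proof.
rewrite TZE; apply: (jholo_comp constant_diff_toXY) => v.
rewrite /toXY /jTZ /jW /= row_mxKl row_mxKr !jrotD !jrotN !jrotZ !scalerA mulVf// !scale1r.
by rewrite opprB [jrot v.1 + _]addrC.
Qed.

(** The diagonal is the real subspace of the coordinates (T, Z). *)
Lemma sesquiholo_unique G1 G2 : sesquiholo G1 -> sesquiholo G2 ->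
  (forall X, G1 X X = G2 X X) -> G1 = G2.
Proof.
move=> h1 h2 E.
pose G X Y := (-1) * G1 X Y + G2 X Y.
have hG : sesquiholo G by exact: jholo_linear h1 h2.
have G0 T : TZ G (T, 0) = 0.
  by rewrite /TZ /G /= scaler0 addr0 subr0 E mulN1r addNr.
have Z := jholo_real_subspace_zero (jholo_TZ hG) G0.
apply/funext => X; apply/funext => Y.
have := TZ_shift G X Y; rewrite Z /G mulN1r => /eqP.
by rewrite addrC subr_eq0 => /eqP.
Qed.

Lemma sesqui_extension_holo (F : phase -> R[i]) G : sesqui_extension F G ->
  sesquiholo G /\ forall X, G X X = F X.
Proof.
move=> [[Gr Gi] CR GF]; split=> //; apply/sesquiholoP; split=> //.
by split; exact: real_analytic_C1.
Qed.

Lemma Fext_unique (F : phase -> R[i]) G : sesqui_extension F G -> Fext F = G.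
Proof.
move=> GF; have [hG GE] := sesqui_extension_holo GF.
have : sesqui_extension F (Fext F).
  by rewrite /Fext; case: xgetP => [G' _ //|/(_ G)].
move=> /sesqui_extension_holo[hF FE].
by apply: sesquiholo_unique => // X; rewrite FE GE.
Qed.

End phase_coordinates.

(** * Growth of sesqui-holomorphic functions *)

Section invariant_integrals.
Context {R : realType} {d} {T : measurableType d} (mu : {measure set T -> \bar R}).
Variable phi : T -> T.
Hypothesis mphi : measurable_fun setT phi.
Hypothesis phiE : forall F : T -> \bar R, measurable_fun setT F ->
  (forall x, 0 <= F x)%E -> (\int[mu]_x F (phi x) = \int[mu]_x F x)%E.

Lemma integral_invariant (F : T -> \bar R) : measurable_fun setT F ->
  (\int[mu]_x F (phi x) = \int[mu]_x F x)%E.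
Proof.
move=> mF; rewrite integralE [RHS]integralE; congr (_ - _)%E.
  rewrite -(phiE (measurable_funepos mF))//.
  by apply: eq_integral => x _; rewrite funeposE funeposE.
rewrite -(phiE (measurable_funeneg mF))//.
by apply: eq_integral => x _; rewrite funenegE funenegE.
Qed.

Lemma integrable_invariant (F : T -> \bar R) : mu.-integrable setT F ->
  mu.-integrable setT (F \o phi).
Proof.
move=> /integrableP[mF Foo]; apply/integrableP; split; first exact: measurableT_comp.
rewrite (phiE (F := fun x => `|F x|%E))//.
by apply: measurableT_comp.
Qed.

End invariant_integrals.

Section translations.
Context {R : realType} {n : nat}.
Local Notation phase := 'rV[R]_(n + n).
Local Notation mu := (sfprod (leb (n + n)) (leb (R := R) (n + n))).

Lemma measurable_translate m (w : 'rV[R]_m) : measurable_fun setT (fun v : 'rV[R]_m => v + w).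
Proof. by apply: measurable_rV_add => //; exact: measurable_cst. Qed.

Lemma integral_leb_translate m (w : 'rV[R]_m) (F : 'rV[R]_m -> \bar R) :
  measurable_fun setT F -> (\int[leb m]_v F (v + w)%R = \int[leb m]_v F v)%E.
Proof.
apply: (@integral_invariant R _ _ (leb m) (fun v : 'rV[R]_m => v + w)) => G mG G0.
exact: ge0_integral_translate.
Qed.

Lemma integrable_leb_translate m (w : 'rV[R]_m) (F : 'rV[R]_m -> \bar R) :
  (leb m).-integrable setT F -> (leb m).-integrable setT (fun v => F (v + w)).
Proof.
apply: (@integrable_invariant R _ _ (leb m) (fun v : 'rV[R]_m => v + w)) => [|G mG G0]; first exact: measurable_translate.
exact: ge0_integral_translate.
Qed.

Lemma measurable_pair_translate (q : phase * phase) :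
  measurable_fun setT (fun p : phase * phase => p + q).
Proof.
apply/measurable_fun_pairP; split => /=.
  by apply: measurable_rV_add; [exact: measurable_fst|exact: measurable_cst].
by apply: measurable_rV_add; [exact: measurable_snd|exact: measurable_cst].
Qed.

Lemma integral_phase_translate (q : phase * phase) (F : phase * phase -> \bar R) :
  measurable_fun setT F -> (\int[mu]_p F (p + q)%R = \int[mu]_p F p)%E.
Proof.
apply: (@integral_invariant R _ _ mu (fun p : phase * phase => p + q)) => G mG G0.
have mG2 Z : measurable_fun setT (fun T => G (T, Z)).
  by apply: measurableT_comp mG _; exact: pair2_measurable.
have mG1 T : measurable_fun setT (fun Z => G (T, Z)).
  by apply: measurableT_comp mG _; exact: pair1_measurable.
rewrite /sfprod fubini_tonelli1//; last first.
  by apply: measurableT_comp mG _; exact: measurable_pair_translate.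
rewrite [RHS]fubini_tonelli1//.
rewrite -[RHS](@ge0_integral_translate _ _ q.1) //; last 2 first.
- exact: measurable_fun_fubini_tonelli_F.
- by move=> T; apply: integral_ge0.
apply: eq_integral => T _; rewrite /fubini_F.
by rewrite -[RHS](@ge0_integral_translate _ _ q.2).
Qed.

(** Tonelli's theorem for a product of functions of separate variables. *)
Lemma integrable_tensor (a b : phase -> R) :
  (leb (n + n)).-integrable setT (EFin \o a) ->
  (leb (n + n)).-integrable setT (EFin \o b) ->
  mu.-integrable setT (fun p => (a p.1 * b p.2)%:E) /\
  (\int[mu]_p (a p.1 * b p.2)%:E =
    (\int[leb (n + n)]_T (a T)%:E) * (\int[leb (n + n)]_Z (b Z)%:E))%E.
Proof.
move=> ia ib.
have ma : measurable_fun setT a by apply/measurable_EFinP; exact: measurable_int ia.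
have mb : measurable_fun setT b by apply/measurable_EFinP; exact: measurable_int ib.
have mab : measurable_fun setT (fun p : phase * phase => (a p.1 * b p.2)%:E).
  apply/measurable_EFinP; apply: measurable_funM.
    by apply: measurableT_comp; [exact: ma|exact: measurable_fst].
  by apply: measurableT_comp; [exact: mb|exact: measurable_snd].
have iab : mu.-integrable setT (fun p => (a p.1 * b p.2)%:E).
  apply/integrable12ltyP => //.
  have E T : (\int[leb (n + n)]_Z `|(a T * b Z)%:E| =
      (`|a T|)%:E * \int[leb (n + n)]_Z `|(b Z)%:E|)%E.
    under eq_integral => Z _ do rewrite EFinM abseM.
    by rewrite ge0_integralZl//; apply: measurableT_comp => //; exact/measurable_EFinP.
  rewrite /=; under eq_integral => T _ do rewrite E.
  have /integrableP[_ foo] := ib.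
  have b0 : (0 <= \int[leb (n + n)]_Z `|(b Z)%:E|)%E by apply: integral_ge0.
  rewrite ge0_integralZr//; last by apply/measurable_EFinP; exact: measurableT_comp.
  have /integrableP[_ aoo] := ia.
  by rewrite lte_mul_pinfty// ?ge0_fin_numE//; apply: integral_ge0.
split=> //; rewrite -(integral12_prod_meas1 iab) /fubini_F /=.
rewrite -(fineK (integrable_fin_num measurableT ib)) -integralZr//.
apply: eq_integral => T _; rewrite (fineK (integrable_fin_num measurableT ib)) -integralZl//.
Qed.

End translations.

Section modulus.
Context {R : realType}.
Local Notation re := (@complex.Re R).
Local Notation im := (@complex.Im R).
Local Notation normc := (@Normc.normc R).

Lemma normc_ge0 (z : R[i]) : 0 <= normc z.
Proof. by case: z => a b; exact: sqrtr_ge0. Qed.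

Lemma normr_Re_le (z : R[i]) : `|re z| <= normc z.
Proof.
case: z => a b /=; rewrite -(ger0_norm (sqrtr_ge0 _)) -sqrtr_sqr.
by rewrite ger0_norm ?sqrtr_ge0// ler_wsqrtr// lerDl sqr_ge0.
Qed.

Lemma normr_Im_le (z : R[i]) : `|im z| <= normc z.
Proof.
case: z => a b /=; rewrite -sqrtr_sqr ler_wsqrtr// lerDr sqr_ge0 //.
Qed.

Lemma normc_le_sum (z : R[i]) : normc z <= `|re z| + `|im z|.
Proof.
case: z => a b /=; rewrite -[leRHS]ger0_norm ?addr_ge0// -sqrtr_sqr ler_wsqrtr//.
rewrite -(real_normK (num_real a)) -(real_normK (num_real b)) sqrrD lerD2r lerDl.
by rewrite mulrn_wge0// mulr_ge0.
Qed.

Lemma rotate_to_real (z : R[i]) : exists u : R[i], normc u <= 1 /\ re (u * z) = normc z.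
Proof.
case: z => a b /=; set N := Num.sqrt _.
have NN : N ^+ 2 = a ^+ 2 + b ^+ 2 by rewrite sqr_sqrtr// addr_ge0 ?sqr_ge0.
exists ((a / N) +i* (- b / N)) => /=.
have [N0|N0] := eqVneq N 0.
  by rewrite N0 invr0 !mulr0 expr0n addr0 sqrtr0 !mul0r subr0.
split; last by apply: (mulIf N0); rewrite -expr2 NN; field.
rewrite (_ : _ + _ = 1) ?sqrtr1//.
by rewrite !exprMn sqrrN -mulrDl -NN -exprMn divff// expr1n.
Qed.

End modulus.

Section growth.
Context {R : realType} {n : nat}.
Local Notation phase := 'rV[R]_(n + n).
Local Notation jspace := 'rV[R]_((n + n) + (n + n)).
Local Notation mu := (sfprod (leb (n + n)) (leb (R := R) (n + n))).
Local Notation re := (@complex.Re R).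
Local Notation im := (@complex.Im R).
Local Notation normc := (@Normc.normc R).

Lemma gmass_gt0 (c : R) : 0 < c -> 0 < @gmass R n c.
Proof.
by move=> c0; rewrite /gmass mulr_gt0 ?exprn_gt0 ?divr_gt0 ?mulr_gt0 ?pi_gt0.
Qed.

Lemma integrable_gweight c : 0 < c -> mu.-integrable setT (EFin \o @gweight R n c).
Proof.
move=> c0; apply/integrableP; split.
  by apply/measurable_EFinP; exact: measurable_gweight.
under eq_integral => p _ do rewrite /= ger0_norm ?expR_ge0//.
by have -> := @integral_gweight R n c c0; rewrite ltry.
Qed.

Lemma integrable_gauss m (c : R) : 0 < c ->
  (leb m).-integrable setT (fun v => (expR (- (c * sqn v)))%:E).
Proof.
move=> c0; apply/integrableP; split.
  apply/measurable_EFinP; apply: measurableT_comp => //; apply: measurableT_comp => //.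
  by apply: measurable_funM => //; exact: measurable_sqn.
under eq_integral => p _ do rewrite /= ger0_norm ?expR_ge0//.
by rewrite integral_gauss_rV// ltry.
Qed.

Lemma integrable_dominated d (T : measurableType d) (m : {measure set T -> \bar R}) (f g : T -> R) :
  measurable_fun setT f -> (forall x, `|f x| <= g x) ->
  m.-integrable setT (EFin \o g) -> m.-integrable setT (EFin \o f).
Proof.
move=> mf fg ig; apply: le_integrable ig => //; first exact/measurable_EFinP.
by move=> x _ /=; rewrite lee_fin (le_trans (fg x))// ler_norm.
Qed.

Lemma jholo_continuous (V : normedModType R) (J : V -> V) (f : V -> R[i]) : jholo J f ->
  continuous (re \o f) /\ continuous (im \o f).
Proof. by move=> [[f1 f2] _]; split; exact: is_C1_continuous. Qed.

Lemma continuous_pair_add (q : phase * phase) : continuous (fun p : phase * phase => q + p).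
Proof.
have h := constant_diffD (constant_diff_cst (W := (phase * phase)%type) q) (@constant_diff_id R _).
by move=> p; exact: differentiable_continuous (h p).1.
Qed.

Lemma measurable_shifted (k : R[i] -> R) (f : phase * phase -> R[i]) (q : phase * phase) :
  continuous (k \o f) -> measurable_fun setT (fun p : phase * phase => k (f (q + p))).
Proof.
move=> cf; apply: continuous_measurable_pair => p.
apply: (@continuous_comp _ _ _ (fun p : phase * phase => q + p) (k \o f)); first exact: continuous_pair_add.
exact: cf.
Qed.

(** The value at a point is a Gaussian mean of the values around it, so a bound
    on the weighted values gives one at the point; rotating the value to a
    nonnegative real first avoids losing a constant. *)
Lemma gaussian_mean_le (f : phase * phase -> R[i]) (c : R) p0 (D : phase * phase -> R) :
  0 < c -> jholo jTZ f -> mu.-integrable setT (EFin \o D) ->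
  (forall p, normc (f (p0 + p)) * gweight c p <= D p) ->
  ((normc (f p0) * @gmass R n c)%:E <= \int[mu]_p (D p)%:E)%E.
Proof.
move=> c0 fJ iD fD; have [u [u1 uz]] := rotate_to_real (f p0).
have gJ : jholo jTZ (fun p => u * f p) by apply: jholoM => //; exact: jholo_cst.
have [cg _] := jholo_continuous gJ.
have le p : `|re (u * f (p0 + p)) * gweight c p| <= D p.
  rewrite normrM (gtr0_norm (gweight_gt0 c p)); apply: le_trans (fD p).
  apply: ler_wpM2r; first exact: ltW (gweight_gt0 c p).
  apply: le_trans (normr_Re_le _) _.
  by rewrite Normc.normcM ler_piMl ?normc_ge0.
have ig : mu.-integrable setT (EFin \o (fun p => re (u * f (p0 + p)) * gweight c p)).
  apply: integrable_dominated iD => //.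
  apply: measurable_funM; last exact: measurable_gweight.
  exact: (@measurable_shifted re (fun p => u * f p)).
have <- : (\int[mu]_p (re (u * f (p0 + p)) * gweight c p)%:E = (normc (f p0) * @gmass R n c)%:E)%E.
  by rewrite -uz; apply: (gaussian_mean_re c0 gJ (p0 := p0)); exact: ig.
apply: le_integral => // p _; rewrite lee_fin.
by apply: le_trans (le p); exact: ler_norm.
Qed.

Lemma half_diff (T Z : phase) : T + 2^-1 *: Z - (T - 2^-1 *: Z) = Z.
Proof.
have h : 2^-1 + 2^-1 = 1 :> R by field.
by rewrite opprB addrC addrA subrK -scalerDl h scale1r.
Qed.

Lemma sqn_add_le m (u v : 'rV[R]_m) : sqn (u + v) <= 2 * sqn u + 2 * sqn v.
Proof.
have := sqn_ge0 (u - v); rewrite sqnB sqnD; lra.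
Qed.

Variable h : R.
Hypothesis h0 : 0 < h.

(** Half of the exponent of the weights [gweight c] with c = 4 / h, so that every
    Gaussian mean with such a weight converges absolutely. Twice the exponent in
    the definition of the space Dh is what remains of that bound at a point once
    the profile is only known to be integrable. *)
Definition subcritical (G : phase -> phase -> R[i]) : Prop :=
  exists2 C : R, 0 <= C &
    forall X Y, normc (G X Y) <= C * expR (1 / (2 * h) * sqn (X - Y)).

(** The mean at the base point (T0, Z0) with c = 2 / h, where the inequality
    |Z0 + Z|^2 <= 2 |Z0|^2 + 2 |Z|^2 leaves exactly the integral of the profile. *)
Lemma subcritical_bound (G : phase -> phase -> R[i]) (psi : phase -> R) :
  sesquiholo G -> (leb (n + n)).-integrable setT (EFin \o psi) ->
  (forall X Y, normc (G X Y) <= expR (1 / (4 * h) * sqn (X - Y)) * psi (X - Y)) ->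
  subcritical G.
Proof.
move=> GJ ipsi Gpsi; have c0 : 0 < 2 / h by rewrite divr_gt0.
have g0 := gmass_gt0 c0.
pose A := fine (\int[leb (n + n)]_T (expR (- (2 / h * sqn T)))%:E).
pose B := fine (\int[leb (n + n)]_Z (psi Z)%:E)%E.
have psi0 Z : 0 <= psi Z.
  have := le_trans (normc_ge0 _) (Gpsi Z 0).
  by rewrite subr0 pmulr_rge0 ?expR_gt0.
have A0 : 0 <= A by rewrite fine_ge0// integral_ge0// => T _; rewrite lee_fin expR_ge0.
have B0 : 0 <= B by rewrite fine_ge0// integral_ge0// => T _; rewrite lee_fin.
exists (A * B / @gmass R n (2 / h)) => [|X Y]; first exact: divr_ge0 (mulr_ge0 A0 B0) (ltW g0).
set e := expR _; rewrite (TZ_shift G).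
set p0 := (2^-1 *: (X + Y), X - Y).
have := @gaussian_mean_le (TZ G) (2 / h) p0
  (fun p => expR (- (2 / h * sqn p.1)) * (e * psi (p.2 + p0.2))) c0 (jholo_TZ GJ).
have ip : (leb (n + n)).-integrable setT (EFin \o (fun Z => e * psi (Z + p0.2))).
  have := integrable_leb_translate p0.2 ipsi.
  by move=> /(integrableZl measurableT e).
have [iD ED] := integrable_tensor (integrable_gauss (n + n) c0) ip.
move=> /(_ iD); rewrite ED.
have -> : (\int[leb (n + n)]_Z (e * psi (Z + p0.2))%:E = (e * B)%:E)%E.
  under eq_integral => Z _ do rewrite EFinM.
  rewrite integralZl//; last exact: (integrable_leb_translate p0.2 ipsi).
  rewrite (@integral_leb_translate _ _ p0.2 (EFin \o psi)); last exact: measurable_int ipsi.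
  by rewrite EFinM /B fineK//; exact: integrable_fin_num.
have -> : (\int[leb (n + n)]_T (expR (- (2 / h * sqn T)))%:E = A%:E)%E.
  by rewrite /A fineK//; exact: (integrable_fin_num measurableT (integrable_gauss (n + n) c0)).
rewrite -EFinM lee_fin => H; rewrite mulrAC ler_pdivlMr//.
apply: le_trans (H _) _; last by rewrite mulrCA mulrC mulrAC.
move=> p; apply: le_trans (_ : expR (1 / (4 * h) * sqn (p.2 + p0.2)) * psi (p.2 + p0.2) * gweight (2 / h) p <= _).
  apply: ler_wpM2r; first exact: ltW (gweight_gt0 _ p).
  rewrite /TZ.
  have := Gpsi ((p0 + p).1 + 2^-1 *: (p0 + p).2) ((p0 + p).1 - 2^-1 *: (p0 + p).2).
  by rewrite half_diff [(p0 + p).2]addrC.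
rewrite mulrAC [leRHS]mulrA ler_wpM2r//.
rewrite /gweight -!expRD ler_expR.
have h1 := sqn_add_le p.2 p0.2.
have h2 : 1 / (4 * h) * sqn (p.2 + p0.2) <= 1 / (4 * h) * (2 * sqn p.2 + 2 * sqn p0.2).
  by rewrite ler_wpM2l// divr_ge0// mulr_ge0// ltW.
apply: le_trans (lerD h2 (lexx _)) _; rewrite le_eqVlt; apply/orP; left; apply/eqP.
by rewrite /p0 /=; field; rewrite gt_eqF.
Qed.

End growth.

(** * Analyticity, and averages of translates *)

Lemma integrable_scaled {R : realType} d (T : measurableType d) (m : {measure set T -> \bar R})
    (c : R) (f : T -> R) :
  m.-integrable setT (EFin \o f) -> m.-integrable setT (EFin \o (fun x => c * f x)).
Proof. exact: (integrableZl measurableT c). Qed.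

Section averages.
Context {R : realType} {n : nat}.
Local Notation phase := 'rV[R]_(n + n).
Local Notation jspace := 'rV[R]_((n + n) + (n + n)).
Local Notation mu := (sfprod (leb (n + n)) (leb (R := R) (n + n))).
Local Notation re := (@complex.Re R).
Local Notation im := (@complex.Im R).
Local Notation normc := (@Normc.normc R).

Variables (h : R) (h0 : 0 < h).
Variable (G : phase -> phase -> R[i]).
Hypothesis GJ : sesquiholo G.
Hypothesis Gsub : subcritical h G.

Definition ofXY (W : jspace) : phase * phase :=
  (2^-1 *: (lsubmx W + rsubmx W), lsubmx W - rsubmx W).

Lemma ofXYK W : toXY (ofXY W) = W.
Proof.
have h2 : 2^-1 + 2^-1 = 1 :> R by field.
rewrite /toXY /ofXY /= -scalerDr -scalerBr -[RHS]hsubmxK; congr row_mx.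
  by rewrite addrACA subrr addr0 scalerDr -scalerDl h2 scale1r.
by rewrite opprB [rsubmx W - _]addrC addrACA subrr add0r scalerDr -scalerDl h2 scale1r.
Qed.

Definition shift_both (s : phase) (X Y : phase) : R[i] := G (X - s) (Y - s).

Lemma joint_shift_both s W : joint (shift_both s) W = TZ G ((ofXY W).1 - s, (ofXY W).2).
Proof.
have h2 : 2^-1 + 2^-1 = 1 :> R by field.
rewrite /joint /shift_both TZ_shift /ofXY /=; congr (TZ G (_, _)).
  by rewrite addrACA -opprD scalerBr [2^-1 *: (s + s)]scalerDr -scalerDl h2 scale1r.
by rewrite opprB addrA subrK.
Qed.

Lemma sesquiholo_shift s : sesquiholo (shift_both s).
Proof.
rewrite /sesquiholo (_ : joint _ = joint G \o (fun W => W - row_mx s s)).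
  apply: (jholo_comp (L := fun v => v - 0) _ _ GJ); last by move=> v; rewrite !subr0.
  by apply: constant_diffB; [exact: constant_diff_id|exact: constant_diff_cst].
apply/funext => W; rewrite /joint /shift_both /=.
by rewrite !linearB /= row_mxKl row_mxKr.
Qed.

Lemma sqn_toXY (p : phase * phase) : sqn (toXY p) = 2 * (sqn p.1 + sqn p.2 / 4).
Proof.
by rewrite {1}/sqn dotv_row_mx -!/(sqn _) sqnD sqnB !sqnZ; field.
Qed.

Lemma toXYB (p q : phase * phase) : toXY (p - q) = toXY p - toXY q.
Proof.
rewrite /toXY opp_row_mx add_row_mx /=; congr row_mx.
  by rewrite scalerBr addrACA opprD.
by rewrite scalerBr opprD opprK addrACA opprD opprK.
Qed.

Lemma gkernel_prod (c c' : R) (P w : jspace) :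
  \prod_j gkernel c c' (P 0 j) (w 0 j) = expR (c' * sqn w - c * sqn (w - P)).
Proof.
rewrite /gkernel -expR_sum; congr expR; rewrite !sqnE !mulr_sumr -sumrB.
by apply: eq_bigr => j _; rewrite !mxE.
Qed.

Lemma gweight_gkernel (p : phase * phase) (W : jspace) :
  gweight (4 / h) p * \prod_j gkernel (4 / h) (2 / h) (W 0 j) (toXY p 0 j) =
  gweight (8 / h) (p - ofXY W).
Proof.
rewrite gkernel_prod -{1}(ofXYK W) -toXYB !sqn_toXY /gweight -expRD; congr expR.
by field; rewrite gt_eqF.
Qed.

Section part.
Let c0 : 0 < 2 / h :> R. Proof. by rewrite divr_gt0. Qed.
Variable k : R[i] -> R.
Hypothesis k_le : forall z, `|k z| <= normc z.
Hypothesis kc : continuous (k \o TZ G).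
Hypothesis kmean : forall (c : R) p0, 0 < c ->
  mu.-integrable setT (fun p => (k (TZ G (p0 + p)) * gweight c p)%:E) ->
  (\int[mu]_p (k (TZ G (p0 + p)) * gweight c p)%:E = (k (TZ G p0) * @gmass R n c)%:E)%E.

(** Normalised so that its transform is the function itself; the shift [s] of the
    argument is kept here, away from the analytic kernel. *)
Definition density (s : phase) (p : phase * phase) : R :=
  (@gmass R n (8 / h))^-1 * (k (TZ G (p.1 - s, p.2)) * gweight (4 / h) p).

Lemma shift_pairE (s : phase) (p : phase * phase) : (p.1 - s, p.2) = ((- s, 0) : phase * phase) + p.
Proof. by case: p => T Z; congr pair; rewrite /= ?add0r// addrC. Qed.

Lemma measurable_density s : measurable_fun setT (density s).
Proof.
apply: measurable_funM => //; apply: measurable_funM; last exact: measurable_gweight.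
under eq_fun do rewrite shift_pairE.
exact: measurable_shifted.
Qed.

Lemma measurable_density2 : measurable_fun setT (fun z : phase * (phase * phase) => density z.1 z.2).
Proof.
apply: measurable_funM => //; apply: measurable_funM; last first.
  by apply: measurableT_comp; [exact: measurable_gweight|exact: measurable_snd].
apply: (@measurableT_comp _ _ _ _ _ _ (k \o TZ G)); first exact: continuous_measurable_pair.
have m1 : measurable_fun setT (fun z : phase * (phase * phase) => z.2.1).
  exact: (measurableT_comp measurable_fst measurable_snd).
have m2 : measurable_fun setT (fun z : phase * (phase * phase) => z.2.2).
  exact: (measurableT_comp measurable_snd measurable_snd).
apply/measurable_fun_pairP; split; last exact: m2.
by apply: measurable_rV_add; [exact: m1|apply: measurable_rV_opp; exact: measurable_fst].
Qed.

Lemma density_le : exists2 C, 0 <= C & forall s p, `|density s p| <= C * gweight (2 / h) p.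
Proof.
have [C C0 GC] := Gsub; have g0 := @gmass_gt0 R n (8 / h).
have {}g0 : 0 < @gmass R n (8 / h) by apply: g0; rewrite divr_gt0.
exists ((@gmass R n (8 / h))^-1 * C) => [|s p]; first by rewrite mulr_ge0// invr_ge0 ltW.
rewrite /density normrM gtr0_norm ?invr_gt0// -mulrA ler_wpM2l ?invr_ge0 ?(ltW g0)//.
rewrite normrM (gtr0_norm (gweight_gt0 _ p)).
have := GC (p.1 - s + 2^-1 *: p.2) (p.1 - s - 2^-1 *: p.2); rewrite half_diff => H.
apply: le_trans (ler_wpM2r (ltW (gweight_gt0 _ p)) (le_trans (k_le _) H)) _.
rewrite -[C * _ * _]mulrA; apply: ler_wpM2l => //; rewrite /gweight -expRD ler_expR.
have := sqn_ge0 p.1; have hi : 0 < h^-1 by rewrite invr_gt0.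
move=> /(mulr_ge0 (ltW hi)) H1.
rewrite (_ : 1 / (2 * h) = h^-1 / 2); last by field; rewrite gt_eqF.
by move: H1; lra.
Qed.

Lemma integrable_density s : mu.-integrable setT (EFin \o density s).
Proof.
have [C C0 dC] := density_le; apply: (integrable_dominated (measurable_density s) (dC s)).
exact: (integrable_scaled C (integrable_gweight c0)).
Qed.

Lemma measurable_toXY j : measurable_fun setT (fun p : phase * phase => toXY p 0 j).
Proof.
apply: (measurableT_comp (measurable_coord j)); apply: measurable_row_mx.
  apply: measurable_rV_add; first exact: measurable_fst.
  by apply: measurable_rV_scale => //; exact: measurable_snd.
apply: measurable_rV_add; first exact: measurable_fst.
by apply: measurable_rV_opp; apply: measurable_rV_scale => //; exact: measurable_snd.
Qed.

Let cc : 2 / h < 4 / h :> R. Proof. by rewrite ltr_pM2r ?invr_gt0// ltr_nat. Qed.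

(** The Gaussian mean at the point shifted by [s], after the integration variable
    has been translated so that the point enters through the kernel only. *)
Lemma kernel_transform_density s :
  kernel_transform mu (4 / h) (2 / h) (density s) toXY = k \o joint (shift_both s).
Proof.
apply/funext => W /=; rewrite joint_shift_both /kernel_transform /Rintegral.
set q := ofXY W; set p0 := ((q.1 - s), q.2).
have c8 : 0 < 8 / h by rewrite divr_gt0.
have E p : (density s p * \prod_j gkernel (4 / h) (2 / h) (W 0 j) (toXY p 0 j))%:E =
    (((@gmass R n (8 / h))^-1)%:E * (fun p => (k (TZ G (p0 + p)) * gweight (8 / h) p)%:E) (p - q)%R)%E.
  rewrite -EFinM /density; congr EFin; rewrite -2!mulrA; congr (_ * _).
  rewrite gweight_gkernel -/q; congr (k (TZ G _) * _).
  by rewrite /p0 !shift_pairE -addrA [q + _]addrC subrK.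
under eq_integral => p _ do rewrite E.
have mF : measurable_fun setT (fun p => (k (TZ G (p0 + p)) * gweight (8 / h) p)%:E).
  apply/measurable_EFinP; apply: measurable_funM; last exact: measurable_gweight.
  exact: measurable_shifted.
have iF : mu.-integrable setT (fun p => (k (TZ G (p0 + p)) * gweight (8 / h) p)%:E).
  have [C C0 GC] := Gsub.
  apply: (@integrable_dominated _ _ _ _ _ (fun p => C * expR (1 / h * sqn p0.2) * gweight (4 / h) p)).
  - by apply/measurable_EFinP.
  - move=> p; rewrite normrM (gtr0_norm (gweight_gt0 _ p)).
    have := GC ((p0 + p).1 + 2^-1 *: (p0 + p).2) ((p0 + p).1 - 2^-1 *: (p0 + p).2).
    rewrite half_diff => H.
    apply: le_trans (ler_wpM2r (ltW (gweight_gt0 _ p)) (le_trans (k_le _) H)) _.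
    rewrite -[C * _ * _]mulrA -[C * _ * _]mulrA; apply: ler_wpM2l => //.
    rewrite /gweight -!expRD ler_expR.
    have h1 : 1 / (2 * h) * sqn (p0 + p).2 <= 1 / (2 * h) * (2 * sqn p0.2 + 2 * sqn p.2).
      by apply: ler_wpM2l; [rewrite divr_ge0// mulr_ge0// ltW|exact: sqn_add_le].
    apply: le_trans (lerD h1 (lexx _)) _.
    have := sqn_ge0 p.1; have hi : 0 < h^-1 by rewrite invr_gt0.
    move=> /(mulr_ge0 (ltW hi)) H1.
    rewrite (_ : 1 / (2 * h) = h^-1 / 2); last by field; rewrite gt_eqF.
    by move: H1; lra.
  - have c4 : 0 < 4 / h by rewrite divr_gt0.
    exact: (integrable_scaled _ (integrable_gweight c4)).
have iFq := @integrable_invariant R _ _ mu (fun p => p - q) (measurable_pair_translate (- q))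
  (fun F mF _ => integral_phase_translate (- q) mF) _ iF.
rewrite integralZl//.
rewrite (integral_phase_translate (- q) mF) kmean// -EFinM /=.
by rewrite mulrC mulfK// gt_eqF// gmass_gt0.
Qed.

Section measure_average.
Variable m : {finite_measure set phase -> \bar R}.
Local Notation mm := (m \x mu)%E.
Local Notation density2 := (fun z : phase * (phase * phase) => density z.1 z.2).
Local Notation toXY2 := (fun z : phase * (phase * phase) => toXY z.2).

Lemma integrable_density2 : mm.-integrable setT (EFin \o density2).
Proof.
have [C C0 dC] := density_le.
apply: (integrable_dominated measurable_density2 (g := fun z => C * gweight (2 / h) z.2)).
  by move=> z; exact: dC.
apply: integrable_scaled; apply/integrable12ltyP.
  apply/measurable_EFinP; apply: measurableT_comp; last exact: measurable_snd.
  exact: measurable_gweight.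
under eq_integral => s _.
  under eq_integral => p _ do rewrite /= ger0_norm ?expR_ge0//.
  rewrite (integral_gweight c0); over.
rewrite integral_cst// lte_mul_pinfty ?lee_fin ?ltW ?gmass_gt0//.
by rewrite ltey_eq fin_num_measure.
Qed.

Lemma measurable_toXY2 j : measurable_fun setT (fun z : phase * (phase * phase) => toXY2 z 0 j).
Proof. exact: (measurableT_comp (measurable_toXY j) measurable_snd). Qed.

(** Transforms and their derivatives are integrals of kernel coefficients, so one
    use of Fubini's theorem moves the measure [m] across both. *)
Lemma kernel_coeff_fubini P b :
  m.-integrable setT (EFin \o (fun s => kernel_coeff mu (4 / h) (2 / h) (density s) toXY P b)) /\
  kernel_coeff mm (4 / h) (2 / h) density2 toXY2 P b =
  \int[m]_s kernel_coeff mu (4 / h) (2 / h) (density s) toXY P b.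
Proof.
have i2 := integrable_kernel_coeff c0 cc integrable_density2 measurable_toXY2 P b.
have i1 s := integrable_kernel_coeff c0 cc (integrable_density s) measurable_toXY P b.
have E : fubini_F mu (EFin \o (fun z : phase * (phase * phase) => density2 z *
     \prod_j gkernel_coeff (4 / h) (2 / h) (P 0 j) (b j) (toXY2 z 0 j))) =
   EFin \o (fun s => kernel_coeff mu (4 / h) (2 / h) (density s) toXY P b).
  apply/funext => s; rewrite /fubini_F /kernel_coeff /Rintegral /= fineK//.
  exact: (integrable_fin_num measurableT (i1 s)).
split; first by rewrite -E; exact: integrable_fubini_F i2.
by rewrite /kernel_coeff /Rintegral -(integral12_prod_meas1 i2) E.
Qed.

Lemma kernel_transform_centre d (T : measurableType d) (nu : {measure set T -> \bar R})
    (U : T -> R) (w : T -> jspace) P :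
  nu.-integrable setT (EFin \o U) -> (forall j, measurable_fun setT (fun x => w x 0 j)) ->
  kernel_transform nu (4 / h) (2 / h) U w P = kernel_coeff nu (4 / h) (2 / h) U w P [ffun=> 0%N].
Proof.
move=> iU mw; apply/esym.
exact: power_series_centre0 (kernel_transform_series c0 cc iU mw P).
Qed.

Lemma average_kernel_transform :
  kernel_transform mm (4 / h) (2 / h) density2 toXY2 =
  (fun P => \int[m]_s k (joint (shift_both s) P)).
Proof.
apply/funext => P.
rewrite (kernel_transform_centre _ integrable_density2 measurable_toXY2).
rewrite (kernel_coeff_fubini P _).2; apply: eq_Rintegral => s _.
rewrite -(kernel_transform_centre _ (integrable_density s) measurable_toXY).
by rewrite kernel_transform_density.
Qed.

Lemma average_analytic : real_analytic (fun P => \int[m]_s k (joint (shift_both s) P)).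
Proof.
rewrite -average_kernel_transform.
exact: (kernel_transform_analytic c0 cc integrable_density2 measurable_toXY2).
Qed.

Lemma derive_average P j :
  m.-integrable setT (EFin \o (fun s => 'D_(delta_mx 0 j) (k \o joint (shift_both s)) P)) /\
  'D_(delta_mx 0 j) (fun P => \int[m]_s k (joint (shift_both s) P)) P =
  \int[m]_s 'D_(delta_mx 0 j) (k \o joint (shift_both s)) P.
Proof.
have [i E] := kernel_coeff_fubini P (unit_index j).
have D s : 'D_(delta_mx 0 j) (k \o joint (shift_both s)) P =
    kernel_coeff mu (4 / h) (2 / h) (density s) toXY P (unit_index j).
  rewrite -kernel_transform_density.
  exact: (derive_kernel_transform c0 cc (integrable_density s) measurable_toXY).
split; first by rewrite (_ : (fun s => _) = fun s =>
  kernel_coeff mu (4 / h) (2 / h) (density s) toXY P (unit_index j))//; apply/funext.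
rewrite -average_kernel_transform.
rewrite (derive_kernel_transform c0 cc integrable_density2 measurable_toXY2) E.
by apply: eq_Rintegral => s _; rewrite D.
Qed.

End measure_average.

Lemma part_analytic : real_analytic (k \o joint G).
Proof.
have -> : k \o joint G = k \o joint (shift_both 0).
  by apply/funext => W; rewrite /= /joint /shift_both !subr0.
rewrite -kernel_transform_density.
exact: (kernel_transform_analytic c0 cc (integrable_density 0) measurable_toXY).
Qed.

End part.

Let fJ := jholo_TZ GJ.

Let reC := (jholo_continuous fJ).1.
Let imC := (jholo_continuous fJ).2.

Let reM (c : R) p0 : 0 < c ->
  mu.-integrable setT (fun p => (re (TZ G (p0 + p)) * gweight c p)%:E) ->
  (\int[mu]_p (re (TZ G (p0 + p)) * gweight c p)%:E = (re (TZ G p0) * @gmass R n c)%:E)%E.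
Proof. move=> c0; exact: (gaussian_mean_re c0 fJ (p0 := p0)). Qed.

Let imM (c : R) p0 : 0 < c ->
  mu.-integrable setT (fun p => (im (TZ G (p0 + p)) * gweight c p)%:E) ->
  (\int[mu]_p (im (TZ G (p0 + p)) * gweight c p)%:E = (im (TZ G p0) * @gmass R n c)%:E)%E.
Proof. move=> c0; exact: (gaussian_mean_im c0 fJ (p0 := p0)). Qed.

(** C^1 with Cauchy-Riemann and subcritical growth imply analyticity, through the
    representation as a Gaussian transform. *)
Theorem sesquiholo_analytic : real_canalytic (joint G).
Proof.
split; first exact: (part_analytic (@normr_Re_le R) reC reM).
exact: (part_analytic (@normr_Im_le R) imC imM).
Qed.

Lemma sesquiholo_sesqui_CR : sesqui_CR G.
Proof. by have /sesquiholoP[] := GJ. Qed.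

Lemma row_mx_delta_l (i : 'I_(n + n)) :
  row_mx (delta_mx 0 i) 0 = delta_mx 0 (lshift (n + n) i) :> jspace.
Proof. by rewrite delta_mx_lshift. Qed.

Lemma row_mx_delta_r (i : 'I_(n + n)) :
  row_mx 0 (delta_mx 0 i) = delta_mx 0 (rshift (n + n) i) :> jspace.
Proof. by rewrite delta_mx_rshift. Qed.

(** The average is a Gaussian transform over the product of [m] with the phase
    space, hence C^1; its derivatives are averages of derivatives, so it
    inherits the Cauchy-Riemann equations. *)
Theorem sesquiholo_average (m : {finite_measure set phase -> \bar R}) :
  sesquiholo (fun X Y => (\int[m]_s re (G (X - s) (Y - s))) +i* (\int[m]_s im (G (X - s) (Y - s)))).
Proof.
set A := fun X Y => _ +i* _.
have rA : re \o joint A = fun P => \int[m]_s re (joint (shift_both s) P) by [].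
have iA : im \o joint A = fun P => \int[m]_s im (joint (shift_both s) P) by [].
have AC : is_cC1 (joint A).
  split; apply: real_analytic_C1.
    by rewrite rA; exact: (average_analytic (@normr_Re_le R) reC reM).
  by rewrite iA; exact: (average_analytic (@normr_Im_le R) imC imM).
apply/sesquiholoP; split=> //; apply/sesqui_CR_derive => X Y j.
have dR i := derive_average (@normr_Re_le R) reC reM m (row_mx X Y) i.
have dI i := derive_average (@normr_Im_le R) imC imM m (row_mx X Y) i.
have CR s := (sesqui_CR_derive _).1 ((sesquiholoP _).1 (sesquiholo_shift s)).2 X Y j.
have RintN (f : phase -> R) : m.-integrable setT (EFin \o f) ->
    \int[m]_s - f s = - \int[m]_s f s.
  move=> intf; rewrite -[RHS]mulN1r -RintegralZl//.
  by apply: eq_Rintegral => s _; rewrite mulN1r.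
rewrite rA iA !row_mx_delta_l !row_mx_delta_r (dR _).2 (dI _).2 (dR _).2 (dI _).2.
rewrite (dR _).2 (dI _).2 (dR _).2 (dI _).2.
rewrite -!RintN; [|exact: (dR _).1|exact: (dI _).1].
by split; apply: eq_Rintegral => s _; have [] := CR s; rewrite !row_mx_delta_l !row_mx_delta_r.
Qed.

End averages.

(** * The space Dh and its two descriptions *)

(** The remaining fields are propositions. *)
Lemma measure_ext d (T : measurableType d) (R : realType) (m1 m2 : {measure set T -> \bar R}) :
  (m1 : set T -> \bar R) = m2 -> m1 = m2.
Proof.
case: m1 => s1 [[a1 b1] [c1]]; case: m2 => s2 [[a2 b2] [c2]] /= E.
move: a2 b2 c2; rewrite -E => a2 b2 c2.
by rewrite (Prop_irrelevance a2 a1) (Prop_irrelevance b2 b1) (Prop_irrelevance c2 c1).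
Qed.
Lemma lebE (R : realType) n : lebesgue_rV n = (leb n : {measure set 'rV[R]_n -> \bar R}).
Proof. exact: measure_ext. Qed.

Section essentially_bounded.
Context {d} {T : measurableType d} {R : realType} (mu : {measure set T -> \bar R}).

Lemma Lfun_ooP (f : T -> R) : f \in Lfun mu +oo <->
  measurable_fun setT f /\ exists M : R, {ae mu, forall x, `|f x| <= M}.
Proof.
split=> [|[mf [M fM]]].
  rewrite inE => /andP[]; rewrite !inE /= => mf; rewrite /finite_norm unlock.
  case: ifPn => mu0 finf; split=> //.
    have [M fM] : exists M : R, (ess_sup_inf.ess_sup mu (abse \o (EFin \o f)) <= M%:E)%E.
      move: finf; case: (ess_sup_inf.ess_sup mu _) => [r _||_]; [by exists r|by []|by exists 0; exact: leNye].
    by exists M; move/ess_sup_inf.ess_supP : fM; apply: filterS => x; rewrite /= lee_fin.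
  exists 0; exists setT; split=> //.
  by apply/eqP; rewrite eq_le measure_ge0 andbT leNgt.
rewrite inE; apply/andP; split; rewrite inE //= /finite_norm unlock.
case: ifPn => _; last exact: ltry.
apply: (@le_lt_trans _ _ M%:E); last exact: ltry.
by apply/ess_sup_inf.ess_supP; move: fM; apply: filterS => x; rewrite /= lee_fin.
Qed.

Definition L1oo (psi : T -> R) : Prop :=
  mu.-integrable setT (EFin \o psi) /\ exists M : R, {ae mu, forall x, `|psi x| <= M}.

Lemma L1ooP (psi : T -> R) : L1oo psi <-> psi \in Lfun mu 1 /\ psi \in Lfun mu +oo.
Proof.
split=> [[ipsi bpsi]|[/Lfun1_integrable ipsi /Lfun_ooP[_ bpsi]]//].
split; first exact/Lfun1_integrable.
by apply/Lfun_ooP; split=> //; apply/measurable_EFinP; exact: measurable_int ipsi.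
Qed.

Lemma L1oo_linear (a b : R) (f g : T -> R) : L1oo f -> L1oo g ->
  L1oo (fun x => a * f x + b * g x).
Proof.
move=> [fi [M fM]] [gi [N gN]]; split.
  exact: (integrableD measurableT (integrable_scaled a fi) (integrable_scaled b gi)).
exists (`|a| * M + `|b| * N); apply: filterS2 fM gN => x fx gx.
by rewrite (le_trans (ler_normD _ _))// !normrM lerD// ler_wpM2l.
Qed.

Lemma L1oo_norm (f : T -> R) : L1oo f -> L1oo (fun x => `|f x|).
Proof.
move=> [fi [M fM]]; split; first exact: (integrable_abse fi).
by exists M; apply: filterS fM => x; rewrite normr_id.
Qed.

End essentially_bounded.

Section four_real_coordinates.
Context {R : realType} {n : nat}.
Local Notation vec := 'rV[R]_n.
Local Notation quad := (vec * vec * vec * vec)%type.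
Local Notation phase := 'rV[R]_(n + n).
Local Notation jspace := 'rV[R]_((n + n) + (n + n)).
Local Notation re := (@complex.Re R).
Local Notation im := (@complex.Im R).
Implicit Types Ft : vec -> vec -> vec -> vec -> R[i].

Definition J4 (q : quad) : quad := (- q.1.1.2, q.1.1.1, - q.2, q.1.2).

Lemma J4D u v : J4 (u + v) = J4 u + J4 v.
Proof. by rewrite /J4 /= !opprD. Qed.

Lemma J4Z a v : J4 (a *: v) = a *: J4 v.
Proof. by rewrite /J4 /= -!scalerN. Qed.

Lemma J4K v : J4 (J4 v) = - v.
Proof. by case: v => [[[a b] c] e]; rewrite /J4 /=. Qed.

Lemma holomorphicP Ft : holomorphic Ft <-> jholo J4 (joint4 Ft).
Proof.
have z a (u v : vec) : a *: 0 + v = v by rewrite scaler0 add0r.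
have D1 x1 x2 x3 x4 i : cpartial (fun y => Ft y x2 x3 x4) i x1 =
    'D_(delta_mx 0 i, 0, 0, 0) (re \o joint4 Ft) (x1, x2, x3, x4) +i*
    'D_(delta_mx 0 i, 0, 0, 0) (im \o joint4 Ft) (x1, x2, x3, x4).
  have sl (a : R) : (a *: delta_mx 0 i + x1, x2, x3, x4) =
      a *: ((delta_mx 0 i, 0, 0, 0) : quad) + (x1, x2, x3, x4).
    by congr (_, _, _, _) => /=; rewrite scaler0 add0r.
  rewrite -(@derive_slice R _ _ (re \o joint4 Ft) (fun y => (y, x2, x3, x4)) x1 _ _ sl).
  by rewrite -(@derive_slice R _ _ (im \o joint4 Ft) (fun y => (y, x2, x3, x4)) x1 _ _ sl).
have D2 x1 x2 x3 x4 i : cpartial (fun y => Ft x1 y x3 x4) i x2 =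
    'D_(0, delta_mx 0 i, 0, 0) (re \o joint4 Ft) (x1, x2, x3, x4) +i*
    'D_(0, delta_mx 0 i, 0, 0) (im \o joint4 Ft) (x1, x2, x3, x4).
  have sl (a : R) : (x1, a *: delta_mx 0 i + x2, x3, x4) =
      a *: ((0, delta_mx 0 i, 0, 0) : quad) + (x1, x2, x3, x4).
    by congr (_, _, _, _) => /=; rewrite scaler0 add0r.
  rewrite -(@derive_slice R _ _ (re \o joint4 Ft) (fun y => (x1, y, x3, x4)) x2 _ _ sl).
  by rewrite -(@derive_slice R _ _ (im \o joint4 Ft) (fun y => (x1, y, x3, x4)) x2 _ _ sl).
have D3 x1 x2 x3 x4 i : cpartial (fun y => Ft x1 x2 y x4) i x3 =
    'D_(0, 0, delta_mx 0 i, 0) (re \o joint4 Ft) (x1, x2, x3, x4) +i*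
    'D_(0, 0, delta_mx 0 i, 0) (im \o joint4 Ft) (x1, x2, x3, x4).
  have sl (a : R) : (x1, x2, a *: delta_mx 0 i + x3, x4) =
      a *: ((0, 0, delta_mx 0 i, 0) : quad) + (x1, x2, x3, x4).
    by congr (_, _, _, _) => /=; rewrite scaler0 add0r.
  rewrite -(@derive_slice R _ _ (re \o joint4 Ft) (fun y => (x1, x2, y, x4)) x3 _ _ sl).
  by rewrite -(@derive_slice R _ _ (im \o joint4 Ft) (fun y => (x1, x2, y, x4)) x3 _ _ sl).
have D4 x1 x2 x3 x4 i : cpartial (fun y => Ft x1 x2 x3 y) i x4 =
    'D_(0, 0, 0, delta_mx 0 i) (re \o joint4 Ft) (x1, x2, x3, x4) +i*
    'D_(0, 0, 0, delta_mx 0 i) (im \o joint4 Ft) (x1, x2, x3, x4).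
  have sl (a : R) : (x1, x2, x3, a *: delta_mx 0 i + x4) =
      a *: ((0, 0, 0, delta_mx 0 i) : quad) + (x1, x2, x3, x4).
    by congr (_, _, _, _) => /=; rewrite scaler0 add0r.
  rewrite -(@derive_slice R _ _ (re \o joint4 Ft) (fun y => (x1, x2, x3, y)) x4 _ _ sl).
  by rewrite -(@derive_slice R _ _ (im \o joint4 Ft) (fun y => (x1, x2, x3, y)) x4 _ _ sl).
have j1 (v : vec) : J4 (v, 0, 0, 0) = (0, v, 0, 0) by rewrite /J4 /= oppr0.
have j3 (v : vec) : J4 (0, 0, v, 0) = (0, 0, 0, v) by rewrite /J4 /= oppr0.
split=> [[FC CR]|[FC CR]]; last first.
  split=> // x1 x2 x3 x4 j; rewrite D1 D2 D3 D4.
  have := CR (x1, x2, x3, x4) (delta_mx 0 j, 0, 0, 0); rewrite j1 => h1.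
  have := CR (x1, x2, x3, x4) (0, 0, delta_mx 0 j, 0); rewrite j3 => h3.
  by split; apply/CR_plus; [exact: h1|exact: h3].
suff H v : CR_at J4 (joint4 Ft) v by split=> // p v; exact: H.
have H1 j : CR_at J4 (joint4 Ft) (delta_mx 0 j, 0, 0, 0).
  move=> -[[[x1 x2] x3] x4]; rewrite j1.
  by have [] := CR x1 x2 x3 x4 j; rewrite D1 D2 => /CR_plus.
have H3 j : CR_at J4 (joint4 Ft) (0, 0, delta_mx 0 j, 0).
  move=> -[[[x1 x2] x3] x4]; rewrite j3.
  by have [_] := CR x1 x2 x3 x4 j; rewrite D3 D4 => /CR_plus.
have E1 (x : vec) : CR_at J4 (joint4 Ft) (x, 0, 0, 0).
  apply: (CR_at_embedding J4D J4Z FC (iota := fun x => (x, 0, 0, 0))); last exact: H1.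
  - move=> u w; congr (_, _, _, _); rewrite /= ?addr0 //.
  - move=> a w; congr (_, _, _, _); rewrite /= ?scaler0 //.
have E3 (x : vec) : CR_at J4 (joint4 Ft) (0, 0, x, 0).
  apply: (CR_at_embedding J4D J4Z FC (iota := fun x => (0, 0, x, 0))); last exact: H3.
  - move=> u w; congr (_, _, _, _); rewrite /= ?addr0 //.
  - move=> a w; congr (_, _, _, _); rewrite /= ?scaler0 //.
have E2 (x : vec) : CR_at J4 (joint4 Ft) (0, x, 0, 0).
  by rewrite -j1; apply: (CR_at_J FC); [exact: J4K|exact: E1].
have E4 (x : vec) : CR_at J4 (joint4 Ft) (0, 0, 0, x).
  by rewrite -j3; apply: (CR_at_J FC); [exact: J4K|exact: E3].
case: v => [[[x1 x2] x3] x4].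
have -> : (x1, x2, x3, x4) = ((x1, 0, 0, 0) : quad) + (0, x2, 0, 0) + (0, 0, x3, 0) + (0, 0, 0, x4).
  by congr (_, _, _, _) => /=; rewrite ?addr0 ?add0r.
apply: (CR_atD J4D FC); last exact: E4.
apply: (CR_atD J4D FC); last exact: E3.
by apply: (CR_atD J4D FC); [exact: E1|exact: E2].
Qed.

(** The point of C^2n that corresponds to (X, Y) in the formula for the extension. *)
Definition toQuad (W : jspace) : quad :=
  (2^-1 *: (lsubmx (lsubmx W) + lsubmx (rsubmx W)),
   2^-1 *: (rsubmx (lsubmx W) - rsubmx (rsubmx W)),
   2^-1 *: (rsubmx (lsubmx W) + rsubmx (rsubmx W)),
   2^-1 *: (lsubmx (rsubmx W) - lsubmx (lsubmx W))).

Lemma constant_diff_toQuad : has_constant_diff toQuad toQuad.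
Proof.
have l := @constant_diff_lsubmx R; have r := @constant_diff_rsubmx R.
have ll := constant_diff_comp (@l n n) (@l (n + n) (n + n)).
have lr := constant_diff_comp (@l n n) (@r (n + n) (n + n)).
have rl := constant_diff_comp (@r n n) (@l (n + n) (n + n)).
have rr := constant_diff_comp (@r n n) (@r (n + n) (n + n)).
by do ?[apply: constant_diff_pair]; apply: constant_diffZ;
  [exact: constant_diffD ll lr|exact: constant_diffB rl rr|
   exact: constant_diffD rl rr|exact: constant_diffB lr ll].
Qed.

Lemma sesquiholo_sesqui_of Ft : holomorphic Ft -> sesquiholo (sesqui_of Ft).
Proof.
move=> /holomorphicP FJ; rewrite /sesquiholo.
rewrite (_ : joint (sesqui_of Ft) = joint4 Ft \o toQuad)//.
apply: (jholo_comp constant_diff_toQuad _ FJ) => v.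
rewrite /toQuad /jW /J4 /jrot /= opp_row_mx opprK !(row_mxKl, row_mxKr) -!scalerN.
by congr (_, _, _, _); congr (_ *: _); rewrite ?opprD ?opprB ?opprK// addrC.
Qed.

(** The inverse of [toQuad]. *)
Definition ofQuad (q : quad) : jspace :=
  row_mx (row_mx (q.1.1.1 - q.2) (q.1.2 + q.1.1.2)) (row_mx (q.1.1.1 + q.2) (q.1.2 - q.1.1.2)).

Lemma constant_diff_ofQuad : has_constant_diff ofQuad ofQuad.
Proof.
have c4 := @constant_diff_snd R vec (vec * vec * vec)%type.
have f3 := @constant_diff_fst R vec (vec * vec * vec)%type.
have c3 := constant_diff_comp (@constant_diff_snd R vec (vec * vec)%type) f3.
have f2 := constant_diff_comp (@constant_diff_fst R vec (vec * vec)%type) f3.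
have c2 := constant_diff_comp (@constant_diff_snd R vec vec) f2.
have c1 := constant_diff_comp (@constant_diff_fst R vec vec) f2.
apply: constant_diff_row_mx; apply: constant_diff_row_mx.
- exact: constant_diffB c1 c4.
- exact: constant_diffD c3 c2.
- exact: constant_diffD c1 c4.
- exact: constant_diffB c3 c2.
Qed.

(** The holomorphic function on C^2n attached to a sesqui-holomorphic one, in
    the coordinates where the diagonal is the real subspace. *)
Definition holo_of (G : phase -> phase -> R[i]) (x1 x2 x3 x4 : vec) : R[i] :=
  G (row_mx (x1 - x4) (x3 + x2)) (row_mx (x1 + x4) (x3 - x2)).

Lemma holomorphic_holo_of G : sesquiholo G -> holomorphic (holo_of G).
Proof.
move=> GJ; apply/holomorphicP.
have -> : joint4 (holo_of G) = joint G \o ofQuad.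
  by apply/funext => q; rewrite /joint4 /holo_of /joint /= /ofQuad row_mxKl row_mxKr.
apply: (jholo_comp constant_diff_ofQuad _ GJ) => v.
rewrite /ofQuad /jW /J4 /jrot /= opp_row_mx opprK !(row_mxKl, row_mxKr).
by congr (row_mx (row_mx _ _) (row_mx _ _)); rewrite ?opprD ?opprB ?opprK// addrC.
Qed.

Lemma sesqui_of_diag Ft (F : phase -> R[i]) :
  (forall x xi, Ft x 0 xi 0 = F (row_mx x xi)) -> forall X, sesqui_of Ft X X = F X.
Proof.
have h2 (v : vec) : 2^-1 *: (v + v) = v.
  by rewrite scalerDr -scalerDl (_ : 2^-1 + 2^-1 = 1 :> R) ?scale1r//; field.
move=> FtF X; rewrite /sesqui_of !subrr !scaler0 !h2 FtF.
by rewrite hsubmxK.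
Qed.

End four_real_coordinates.

Section Dh_space.
Context {R : realType} {n : nat}.
Local Notation phase := 'rV[R]_(n + n).
Local Notation normc := (@Normc.normc R).
Local Notation re := (@complex.Re R).
Local Notation im := (@complex.Im R).
Variables (h : R) (h0 : 0 < h).
Implicit Types (F : phase -> R[i]) (G : phase -> phase -> R[i]).

Definition Dh_bound G (psi : phase -> R) : Prop :=
  L1oo (leb (n + n)) psi /\
  forall X Y, normc (G X Y) <= expR (1 / (4 * h) * sqn (X - Y)) * psi (X - Y).

Lemma Dh_bound_subcritical G psi : sesquiholo G -> Dh_bound G psi -> subcritical h G.
Proof. by move=> GJ [[ipsi _] Gpsi]; exact: subcritical_bound Gpsi. Qed.

Lemma sesquiholo_extension F G : sesquiholo G -> subcritical h G ->
  (forall X, G X X = F X) -> sesqui_extension F G.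
Proof.
move=> GJ Gs GF; split=> //; first exact: (sesquiholo_analytic h0 GJ Gs).
exact: sesquiholo_sesqui_CR.
Qed.

Lemma Dh_intro F G psi : sesquiholo G -> (forall X, G X X = F X) ->
  Dh_bound G psi -> Dh h F /\ Fext F = G.
Proof.
move=> GJ GF Gpsi; have ext := sesquiholo_extension GJ (Dh_bound_subcritical GJ Gpsi) GF.
split; last exact: Fext_unique.
exists G => //; exists psi; have [/L1ooP[p1 poo] b] := Gpsi.
by rewrite lebE.
Qed.

Lemma Dh_elim F : Dh h F ->
  [/\ sesquiholo (Fext F), forall X, Fext F X X = F X, subcritical h (Fext F) &
    exists psi, Dh_bound (Fext F) psi].
Proof.
rewrite /Dh lebE => -[G GF [psi [p1 poo Gpsi]]]; rewrite (Fext_unique GF).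
have [GJ GE] := sesqui_extension_holo GF.
have b : Dh_bound G psi by split=> //; exact/L1ooP.
split=> //; first exact: Dh_bound_subcritical b.
by exists psi.
Qed.

(** Both functions are sesqui-holomorphic with the same diagonal. *)
Lemma Fext_of_holomorphic F (Ft : 'rV[R]_n -> 'rV[R]_n -> 'rV[R]_n -> 'rV[R]_n -> R[i]) :
  Dh h F -> holomorphic_extension F Ft -> Fext F = sesqui_of Ft.
Proof.
move=> /Dh_elim[FJ FE _ _] [/sesquiholo_sesqui_of sJ /sesqui_of_diag sE].
by apply: sesquiholo_unique => // X; rewrite FE sE.
Qed.

Lemma Dh_bound_linear (c : R[i]) G1 G2 psi1 psi2 :
  Dh_bound G1 psi1 -> Dh_bound G2 psi2 ->
  Dh_bound (fun X Y => c * G1 X Y + G2 X Y) (fun Z => normc c * psi1 Z + 1 * psi2 Z).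
Proof.
move=> [l1 b1] [l2 b2]; split; first exact: L1oo_linear.
move=> X Y; apply: le_trans (le_normcD _ _) _; rewrite Normc.normcM mulrDr.
apply: lerD; last by rewrite (mul1r (psi2 _)).
by rewrite mulrCA; apply: ler_wpM2l; [exact: normc_ge0|exact: b1].
Qed.

Lemma Dh_linear (c : R[i]) F1 F2 : Dh h F1 -> Dh h F2 ->
  Dh h (fun X => c * F1 X + F2 X) /\
  Fext (fun X => c * F1 X + F2 X) = fun X Y => c * Fext F1 X Y + Fext F2 X Y.
Proof.
move=> /Dh_elim[J1 E1 _ [psi1 b1]] /Dh_elim[J2 E2 _ [psi2 b2]].
apply: Dh_intro (Dh_bound_linear c b1 b2); first exact: jholo_linear J1 J2.
by move=> X; rewrite E1 E2.
Qed.

Lemma Dh_translate V F : Dh h F ->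
  Dh h (translate V F) /\ Fext (translate V F) = fun X Y => Fext F (X - V) (Y - V).
Proof.
move=> /Dh_elim[J E _ [psi [l b]]].
apply: (@Dh_intro _ _ psi); first exact: sesquiholo_shift.
  by move=> X; rewrite E.
by split=> // X Y; have := b (X - V) (Y - V); rewrite opprB addrA subrK.
Qed.

End Dh_space.

(** * The inverse heat operator *)

Section complex_integrals.
Context {R : realType} {d} {T : measurableType d} (mu : {measure set T -> \bar R}).
Local Notation re := (@complex.Re R).
Local Notation im := (@complex.Im R).

Lemma Re_mulrC (z : R[i]) (x : R) : re (z * x%:C) = re z * x.
Proof. by case: z => a b /=; ring. Qed.

Lemma Im_mulrC (z : R[i]) (x : R) : im (z * x%:C) = im z * x.
Proof. by case: z => a b /=; ring. Qed.

Lemma Re_mul (z w : R[i]) : re (z * w) = re z * re w - im z * im w.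
Proof. by case: z w => [a b] [c e]. Qed.

Lemma Im_mul (z w : R[i]) : im (z * w) = re z * im w + im z * re w.
Proof. by case: z w => [a b] [c e]. Qed.

Lemma integral_combination3 (a b c : R) (f g k : T -> R) :
  mu.-integrable setT (EFin \o f) -> mu.-integrable setT (EFin \o g) ->
  mu.-integrable setT (EFin \o k) ->
  mu.-integrable setT (EFin \o (fun x => a * f x + b * g x + c * k x)) /\
  \int[mu]_x (a * f x + b * g x + c * k x) =
    a * \int[mu]_x f x + b * \int[mu]_x g x + c * \int[mu]_x k x.
Proof.
move=> fi gi ki.
have afi := integrable_scaled a fi; have bgi := integrable_scaled b gi.
have cki := integrable_scaled c ki.
have fgi : mu.-integrable setT (EFin \o (fun x => a * f x + b * g x)).
  exact: (integrableD measurableT afi bgi).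
split; first exact: (integrableD measurableT fgi cki).
by rewrite RintegralD// RintegralD// !RintegralZl.
Qed.

Lemma cintegral_linear (c : R[i]) (f g : T -> R[i]) :
  cintegrable mu f -> cintegrable mu g ->
  cintegral mu (fun x => c * f x + g x) = c * cintegral mu f + cintegral mu g.
Proof.
move=> [f1 f2] [g1 g2]; apply/eqP; rewrite eq_complex; apply/andP; split; apply/eqP.
  have [_ E] := integral_combination3 (re c) (- im c) 1 f1 f2 g1.
  transitivity (\int[mu]_x (re c * re (f x) + - im c * im (f x) + 1 * re (g x))).
    by apply: eq_Rintegral => x _; rewrite ReD Re_mul; ring.
  by rewrite [LHS]E ReD Re_mul /cintegral /=; ring.
have [_ E] := integral_combination3 (re c) (im c) 1 f2 f1 g2.
transitivity (\int[mu]_x (re c * im (f x) + im c * re (f x) + 1 * im (g x))).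
  by apply: eq_Rintegral => x _; rewrite ImD Im_mul; ring.
by rewrite [LHS]E ImD Im_mul /cintegral /=; ring.
Qed.

End complex_integrals.

Section heat.
Context {R : realType} {n : nat}.
Local Notation phase := 'rV[R]_(n + n).
Local Notation lebp := (leb (R := R) (n + n)).
Local Notation mu := (sfprod (leb (n + n)) (leb (R := R) (n + n))).
Local Notation normc := (@Normc.normc R).
Local Notation re := (@complex.Re R).
Local Notation im := (@complex.Im R).
Variables (h : R) (h0 : 0 < h) (G : phase -> phase -> R[i]) (psi : phase -> R).
Hypothesis GJ : sesquiholo G.
Hypothesis Gpsi : Dh_bound h G psi.

Lemma TZ_bound T Z : normc (TZ G (T, Z)) <= expR (1 / (4 * h) * sqn Z) * psi Z.
Proof.
have := Gpsi.2 (T + 2^-1 *: Z) (T - 2^-1 *: Z).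
by rewrite half_diff.
Qed.

Section part.
Variable k : R[i] -> R.
Hypothesis k_le : forall z, `|k z| <= normc z.
Hypothesis kc : continuous (k \o TZ G).
Hypothesis kmean : forall (c : R) p0, 0 < c ->
  mu.-integrable setT (fun p => (k (TZ G (p0 + p)) * gweight c p)%:E) ->
  (\int[mu]_p (k (TZ G (p0 + p)) * gweight c p)%:E = (k (TZ G p0) * @gmass R n c)%:E)%E.

Let slice T Z := k (TZ G (T, Z)) * expR (- (1 / (4 * h) * sqn Z)).

Lemma slice_le T Z : `|slice T Z| <= psi Z.
Proof.
rewrite normrM (ger0_norm (expR_ge0 _)).
apply: le_trans (ler_wpM2r (expR_ge0 _) (le_trans (k_le _) (TZ_bound T Z))) _.
by rewrite mulrAC -expRD subrr expR0 mul1r.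
Qed.

Lemma measurable_slice T : measurable_fun setT (slice T).
Proof.
apply: measurable_funM.
  apply: (@measurableT_comp _ _ _ _ _ _ (k \o TZ G)); first exact: continuous_measurable_pair.
  exact: pair1_measurable.
apply: measurableT_comp => //; apply: measurableT_comp => //.
by apply: measurable_funM => //; exact: measurable_sqn.
Qed.

Lemma integrable_slice T : lebp.-integrable setT (EFin \o slice T).
Proof. exact: (integrable_dominated (measurable_slice T) (slice_le T) Gpsi.1.1). Qed.

Definition slice_mean T := \int[lebp]_Z slice T Z.

Lemma slice_mean_le T : `|slice_mean T| <= \int[lebp]_Z psi Z.
Proof.
apply: le_trans (le_normr_Rintegral measurableT (integrable_slice T)) _.
apply: le_Rintegral => //; [exact: (integrable_abse (integrable_slice T))|exact: Gpsi.1.1|].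
by move=> Z _; exact: slice_le.
Qed.

(** The Gaussian mean at (X, 0) with c = 1 / h, integrated over Z first: the inner
    integral is the inverse heat operator up to its constant. *)
Lemma heat_part X :
  lebp.-integrable setT (EFin \o (fun T => expR (- (1 / h * sqn (X - T))) * slice_mean T)) /\
  \int[lebp]_T (expR (- (1 / h * sqn (X - T))) * slice_mean T) = k (G X X) * @gmass R n (1 / h).
Proof.
have c0 : 0 < 1 / h by rewrite divr_gt0.
pose p0 : phase * phase := (X, 0).
pose H p := k (TZ G (p0 + p)) * gweight (1 / h) p.
have HE T Z : H (T, Z) = expR (- (1 / h * sqn T)) * slice (X + T) Z.
  have -> : H (T, Z) = k (TZ G (X + T, Z)) * gweight (1 / h) (T, Z).
    by rewrite /H (_ : p0 + (T, Z) = (X + T, Z))//; congr pair; rewrite /= add0r.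
  have E4 : 1 / h / 4 = 1 / (4 * h) by field; rewrite gt_eqF.
  by rewrite gweightE E4 [LHS]mulrCA.
have mH : measurable_fun setT H.
  by apply: measurable_funM; [exact: measurable_shifted|exact: measurable_gweight].
have [iD _] := integrable_tensor (integrable_gauss (n + n) c0) Gpsi.1.1.
have iH : mu.-integrable setT (EFin \o H).
  apply: (integrable_dominated mH (g := fun p => expR (- (1 / h * sqn p.1)) * psi p.2)) => //.
  move=> [T Z]; rewrite HE normrM ger0_norm ?expR_ge0//.
  by rewrite ler_wpM2l ?expR_ge0// slice_le.
have FE : fubini_F lebp (EFin \o H) =
    EFin \o (fun T => expR (- (1 / h * sqn T)) * slice_mean (X + T)).
  apply/funext => T; rewrite /fubini_F /=.
  under eq_integral => Z _ do rewrite HE EFinM.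
  rewrite integralZl//; last exact: integrable_slice.
  by rewrite EFinM /slice_mean /Rintegral fineK//; exact: (integrable_fin_num measurableT (integrable_slice _)).
have iF := integrable_fubini_F iH; rewrite FE in iF.
have tE : (fun T => expR (- (1 / h * sqn (X - T))) * slice_mean T) =
    (fun T => expR (- (1 / h * sqn T)) * slice_mean (X + T)) \o (fun T => T - X).
  by apply/funext => T /=; rewrite -[sqn (X - T)]sqnN opprB [X + _]addrC subrK.
split; first by rewrite tE; exact: (integrable_leb_translate (- X) iF).
rewrite tE /Rintegral.
have := @integral_leb_translate R _ (- X) _ (measurable_int _ iF); move=> /= ->.
have := kmean c0 (p0 := p0) iH; rewrite -(integral12_prod_meas1 iH) FE /= => ->.
by rewrite /p0 /TZ /= scaler0 addr0 subr0.
Qed.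

(** Fubini's theorem gives measurability of the product with a Gaussian, which is
    nowhere zero. *)
Lemma measurable_slice_mean : measurable_fun setT slice_mean.
Proof.
have [i0 _] := heat_part 0.
have m0 : measurable_fun setT (fun T : phase => expR (- (1 / h * sqn (0 - T))) * slice_mean T).
  by apply/measurable_EFinP; exact: measurable_int i0.
have -> : slice_mean = fun T : phase => expR (1 / h * sqn T) *
    (expR (- (1 / h * sqn (0 - T))) * slice_mean T).
  by apply/funext => T; rewrite mulrA -expRD sub0r sqnN subrr expR0 mul1r.
apply: measurable_funM => //; apply: measurableT_comp => //.
by apply: measurable_funM => //; exact: measurable_sqn.
Qed.

End part.

Let fJ := jholo_TZ GJ.
Let reC := (jholo_continuous fJ).1.
Let imC := (jholo_continuous fJ).2.

Let reM (c : R) p0 (c0 : 0 < c) := gaussian_mean_re c0 fJ (p0 := p0).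
Let imM (c : R) p0 (c0 : 0 < c) := gaussian_mean_im c0 fJ (p0 := p0).

Definition heat_re := heat_part (@normr_Re_le R) reC reM.
Definition heat_im := heat_part (@normr_Im_le R) imC imM.
Definition integrable_slice_re := integrable_slice (@normr_Re_le R) reC.
Definition integrable_slice_im := integrable_slice (@normr_Im_le R) imC.
Definition slice_mean_re_le := slice_mean_le (@normr_Re_le R) reC.
Definition slice_mean_im_le := slice_mean_le (@normr_Im_le R) imC.
Definition measurable_slice_mean_re := measurable_slice_mean (@normr_Re_le R) reC reM.
Definition measurable_slice_mean_im := measurable_slice_mean (@normr_Im_le R) imC imM.

End heat.

Section inverse_heat.
Context {R : realType} {n : nat}.
Local Notation phase := 'rV[R]_(n + n).
Local Notation lebp := (leb (R := R) (n + n)).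
Local Notation normc := (@Normc.normc R).
Local Notation re := (@complex.Re R).
Local Notation im := (@complex.Im R).
Variables (h : R) (h0 : 0 < h).
Implicit Types (F : phase -> R[i]).

Lemma Re_Hh_integrand F T : re \o Hh_integrand h F T =
  fun Z => re (TZ (Fext F) (T, Z)) * expR (- (1 / (4 * h) * sqn Z)).
Proof. by apply/funext => Z; rewrite /= Re_mulrC. Qed.

Lemma Im_Hh_integrand F T : im \o Hh_integrand h F T =
  fun Z => im (TZ (Fext F) (T, Z)) * expR (- (1 / (4 * h) * sqn Z)).
Proof. by apply/funext => Z; rewrite /= Im_mulrC. Qed.

Lemma cintegrable_Hh_integrand F T : Dh h F -> cintegrable lebp (Hh_integrand h F T).
Proof.
move=> /(Dh_elim h0)[J _ _ [psi b]]; rewrite /cintegrable Re_Hh_integrand Im_Hh_integrand.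
by split; [exact: (integrable_slice_re J b)|exact: (integrable_slice_im J b)].
Qed.

Lemma HhE F T : Hh h F T = (((4 * pi * h) ^- n)%:C : R[i]) *
  (slice_mean h (Fext F) re T +i* slice_mean h (Fext F) im T).
Proof.
rewrite /Hh lebE /cintegral; congr (_ * (_ +i* _)); rewrite /slice_mean.
  by apply: eq_Rintegral => Z _; rewrite -[LHS]/((re \o _) Z) Re_Hh_integrand.
by apply: eq_Rintegral => Z _; rewrite -[LHS]/((im \o _) Z) Im_Hh_integrand.
Qed.

Lemma Re_Hh F T : re (Hh h F T) = (4 * pi * h) ^- n * slice_mean h (Fext F) re T.
Proof. by rewrite HhE Re_mul /=; ring. Qed.

Lemma Im_Hh F T : im (Hh h F T) = (4 * pi * h) ^- n * slice_mean h (Fext F) im T.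
Proof. by rewrite HhE Im_mul /=; ring. Qed.

Lemma Hh_heat F X : Dh h F ->
  cintegrable lebp (heat_integrand h F X) /\
  F X = ((pi * h) ^- n)%:C * cintegral lebp (heat_integrand h F X).
Proof.
move=> /(Dh_elim h0)[J E _ [psi b]].
have [ir er] := heat_re h0 J b X; have [ii ei] := heat_im h0 J b X.
rewrite E in er ei.
set c := (4 * pi * h) ^- n.
have rE : re \o heat_integrand h F X =
    fun T => c * (expR (- (1 / h * sqn (X - T))) * slice_mean h (Fext F) re T).
  by apply/funext => T; rewrite -[LHS]/(re (heat_integrand h F X T)) /heat_integrand Re_mul Re_Hh /= -/c; ring.
have iE : im \o heat_integrand h F X =
    fun T => c * (expR (- (1 / h * sqn (X - T))) * slice_mean h (Fext F) im T).
  by apply/funext => T; rewrite -[LHS]/(im (heat_integrand h F X T)) /heat_integrand Im_mul Im_Hh /= -/c; ring.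
have g0 : 0 < @gmass R n (1 / h) by rewrite gmass_gt0// divr_gt0.
have gE : (pi * h) ^- n * (c * @gmass R n (1 / h)) = 1.
  rewrite /c /gmass (_ : pi / (1 / h) = pi * h); last by field; rewrite gt_eqF.
  rewrite (_ : 4 * pi / (1 / h) = 4 * pi * h); last by field; rewrite gt_eqF.
  by rewrite [X in _ * X]mulrCA mulVf ?mulr1 ?mulVf// expf_neq0// !mulf_neq0// gt_eqF// pi_gt0.
split.
  by rewrite /cintegrable rE iE; split; exact: integrable_scaled.
have cE : cintegral lebp (heat_integrand h F X) =
    (c * (re (F X) * @gmass R n (1 / h))) +i* (c * (im (F X) * @gmass R n (1 / h))).
  rewrite /cintegral -er -ei -!RintegralZl//; congr (_ +i* _).
    by apply: eq_Rintegral => T _; rewrite -[LHS]/((re \o _) T) rE.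
  by apply: eq_Rintegral => T _; rewrite -[LHS]/((im \o _) T) iE.
rewrite cE; apply/eqP; rewrite eq_complex Re_mul Im_mul /= !mul0r subr0 addr0.
have zE z : (pi * h) ^- n * (c * (z * @gmass R n (1 / h))) = z.
  by rewrite [X in c * X]mulrC [X in _ * X]mulrA mulrA gE mul1r.
by rewrite !zE !eqxx.
Qed.

Lemma Hh_essentially_bounded F : Dh h F -> cLfun lebp +oo (Hh h F).
Proof.
move=> /(Dh_elim h0)[J E _ [psi b]].
have c0 : 0 <= (4 * pi * h) ^- n by rewrite invr_ge0 exprn_ge0// !mulr_ge0 ?pi_ge0// ltW.
split; apply/Lfun_ooP; split.
- rewrite (_ : re \o _ = fun T => (4 * pi * h) ^- n * slice_mean h (Fext F) re T).
    by apply: measurable_funM => //; exact: (measurable_slice_mean_re h0 J b).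
  by apply/funext => T; exact: Re_Hh.
- exists ((4 * pi * h) ^- n * \int[lebp]_Z psi Z); apply: aeW => T.
  by rewrite -[(_ \o _) T]/(re (Hh h F T)) Re_Hh normrM ger0_norm// ler_wpM2l// (slice_mean_re_le J b).
- rewrite (_ : im \o _ = fun T => (4 * pi * h) ^- n * slice_mean h (Fext F) im T).
    by apply: measurable_funM => //; exact: (measurable_slice_mean_im h0 J b).
  by apply/funext => T; exact: Im_Hh.
- exists ((4 * pi * h) ^- n * \int[lebp]_Z psi Z); apply: aeW => T.
  by rewrite -[(_ \o _) T]/(im (Hh h F T)) Im_Hh normrM ger0_norm// ler_wpM2l// (slice_mean_im_le J b).
Qed.

Lemma Hh_linear : linear_on (@Dh R n h) (Hh h).
Proof.
move=> c F1 F2 D1 D2; have [D12 E] := Dh_linear h0 c D1 D2; split=> //.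
apply/funext => T; rewrite /Hh lebE.
have -> : Hh_integrand h (fun X => c * F1 X + F2 X) T =
    fun Z => c * Hh_integrand h F1 T Z + Hh_integrand h F2 T Z.
  by apply/funext => Z; rewrite /Hh_integrand E mulrDl mulrA.
rewrite cintegral_linear; [|exact: cintegrable_Hh_integrand..].
by rewrite mulrDr mulrCA.
Qed.

Lemma Hh_translate : commutes_with_translations (@Dh R n h) (Hh h).
Proof.
move=> V F DF; have [DV E] := Dh_translate h0 V DF; split=> //.
apply/funext => T; rewrite /Hh /translate; congr (_ * cintegral _ _).
by apply/funext => Z; rewrite /Hh_integrand E addrAC [T - _ - V]addrAC.
Qed.

End inverse_heat.

(** * Plane waves and the least profile *)

Section complex_exponential.
Context {R : realType}.
Local Notation re := (@complex.Re R).
Local Notation im := (@complex.Im R).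
Local Notation normc := (@Normc.normc R).

Lemma is_C1_line (f f' : R -> R) : (forall x : R, is_derive x (1 : R) f (f' x)) ->
  continuous f' -> is_C1 f /\ forall v x, 'D_v f x = v * f' x.
Proof.
move=> ff' cf'.
have df x : differentiable f x by apply/derivable1_diffP; exact: (@ex_derive _ _ _ _ _ _ _ (ff' x)).
have E v x : 'D_v f x = v * f' x.
  have -> : v = v *: (1 : R) by rewrite [RHS]mulr1.
  rewrite deriveZl// [v *: 1]mulr1.
  by rewrite (@derive_val _ _ _ _ _ _ _ (ff' x)).
split=> //; split=> // v.
rewrite (_ : 'D_v f = fun x => v * f' x); last by apply/funext => x; exact: E.
by move=> x; apply: cvgM; [exact: cvg_cst|exact: cf'].
Qed.

Lemma normc_cexpi (t : R) : normc (cexpi t) = 1.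
Proof. by rewrite /cexpi /= cos2Dsin2 sqrtr1. Qed.

Lemma normc_real (x : R) : normc x%:C = `|x|.
Proof. by rewrite /= expr0n addr0 sqrtr_sqr. Qed.

Variables (V : normedModType R) (J : V -> V) (a b : V -> R).
Hypotheses (aL : has_constant_diff a a) (bL : has_constant_diff b b).
Hypotheses (aJ : forall v, a (J v) = b v) (bJ : forall v, b (J v) = - a v).

(** The exponential of the complex-linear form [b + i a]. *)
Definition cexp_form (v : V) : R[i] := (expR (b v))%:C * cexpi (a v).

(** The exponential of a complex-linear form is the composite of the exponential
    of C with an affine map intertwining the structures. *)
Lemma jholo_cexp_form : jholo J cexp_form.
Proof.
have [eC eD] := is_C1_line (@is_derive_expR R) (@continuous_expR R).
have [sC sD] := is_C1_line (@is_derive_sin R) (@continuous_cos R).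
have cN : continuous (fun x : R => - sin x).
  by move=> x; apply: cvgN; exact: continuous_sin.
have [cC cD] := is_C1_line (@is_derive_cos R) cN.
have rE : re \o cexp_form = fun v => (expR \o b) v * (cos \o a) v.
  by apply/funext => v /=; ring.
have iE : im \o cexp_form = fun v => (expR \o b) v * (sin \o a) v.
  by apply/funext => v /=; ring.
have C1 := is_C1_comp bL eC; have C2 := is_C1_comp aL cC; have C3 := is_C1_comp aL sC.
have D1 v p : 'D_v (expR \o b) p = b v * expR (b p).
  by rewrite (derive_comp_affine v bL (eC.1 _)) eD.
have D2 v p : 'D_v (cos \o a) p = a v * - sin (a p).
  by rewrite (derive_comp_affine v aL (cC.1 _)) cD.
have D3 v p : 'D_v (sin \o a) p = a v * cos (a p).
  by rewrite (derive_comp_affine v aL (sC.1 _)) sD.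
split; first by rewrite /is_cC1 rE iE; split; exact: is_C1M.
have Dm (f g : V -> R) p v : is_C1 f -> is_C1 g ->
    'D_v (fun x => f x * g x) p = f p * 'D_v g p + g p * 'D_v f p.
  by move=> fC gC; rewrite deriveM//; exact: is_C1_derivable.
move=> p v; rewrite rE iE !(Dm _ _ p _ C1 C2) !(Dm _ _ p _ C1 C3) !D1 !D2 !D3 aJ bJ.
by split => /=; ring.
Qed.

Lemma normc_cexp_form v : normc (cexp_form v) = expR (b v).
Proof. by rewrite /cexp_form Normc.normcM normc_cexpi normc_real mulr1 ger0_norm ?expR_ge0. Qed.

End complex_exponential.

Section plane_waves.
Context {R : realType} {n : nat}.
Local Notation phase := 'rV[R]_(n + n).
Local Notation jspace := 'rV[R]_((n + n) + (n + n)).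
Local Notation lebp := (leb (R := R) (n + n)).
Local Notation mu := (sfprod (leb (n + n)) (leb (R := R) (n + n))).
Local Notation normc := (@Normc.normc R).
Local Notation re := (@complex.Re R).
Local Notation im := (@complex.Im R).

(** Extension of [plane_wave a] in the (T, Z) coordinates. *)
Definition waveTZ (a : phase) : phase * phase -> R[i] :=
  cexp_form (fun p => dotv a p.1) (fun p => - (2^-1 * dotv (jrot a) p.2)).

Lemma constant_diff_dotv m (a : 'rV[R]_m) : has_constant_diff (dotv a) (dotv a).
Proof. by apply: constant_diff_sum => i; apply: constant_diffZ; exact: constant_diff_coord. Qed.

Lemma jholo_waveTZ a : jholo jTZ (waveTZ a).
Proof.
apply: jholo_cexp_form => [||v|v].
- exact: constant_diff_comp (constant_diff_dotv a) (@constant_diff_fst R phase phase).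
- apply: constant_diffN; apply: constant_diffZ.
  exact: constant_diff_comp (constant_diff_dotv (jrot a)) (@constant_diff_snd R phase phase).
- by rewrite /jTZ /= dotvZr dotv_jrot mulrN.
- by rewrite /jTZ /= dotvZr dotv_jrot jrotK dotvNl opprK mulrA mulVf// mul1r.
Qed.

Lemma constant_diff_ofXY : has_constant_diff (@ofXY R n) (@ofXY R n).
Proof.
have l := @constant_diff_lsubmx R (n + n) (n + n).
have r := @constant_diff_rsubmx R (n + n) (n + n).
apply: constant_diff_pair; last exact: constant_diffB l r.
by apply: constant_diffZ; exact: constant_diffD l r.
Qed.

Lemma sesquiholo_ofXY (f : phase * phase -> R[i]) : jholo jTZ f ->
  sesquiholo (fun X Y => f (2^-1 *: (X + Y), X - Y)).
Proof.
move=> fJ; rewrite /sesquiholo (_ : joint _ = f \o @ofXY R n)//.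
apply: (jholo_comp constant_diff_ofXY _ fJ) => v.
rewrite /ofXY /jW /jTZ /= row_mxKl row_mxKr opprK jrotZ !jrotD jrotN.
by rewrite scalerA mulfV// scale1r.
Qed.

Variables (h : R) (h0 : 0 < h).

Definition waveXY (a X Y : phase) : R[i] := waveTZ a (2^-1 *: (X + Y), X - Y).

Lemma waveXY_diag a X : waveXY a X X = plane_wave a X.
Proof.
rewrite /waveXY /waveTZ /cexp_form /= subrr dotvC dotv0l mulr0 oppr0 expR0 mul1r.
by rewrite scalerDr -scalerDl (_ : 2^-1 + 2^-1 = 1 :> R) ?scale1r//; field.
Qed.

(** A linear exponent is dominated by a small multiple of |Z|^2 plus a constant. *)
Lemma Dh_bound_waveXY a : exists psi, Dh_bound h (waveXY a) psi.
Proof.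
have e0 : 0 < 1 / (8 * h) by rewrite divr_gt0// mulr_gt0.
pose v := - (2^-1 *: jrot a).
pose C := expR ((4 * (1 / (8 * h)))^-1 * sqn v).
exists (fun Z => C * expR (- (1 / (8 * h) * sqn Z))); split.
  split; first exact: integrable_scaled (integrable_gauss (n + n) e0).
  exists C; apply: aeW => Z; rewrite ger0_norm ?mulr_ge0 ?expR_ge0//.
  rewrite ler_piMr ?expR_ge0// expR_le1 ?oppr_le0//.
  by rewrite mulr_ge0 ?sqn_ge0// ltW.
move=> X Y; rewrite /waveXY normc_cexp_form /=; set Z := X - Y.
rewrite mulrCA -expRD /C -expRD ler_expR.
have := @dotv_ge R _ Z v _ e0; rewrite dotvNr dotvZr dotvC => H.
apply: le_trans H _; rewrite addrC lerD2l.
rewrite le_eqVlt; apply/orP; left; apply/eqP; field; rewrite gt_eqF//.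
Qed.

Lemma Dh_plane_wave a : Dh h (plane_wave a) /\ Fext (plane_wave a) = waveXY a.
Proof.
have [psi b] := Dh_bound_waveXY a; apply: (Dh_intro h0 _ _ b).
  exact: sesquiholo_ofXY (jholo_waveTZ a).
exact: waveXY_diag.
Qed.

(** Completing the square. *)
Lemma gaussian_fourier a :
  \int[lebp]_Z expR (- (2^-1 * dotv (jrot a) Z) - 1 / (4 * h) * sqn Z) =
  expR (h * sqn a / 4) * (4 * pi * h) ^+ n.
Proof.
have c0 : 0 < 1 / (4 * h) by rewrite divr_gt0// mulr_gt0.
have E Z : expR (- (2^-1 * dotv (jrot a) Z) - 1 / (4 * h) * sqn Z) =
    expR (h * sqn a / 4) * expR (- (1 / (4 * h) * sqn (Z + h *: jrot a))).
  rewrite -expRD; congr expR; rewrite sqnD sqnZ dotvZr sqn_jrot dotvC.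
  by field; rewrite gt_eqF.
have ig := integrable_gauss (n + n) c0.
under eq_Rintegral => Z _ do rewrite E.
rewrite RintegralZl//; last exact: (integrable_leb_translate (h *: jrot a) ig).
congr (_ * _); rewrite /Rintegral.
have := integral_leb_translate (h *: jrot a) (measurable_int _ ig); move=> /= ->.
rewrite integral_gauss_rV//= sqrt_exprnn; last by rewrite divr_ge0 ?pi_ge0// ltW.
by congr (_ ^+ _); field; rewrite gt_eqF.
Qed.

Lemma Hh_symbol : has_symbol (@Dh R n h) (Hh h) (fun u => (expR (h * sqn u / 4))%:C).
Proof.
move=> a; have [Da E] := Dh_plane_wave a; split=> //.
apply/funext => T.
have [pc cc] : (4 * pi * h) ^+ n != 0 :> R /\ 0 < (4 * pi * h) ^+ n :> R.
  have p0 : 0 < (4 * pi * h) ^+ n by rewrite exprn_gt0// !mulr_gt0// pi_gt0.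
  by rewrite gt_eqF.
have wE S Z : TZ (Fext (plane_wave a)) (S, Z) = waveTZ a (S, Z).
  rewrite E /TZ /waveXY half_diff; congr (waveTZ a (_, _)).
  have h2 : 2^-1 + 2^-1 = 1 :> R by field.
  by rewrite addrACA subrr addr0 scalerDr -scalerDl h2 scale1r.
have ig : lebp.-integrable setT
    (EFin \o (fun Z => expR (- (2^-1 * dotv (jrot a) Z) - 1 / (4 * h) * sqn Z))).
  have := (cintegrable_Hh_integrand h0 0 Da).1; rewrite Re_Hh_integrand.
  rewrite (_ : (fun Z => _) = fun Z => expR (- (2^-1 * dotv (jrot a) Z) - 1 / (4 * h) * sqn Z))//.
  apply/funext => Z; rewrite wE /waveTZ /cexp_form Re_mul /=.
  by rewrite (dotvC a) dotv0l cos0 mulr1 mul0r subr0 expRD.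
have kE (k : R[i] -> R) : (forall (x : R) z, k (x%:C * z) = x * k z) ->
    slice_mean h (Fext (plane_wave a)) k T =
    k (plane_wave a T) * (expR (h * sqn a / 4) * (4 * pi * h) ^+ n).
  move=> kl; rewrite /slice_mean -gaussian_fourier -RintegralZl//.
  apply: eq_Rintegral => Z _; rewrite wE /waveTZ /cexp_form kl /plane_wave /= expRD.
  by ring.
rewrite HhE (kE re) ?(kE im); last 2 first.
- by move=> x z; rewrite Im_mul /=; ring.
- by move=> x z; rewrite Re_mul /=; ring.
apply/eqP; rewrite eq_complex !Re_mul !Im_mul /= !mul0r !subr0 !addr0.
by apply/andP; split; apply/eqP; field.
Qed.

End plane_waves.

Lemma continuous_add {R : realType} (V : normedModType R) (f g : V -> R) :
  continuous f -> continuous g -> continuous (fun x => f x + g x).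
Proof. by move=> cf cg x; apply: cvgD; [exact: cf|exact: cg]. Qed.

Lemma continuous_mul {R : realType} (V : normedModType R) (f g : V -> R) :
  continuous f -> continuous g -> continuous (fun x => f x * g x).
Proof. by move=> cf cg x; apply: cvgM; [exact: cf|exact: cg]. Qed.

Section least_profile.
Context {R : realType} {n : nat}.
Local Notation phase := 'rV[R]_(n + n).
Local Notation lebp := (leb (R := R) (n + n)).
Local Notation mu := (sfprod (leb (n + n)) (leb (R := R) (n + n))).
Local Notation normc := (@Normc.normc R).
Local Notation re := (@complex.Re R).
Local Notation im := (@complex.Im R).
Variables (h : R) (h0 : 0 < h) (F : phase -> R[i]).
Hypothesis DF : Dh h F.

Lemma psi_ofE V : psi_of h F V = ereal_sup [set
  (normc (TZ (Fext F) (T, V)) * expR (- (sqn V / (4 * h))))%:E | T in [set: phase]].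
Proof.
rewrite /psi_of; congr ereal_sup; apply/seteqP; split=> [_ [[X Y] /= XY <-]|_ [T _ <-]].
  by exists (2^-1 *: (X + Y)) => //; rewrite -XY -TZ_shift.
exists (T + 2^-1 *: V, T - 2^-1 *: V) => //=.
exact: half_diff.
Qed.

Lemma psi_of_ub X Y :
  ((normc (Fext F X Y) * expR (- (sqn (X - Y) / (4 * h))))%:E <= psi_of h F (X - Y))%E.
Proof. by apply: ereal_sup_ubound; exists (X, Y). Qed.

Lemma psi_of_ge0 V : (0 <= psi_of h F V)%E.
Proof.
apply: le_trans (_ : (normc (Fext F V 0) * expR (- (sqn (V - 0) / (4 * h))))%:E <= _)%E.
  by rewrite lee_fin mulr_ge0 ?normc_ge0 ?expR_ge0.
by rewrite -[V in psi_of _ _ V]subr0; exact: psi_of_ub.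
Qed.

Lemma psi_of_le psi V : Dh_bound h (Fext F) psi -> (psi_of h F V <= (psi V)%:E)%E.
Proof.
move=> b; apply: ub_ereal_sup => _ [[X Y] /= XY <-]; rewrite lee_fin.
have := b.2 X Y; rewrite XY => H.
apply: le_trans (ler_wpM2r (expR_ge0 _) H) _.
rewrite mulrAC -expRD (_ : _ + _ = 0) ?expR0 ?mul1r//.
by field; rewrite gt_eqF.
Qed.

(** A supremum of continuous functions is lower semicontinuous. *)
Lemma measurable_psi_of : measurable_fun setT (psi_of h F).
Proof.
have [J _ _ _] := Dh_elim h0 DF.
have [rc ic] := jholo_continuous (jholo_TZ J).
have cT (k : R[i] -> R) T : continuous (k \o TZ (Fext F)) ->
    continuous (fun V : phase => k (TZ (Fext F) (T, V))).
  move=> kc V; apply: (@continuous_comp _ _ _ (fun V : phase => (T, V)) (k \o TZ (Fext F))); last exact: kc.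
  have c := constant_diff_pair (@constant_diff_cst R phase phase T) (@constant_diff_id R phase).
  exact: differentiable_continuous (c V).1.
have cq : continuous (@sqn R (n + n)).
  suff cs (r : seq 'I_(n + n)) : continuous (fun v : phase => \sum_(i <- r) v 0 i * v 0 i) by exact: cs.
  elim: r => [|i r IH].
    have -> : (fun v : phase => \sum_(i <- [::]) v 0 i * v 0 i) = fun=> 0.
      by apply/funext => v; rewrite big_nil.
    exact: is_C1_continuous (is_C1_cst phase 0).
  have -> : (fun v : phase => \sum_(j <- i :: r) v 0 j * v 0 j) =
      fun v : phase => v 0 i * v 0 i + \sum_(j <- r) v 0 j * v 0 j.
    by apply/funext => v; rewrite big_cons.
  have ci : continuous (fun u : phase => u 0 i).
    by move=> v; exact: differentiable_continuous (constant_diff_coord i v).1.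
  by apply: continuous_add => //; exact: continuous_mul.
have cf T : continuous (fun V : phase => normc (TZ (Fext F) (T, V)) * expR (- (sqn V / (4 * h)))).
  have -> : (fun V : phase => normc (TZ (Fext F) (T, V)) * expR (- (sqn V / (4 * h)))) =
      fun V => (@Num.sqrt R \o (fun V => re (TZ (Fext F) (T, V)) * re (TZ (Fext F) (T, V)) +
        im (TZ (Fext F) (T, V)) * im (TZ (Fext F) (T, V)))) V *
      (expR \o (fun V => sqn V * (- (4 * h)^-1))) V.
    by apply/funext => V /=; rewrite mulrN; case: (TZ _ _).
  apply: continuous_mul => V; apply: continuous_comp.
  - by apply: continuous_add; apply: continuous_mul; [exact: (cT re T rc)|exact: (cT re T rc)|exact: (cT im T ic)|exact: (cT im T ic)].
  - exact: sqrt_continuous.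
  - by apply: continuous_mul => //; exact: is_C1_continuous (is_C1_cst _ _).
  - exact: continuous_expR.
apply: (measurability _ (ErealGenOInfty.measurableE R)) => _ [_ [a ->] <-].
rewrite setTI preimage_itvoy.
rewrite (_ : [set V | _] = \bigcup_(T in [set: phase])
    [set V | a < normc (TZ (Fext F) (T, V)) * expR (- (sqn V / (4 * h)))]); last first.
  apply/seteqP; split=> [V /=|V [T _] /= aT].
    by rewrite psi_ofE => /ereal_sup_gt[_ [T _ <-]]; rewrite lte_fin => aT; exists T.
  have := psi_of_ub (T + 2^-1 *: V) (T - 2^-1 *: V); rewrite half_diff.
  by apply: lt_le_trans; rewrite lte_fin.
apply: open_measurable_rV; apply: bigcup_open => T _.
have /continuousP/(_ [set x : R | a < x]) H := cf T.
by apply: H; exact: open_gt.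
Qed.

Lemma psi_of_fin V : psi_of h F V \is a fin_num.
Proof.
have [_ _ _ [psi b]] := Dh_elim h0 DF.
by rewrite ge0_fin_numE ?psi_of_ge0// (le_lt_trans (psi_of_le V b))// ltry.
Qed.

Definition least_profile V : R := fine (psi_of h F V).

Lemma least_profileE V : (least_profile V)%:E = psi_of h F V.
Proof. by rewrite fineK// psi_of_fin. Qed.

Lemma least_profile_ge0 V : 0 <= least_profile V.
Proof. by rewrite fine_ge0// psi_of_ge0. Qed.

Lemma least_profile_ub X Y :
  normc (Fext F X Y) <= expR (1 / (4 * h) * sqn (X - Y)) * least_profile (X - Y).
Proof.
have := psi_of_ub X Y; rewrite -least_profileE lee_fin -ler_pdivlMr ?expR_gt0//.
rewrite -expRN opprK mulrC => H; apply: le_trans H _.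
by rewrite [sqn _ / _]mulrC mul1r.
Qed.

Lemma integrable_least_profile : lebp.-integrable setT (EFin \o least_profile).
Proof.
have [_ _ _ [psi b]] := Dh_elim h0 DF.
have E : EFin \o least_profile = psi_of h F by apply/funext => V; exact: least_profileE.
apply: (integrable_dominated _ _ b.1.1) => [|V].
  by apply/measurable_EFinP; rewrite E; exact: measurable_psi_of.
by rewrite ger0_norm ?least_profile_ge0// -lee_fin least_profileE psi_of_le.
Qed.

Lemma Lnorm1_psi_of : ('N[lebp]_1[psi_of h F] = \int[lebp]_V (least_profile V)%:E)%E.
Proof.
rewrite Lnorm1; apply: eq_integral => V _.
by rewrite gee0_abs ?psi_of_ge0// least_profileE.
Qed.

(** The Gaussian mean at (T0, Z0) with c = 1 / h is applied to the product of the
    extension with the extended plane wave [E], which has value 1 in modulus at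
    that point and modulus exp(- Z0.Z / 2h) at (T0 + T, Z0 + Z). It cancels the
    mixed term of |Z0 + Z|^2, so what is left of the weight in Z is 1 and the
    profile is integrated exactly. *)
Lemma sharp_bound X Y : ((normc (Fext F X Y))%:E <=
  ((4 * pi * h) ^- n)%:E * 'N[lebp]_1[psi_of h F] * (expR (1 / (4 * h) * sqn (X - Y)))%:E)%E.
Proof.
have [J _ _ _] := Dh_elim h0 DF.
have c0 : 0 < 1 / h by rewrite divr_gt0.
pose p0 : phase * phase := (2^-1 *: (X + Y), X - Y).
pose a := - (h^-1 *: jrot (X - Y)).
pose E (q : phase * phase) := waveTZ a (q - p0).
have EJ : jholo jTZ E.
  apply: (jholo_comp (L := fun v => v - 0) _ _ (jholo_waveTZ a)); last by move=> v; rewrite !subr0.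
  by apply: constant_diffB; [exact: constant_diff_id|exact: constant_diff_cst].
have fJ : jholo jTZ (fun q => TZ (Fext F) q * E q) by apply: jholoM => //; exact: jholo_TZ.
have E0 : normc (E p0) = 1.
  rewrite /E subrr /waveTZ normc_cexp_form /= dotvC dotv0l mulr0 oppr0 expR0 //.
have EE p : normc (E (p0 + p)) = expR (- ((2 * h)^-1 * dotv (X - Y) p.2)).
  rewrite /E [p0 + p]addrC addrK /waveTZ normc_cexp_form /a jrotN jrotZ jrotK scalerN opprK.
  by rewrite dotvZl mulrA -invfM.
set e := expR (1 / (4 * h) * sqn (X - Y)).
have iP := integrable_scaled e (integrable_leb_translate (X - Y) integrable_least_profile).
have [iD DE] := integrable_tensor (integrable_gauss (n + n) c0) iP.
have := @gaussian_mean_le _ _ _ (1 / h) p0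
  (fun p => expR (- (1 / h * sqn p.1)) * (e * least_profile (p.2 + (X - Y)))) c0 fJ iD.
rewrite DE integral_gauss_rV//= sqrt_exprnn; last by rewrite divr_ge0 ?pi_ge0// ltW.
have -> : (\int[lebp]_Z (e * least_profile (Z + (X - Y)))%:E =
    e%:E * 'N[lebp]_1[psi_of h F])%E.
  rewrite Lnorm1_psi_of.
  have i := integrable_leb_translate (X - Y) integrable_least_profile.
  have := integralZl measurableT i e; move=> /= ->.
  by have := integral_leb_translate (X - Y) (measurable_int _ integrable_least_profile); move=> /= ->.
rewrite Normc.normcM E0 mulr1 -TZ_shift => H.
have {H} := H _; rewrite Lnorm1_psi_of.
have -> : (\int[lebp]_V (least_profile V)%:E = (fine (\int[lebp]_V (least_profile V)%:E))%:E)%E.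
  by rewrite fineK//; exact: (integrable_fin_num measurableT integrable_least_profile).
rewrite -!EFinM !lee_fin => H.
set A := fine _ in H *.
have m1 : pi / (1 / h) = pi * h by field; rewrite gt_eqF.
have m2 : 4 * pi / (1 / h) = 4 * pi * h by field; rewrite gt_eqF.
have P1 : 0 < (pi * h) ^+ n by rewrite exprn_gt0// mulr_gt0// pi_gt0.
have P2 : 0 < (4 * pi * h) ^+ n by rewrite exprn_gt0// !mulr_gt0// pi_gt0.
have {}H : normc (Fext F X Y) * ((pi * h) ^+ n * (4 * pi * h) ^+ n) <= (pi * h) ^+ n * (e * A).
  apply: le_trans (_ : normc (Fext F X Y) * @gmass R n (1 / h) <= _).
    by rewrite /gmass m1 m2.
  rewrite -m1; apply: H => p; rewrite Normc.normcM EE.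
  have {}H : normc (TZ (Fext F) (p0 + p)) <=
      expR (1 / (4 * h) * sqn (p.2 + (X - Y))) * least_profile (p.2 + (X - Y)).
    have := least_profile_ub ((p0 + p).1 + 2^-1 *: (p0 + p).2) ((p0 + p).1 - 2^-1 *: (p0 + p).2).
    by rewrite half_diff [p.2 + _]addrC.
  apply: le_trans (ler_wpM2r (expR_ge0 _) (ler_wpM2r (expR_ge0 _) H)) _.
  move: (least_profile _) (least_profile_ge0 (p.2 + (X - Y))) => L L0.
  set x1 := expR _; set x2 := expR _; set x3 := expR _; set x4 := expR _.
  rewrite (_ : x1 * L * x2 * x3 = x1 * x2 * x3 * L); last by ring.
  rewrite [leRHS]mulrA; apply: ler_wpM2r => //.
  rewrite /x1 /x2 /x3 /x4 /e -!expRD ler_expR sqnD (dotvC p.2) /p0 /=.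
  by rewrite le_eqVlt; apply/orP; left; apply/eqP; field; rewrite gt_eqF.
rewrite -[leRHS]mulrA [A * e]mulrC -(ler_pM2l P2) mulVKf ?gt_eqF// mulrC.
rewrite mulrCA (ler_pM2l P1) [e * A]mulrC in H.
by apply: le_trans H; rewrite mulrC.
Qed.

(** For the points in question X - Y = (- 2 x4, 2 x2), which turns the sharp bound
    into the bound on the tube. *)
Lemma entire_extension :
  exists2 Ft : 'rV[R]_n -> 'rV[R]_n -> 'rV[R]_n -> 'rV[R]_n -> R[i],
    holomorphic_extension F Ft &
    forall x1 x2 x3 x4 : 'rV[R]_n, ((normc (Ft x1 x2 x3 x4))%:E <=
      ((4 * pi * h) ^- n)%:E * 'N[lebp]_1[psi_of h F] *
      (expR (1 / h * (sqn x2 + sqn x4)))%:E)%E.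
Proof.
have [J E _ _] := Dh_elim h0 DF.
exists (holo_of (Fext F)).
  split; first exact: holomorphic_holo_of.
  by move=> x xi; rewrite /holo_of !subr0 !addr0 E.
move=> x1 x2 x3 x4; apply: le_trans (sharp_bound _ _) _.
rewrite le_eqVlt; apply/orP; left; apply/eqP; congr (_ * (expR _)%:E)%E.
rewrite opp_row_mx add_row_mx !opprD !opprK.
have -> : x1 - x4 + (- x1 - x4) = - (2 *: x4).
  by rewrite addrACA subrr add0r -opprD scaler_nat mulr2n.
have -> : x3 + x2 + (- x3 + x2) = 2 *: x2.
  by rewrite addrACA subrr add0r scaler_nat mulr2n.
rewrite {1}/sqn dotv_row_mx -!/(sqn _) sqnN !sqnZ; field.
by rewrite gt_eqF.
Qed.

End least_profile.

(** * Extensions to a tube, and integrals against complex measures *)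

Section tube_bound.
Context {R : realType} {n : nat}.
Local Notation phase := 'rV[R]_(n + n).
Local Notation lebp := (leb (R := R) (n + n)).
Local Notation normc := (@Normc.normc R).
Local Notation re := (@complex.Re R).
Local Notation im := (@complex.Im R).

Lemma L1oo_coord_affine m (sigma tau : 'I_m -> 'I_m) (s t : 'I_m -> R) (f : 'rV[R]_m -> R) :
  cancel sigma tau -> cancel tau sigma -> (forall i, s i != 0) ->
  L1oo (leb m) f -> L1oo (leb m) (f \o coord_affine sigma s t).
Proof.
move=> sK tK s0 [fi [M fM]]; have mc := measurable_coord_affine sigma s t.
split.
  have /integrableP[mf foo] := fi; apply/integrableP; split; first exact: measurableT_comp mf mc.
  have := ge0_integral_coord_affine t sK tK s0 (measurableT_comp (@abse_measurable R setT) mf)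
    (fun v => abse_ge0 _).
  move=> /= ->; rewrite lte_mul_pinfty// ?lee_fin ?invr_ge0 ?prodr_ge0//.
exists M; have [N [mN N0 NM]] := fM; exists (coord_affine sigma s t @^-1` N); split.
- by rewrite -[X in measurable X]setTI; exact: mc.
- by have := leb_coord_affine t sK tK s0 mN; rewrite N0 mule0.
- by move=> v /= nv; apply: NM.
Qed.

Definition swap_halves (i : 'I_(n + n)) : 'I_(n + n) :=
  match fintype.split i with inl j => rshift n j | inr j => lshift n j end.

Lemma swap_halvesK : cancel swap_halves swap_halves.
Proof.
move=> i; rewrite /swap_halves -[RHS]splitK; case: (fintype.split i) => j /=.
  by rewrite (unsplitK (inr j)).
by rewrite (unsplitK (inl j)).
Qed.

Definition half_sign (i : 'I_(n + n)) : R :=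
  match fintype.split i with inl _ => 2^-1 | inr _ => - 2^-1 end.

Lemma half_rotation (Z : phase) :
  coord_affine swap_halves half_sign (fun=> 0) Z = - (2^-1 *: jrot Z).
Proof.
apply/rowP => i; rewrite !mxE addr0 /swap_halves /half_sign.
by case: (fintype.split i) => j; rewrite ?mxE ?mulrN ?mulNr ?opprK.
Qed.

Lemma L1oo_half_rotation (f : phase -> R) : L1oo lebp f ->
  L1oo lebp (fun Z => f (- (2^-1 *: jrot Z))).
Proof.
move=> lf; have := L1oo_coord_affine (fun=> 0) swap_halvesK swap_halvesK _ lf.
move=> /(_ half_sign) H.
rewrite (_ : (fun Z => _) = f \o coord_affine swap_halves half_sign (fun=> 0)).
  by apply: H => i; rewrite /half_sign; case: (fintype.split i) => _; rewrite ?oppr_eq0 invr_eq0.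
by apply/funext => Z /=; rewrite half_rotation.
Qed.

Variables (h : R) (h0 : 0 < h).

(** The extension is [sesqui_of Ft]. The argument (x2, x4) of [psi] is then minus
    half of the rotation of X - Y by a right angle, so the profile is [psi]
    after a change of variables that preserves both spaces. *)
Lemma Dh_of_tube_bound (F : phase -> R[i]) (Ft : 'rV[R]_n -> 'rV[R]_n -> 'rV[R]_n -> 'rV[R]_n -> R[i])
    (psi : phase -> R[i]) :
  holomorphic_extension F Ft -> cLfun lebp 1 psi -> cLfun lebp +oo psi ->
  (forall x1 x2 x3 x4 : 'rV[R]_n, normc (Ft x1 x2 x3 x4)
     <= normc (psi (row_mx x2 x4)) * expR (1 / h * (sqn x2 + sqn x4))) ->
  Dh h F.
Proof.
move=> [FtH FtF] [p1 p2] [q1 q2] b.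
have lr : L1oo lebp (fun Z => `|re (psi Z)|).
  by apply: (@L1oo_norm _ _ _ lebp (re \o psi)); apply/L1ooP.
have li : L1oo lebp (fun Z => `|im (psi Z)|).
  by apply: (@L1oo_norm _ _ _ lebp (im \o psi)); apply/L1ooP.
have l := L1oo_half_rotation (L1oo_linear 1 1 lr li).
suff bnd : Dh_bound h (sesqui_of Ft) (fun Z => 1 * `|re (psi (- (2^-1 *: jrot Z)))| +
    1 * `|im (psi (- (2^-1 *: jrot Z)))|).
  exact: (Dh_intro h0 (sesquiholo_sesqui_of FtH) (sesqui_of_diag FtF) bnd).1.
split; first exact: l.
move=> X Y; rewrite /sesqui_of; apply: le_trans (b _ _ _ _) _.
rewrite mulrC; set u := row_mx _ _.
have uE : u = - (2^-1 *: jrot (X - Y)).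
  rewrite /u /jrot !linearB /= scale_row_mx opp_row_mx; congr row_mx.
    by rewrite -scalerBr -[RHS]scalerN opprB opprK addrC.
  by rewrite -scalerBr -[RHS]scalerN opprB.
rewrite -uE (_ : 1 / h * _ = 1 / (4 * h) * sqn (X - Y)).
  rewrite ler_wpM2l ?expR_ge0// !mul1r; exact: normc_le_sum.
rewrite (_ : sqn _ + sqn _ = sqn u); last by rewrite /sqn dotv_row_mx.
by rewrite uE sqnN sqnZ sqn_jrot; field; rewrite gt_eqF.
Qed.

End tube_bound.

Section complex_measures.
Context {d} {T : measurableType d} {R : realType}.
Local Notation normc := (@Normc.normc R).
Local Notation re := (@complex.Re R).
Local Notation im := (@complex.Im R).

Definition bounded_measurable (f : T -> R) : Prop :=
  measurable_fun setT f /\ exists M : R, forall x, `|f x| <= M.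

Lemma integrable_bounded (m : {finite_measure set T -> \bar R}) (f : T -> R) :
  bounded_measurable f -> m.-integrable setT (EFin \o f).
Proof.
move=> [mf [M fM]]; apply: (integrable_dominated mf fM).
exact: finite_measure_integrable_cst.
Qed.

Lemma charge_integral_split (nu : {charge set T -> \bar R}) :
  exists mp mn : {finite_measure set T -> \bar R},
    (forall f, charge_integral nu f = \int[mp]_x f x - \int[mn]_x f x) /\
    (forall A, measurable A -> fine (nu A) = fine (mp A) - fine (mn A)).
Proof.
rewrite /charge_integral; case: cid => P exN; case: cid => N nuPN.
exists (jordan_pos nuPN), (jordan_neg nuPN); split=> // A mA.
rewrite [in LHS](jordan_decomp nuPN mA) /cadd /= cscaleN1 fineB ?fin_num_measure//.
Qed.

Variable nu : complex_measure T R.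

(** The four finite measures of the Jordan decompositions of the parts of [nu]. *)
Lemma complex_measure_split : exists p1 n1 p2 n2 : {finite_measure set T -> \bar R},
  (forall f, cm_integral nu f =
    ((\int[p1]_x re (f x) - \int[n1]_x re (f x)) - (\int[p2]_x im (f x) - \int[n2]_x im (f x))) +i*
    ((\int[p1]_x im (f x) - \int[n1]_x im (f x)) + (\int[p2]_x re (f x) - \int[n2]_x re (f x)))) /\
  (forall A, measurable A -> cm_val nu A =
    (fine (p1 A) - fine (n1 A)) +i* (fine (p2 A) - fine (n2 A))).
Proof.
have [p1 [n1 [I1 V1]]] := charge_integral_split (cm_re nu).
have [p2 [n2 [I2 V2]]] := charge_integral_split (cm_im nu).
exists p1, n1, p2, n2; split=> [f|A mA]; first by rewrite /cm_integral !I1 !I2.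
by rewrite /cm_val V1// V2.
Qed.

Lemma cm_integrable_bounded (f : T -> R[i]) :
  bounded_measurable (re \o f) -> bounded_measurable (im \o f) -> cm_integrable nu f.
Proof. by move=> fr fi; split=> P N nuPN; split; exact: integrable_bounded. Qed.

Lemma cm_integral_linear (c : R[i]) (f g : T -> R[i]) :
  bounded_measurable (re \o f) -> bounded_measurable (im \o f) ->
  bounded_measurable (re \o g) -> bounded_measurable (im \o g) ->
  cm_integral nu (fun x => c * f x + g x) = c * cm_integral nu f + cm_integral nu g.
Proof.
move=> fr fi gr gi; have [p1 [n1 [p2 [n2 [I _]]]]] := complex_measure_split.
have Er (m : {finite_measure set T -> \bar R}) : \int[m]_x re (c * f x + g x) =
    re c * \int[m]_x re (f x) - im c * \int[m]_x im (f x) + \int[m]_x re (g x).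
  have [_ E] := integral_combination3 (re c) (- im c) 1
    (integrable_bounded m fr) (integrable_bounded m fi) (integrable_bounded m gr).
  transitivity (\int[m]_x (re c * re (f x) + - im c * im (f x) + 1 * re (g x))).
    by apply: eq_Rintegral => x _; rewrite ReD Re_mul; ring.
  by rewrite [LHS]E /=; ring.
have Ei (m : {finite_measure set T -> \bar R}) : \int[m]_x im (c * f x + g x) =
    re c * \int[m]_x im (f x) + im c * \int[m]_x re (f x) + \int[m]_x im (g x).
  have [_ E] := integral_combination3 (re c) (im c) 1
    (integrable_bounded m fi) (integrable_bounded m fr) (integrable_bounded m gi).
  transitivity (\int[m]_x (re c * im (f x) + im c * re (f x) + 1 * im (g x))).
    by apply: eq_Rintegral => x _; rewrite ImD Im_mul; ring.
  by rewrite [LHS]E /=; ring.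
rewrite !I !Er !Ei; case: c {Er Ei} => c1 c2.
by apply/eqP; rewrite eq_complex /=; apply/andP; split; apply/eqP; ring.
Qed.

Lemma step_approximation (m : {finite_measure set T -> \bar R}) (f : T -> R)
    (K : nat) (idx : T -> nat) (s : nat -> R) (e : R) :
  bounded_measurable f -> (forall x, (idx x < K)%N) ->
  (forall k, measurable [set x | idx x = k]) ->
  (forall x, `|f x - s (idx x)| <= e) ->
  `|\int[m]_x f x - \sum_(k < K) s k * fine (m [set x | idx x = k])| <= e * fine (m setT).
Proof.
move=> fb idxK mE fs; have fi := integrable_bounded m fb.
have ik k : m.-integrable setT (EFin \o (fun x => s k * \1_[set x | idx x = k] x)).
  by apply: integrable_scaled; apply: integrable_indic => //; rewrite setIT; exact: fin_num_measure.
have sE x : s (idx x) = \sum_(k < K) s k * \1_[set y | idx y = k] x.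
  rewrite (bigD1 (Ordinal (idxK x)))//= indicE mem_set// mulr1 big1 ?addr0// => k kx.
  rewrite indicE memNset ?mulr0//= => xk; move: kx; rewrite -val_eqE /= xk.
  by rewrite eqxx.
have iS : m.-integrable setT (EFin \o (fun x => s (idx x))).
  rewrite (_ : EFin \o _ = fun x => (\sum_(k < K) (s k * \1_[set y | idx y = k] x)%:E)%E).
    by apply: integrable_sum => // k _; exact: ik.
  by apply/funext => x; rewrite sumEFin /= sE.
have <- : \int[m]_x s (idx x) = \sum_(k < K) s k * fine (m [set x | idx x = k]).
  apply: EFin_inj; rewrite -sumEFin.
  transitivity (\sum_(k < K) \int[m]_x (s k * \1_[set y | idx y = k] x)%:E)%E.
    rewrite [LHS](fineK (integrable_fin_num measurableT iS)) -integral_sum//; last by move=> k; exact: ik.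
    by apply: eq_integral => x _; rewrite sumEFin -sE.
  apply: eq_bigr => k _; under eq_integral do rewrite EFinM.
  rewrite integralZl//; last first.
    by apply: integrable_indic => //; rewrite setIT; exact: fin_num_measure.
  by rewrite integral_indic// setIT EFinM fineK// fin_num_measure.
rewrite -RintegralB//.
have iD : m.-integrable setT (EFin \o (fun x => f x - s (idx x))).
  exact: (integrableB measurableT fi iS).
apply: le_trans (le_normr_Rintegral measurableT iD) _.
apply: (@le_trans _ _ (\int[m]_x e)); last by rewrite Rintegral_cst.
apply: le_Rintegral => //; first exact: (integrable_abse iD).
exact: finite_measure_integrable_cst.
Qed.

(** The variation is at most the total mass of the four measures. *)
Lemma cm_variation_fin : cm_variation nu \is a fin_num.
Proof.
have [p1 [n1 [p2 [n2 [_ V]]]]] := complex_measure_split.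
rewrite ge0_fin_numE; last first.
  apply: le_trans (_ : 0 <= \sum_(k <oo) (normc (cm_val nu (if k is 0 then setT else set0)))%:E)%E _.
    by apply: nneseries_ge0 => k _ _; rewrite lee_fin normc_ge0.
  apply: ereal_sup_ubound; exists (fun k => if k is 0 then setT else set0) => //; split.
  - by case.
  - by move=> [|i] [|j] _ _ //= [x []].
  - by apply/seteqP; split=> // x _; exists 0%N.
pose m A := (p1 A + n1 A + (p2 A + n2 A))%E.
apply: (@le_lt_trans _ _ (m setT)); last first.
  by rewrite /m -ge0_fin_numE ?adde_ge0// !fin_numD !fin_num_measure.
apply: ub_ereal_sup => _ [E [mE tE ET] <-].
have cvg_m (q : {finite_measure set T -> \bar R}) : (\sum_(k <oo) q (E k) = q setT)%E.
  by rewrite -ET measure_bigcup//; apply: eq_eseriesl => k; rewrite in_setT.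
rewrite /m -!cvg_m -!nneseriesD//; try by move=> *; rewrite ?adde_ge0.
apply: lee_nneseries; first by move=> *; rewrite lee_fin normc_ge0.
move=> k _.
rewrite V; last exact: mE.
have fq (q : {finite_measure set T -> \bar R}) : (q (E k) = (fine (q (E k)))%:E)%E.
  by rewrite fineK// fin_num_measure.
rewrite (fq p1) (fq n1) (fq p2) (fq n2) -!EFinD lee_fin.
have q0 (q : {finite_measure set T -> \bar R}) : 0 <= fine (q (E k)) by rewrite fine_ge0.
apply: le_trans (normc_le_sum _) _ => /=; apply: lerD.
  by apply: le_trans (ler_normB _ _) _; rewrite !ger0_norm.
by apply: le_trans (ler_normB _ _) _; rewrite !ger0_norm.
Qed.

Definition finite_variation : R := fine (cm_variation nu).

Lemma finite_variationE : cm_variation nu = finite_variation%:E.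
Proof. by rewrite /finite_variation fineK// cm_variation_fin. Qed.

Lemma partition_variation_le (idx : T -> nat) K : (forall x, (idx x < K)%N) ->
  (forall k, measurable [set x | idx x = k]) ->
  \sum_(k < K) normc (cm_val nu [set x | idx x = k]) <= finite_variation.
Proof.
move=> idxK mE; rewrite -lee_fin -finite_variationE -sumEFin.
apply: le_trans (_ : _ <= \sum_(k <oo) (normc (cm_val nu [set x | idx x = k]))%:E)%E _.
  rewrite -(big_mkord xpredT (fun k => (normc (cm_val nu [set x | idx x = k]))%:E)).
  by apply: nneseries_lim_ge => k _ _; rewrite lee_fin normc_ge0.
apply: ereal_sup_ubound; exists (fun k => [set x | idx x = k]) => //; split=> //.
- by move=> i j _ _ [x [/= <- <-]].
- by apply/seteqP; split=> // x _; exists (idx x).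
Qed.

(** On the cells of a fine grid [f] is nearly constant, so its integral is
    nearly a sum over a partition, which the variation controls. *)
Theorem cm_integral_le (f : T -> R[i]) (M : R) (x0 : T) :
  measurable_fun setT (re \o f) -> measurable_fun setT (im \o f) ->
  (forall x, normc (f x) <= M) -> normc (cm_integral nu f) <= M * finite_variation.
Proof.
move=> mr mi fM; have [p1 [n1 [p2 [n2 [I V]]]]] := complex_measure_split.
have M0 : 0 <= M := le_trans (normc_ge0 _) (fM x0).
have br : bounded_measurable (re \o f).
  by split=> //; exists M => x; exact: le_trans (normr_Re_le _) (fM x).
have bi : bounded_measurable (im \o f).
  by split=> //; exists M => x; exact: le_trans (normr_Im_le _) (fM x).
pose L := fine (p1 setT) + fine (n1 setT) + fine (p2 setT) + fine (n2 setT).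
have q0 (q : {finite_measure set T -> \bar R}) A : 0 <= fine (q A) by rewrite fine_ge0.
have L0 : 0 <= L by rewrite !addr_ge0.
suff H e : 0 < e -> normc (cm_integral nu f) <= M * finite_variation + e * (2 * L).
  apply/ler_addgt0Pr => e e0; have L1 : 0 < 2 * L + 1 by rewrite ltr_wpDl ?mulr_ge0.
  apply: le_trans (H (e / (2 * L + 1)) (divr_gt0 e0 L1)) _; rewrite lerD2l.
  by rewrite mulrAC ler_pdivrMr// ler_wpM2l ?ltW// ltrDl.
move=> e0.
pose cell (k : R[i] -> R) x := Num.truncn ((k (f x) + M) / e).
pose K1 := (Num.truncn (2 * M / e)).+1.
pose idx x := (cell re x * K1 + cell im x)%N.
have cellP (k : R[i] -> R) : (forall z, `|k z| <= normc z) -> measurable_fun setT (k \o f) ->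
    [/\ forall x, (cell k x < K1)%N, forall i, measurable [set x | cell k x = i] &
      forall x y, cell k x = cell k y -> `|k (f x) - k (f y)| <= e].
  move=> kz mk; have kM x : `|k (f x)| <= M := le_trans (kz _) (fM x).
  have u0 x : 0 <= (k (f x) + M) / e.
    by rewrite divr_ge0 ?(ltW e0)//; have := kM x; rewrite ler_norml; lra.
  split=> [x|i|x y xy].
  - rewrite ltnS; apply: le_truncn; rewrite ler_pM2r ?invr_gt0//.
    by have := kM x; rewrite ler_norml; lra.
  - rewrite (_ : [set x | _] = (fun x => (k (f x) + M) / e) @^-1` `[i%:R, i.+1%:R[%classic).
      rewrite -[X in measurable X]setTI; apply: (_ : measurable_fun setT _) => //.
      by apply: measurable_funM => //; apply: measurable_funD.
    apply/seteqP; split=> x /=; rewrite in_itv /=.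
      by move=> <-; rewrite truncn_itv.
    by move=> /truncn_def.
  - have := truncn_itv (u0 x); have := truncn_itv (u0 y); rewrite -/(cell k x) -/(cell k y) -xy.
    rewrite !ler_pdivlMr// !ltr_pdivrMr// -natr1 => /andP[a1 a2] /andP[b1 b2].
    by rewrite ler_norml; apply/andP; split; move: a1 a2 b1 b2; lra.
have [cr mcr rr] := cellP re (@normr_Re_le R) mr.
have [ci mci ri] := cellP im (@normr_Im_le R) mi.
have idxD x : (idx x %/ K1 = cell re x)%N by rewrite /idx divnMDl// divn_small ?addn0.
have idxM x : (idx x %% K1 = cell im x)%N by rewrite /idx modnMDl modn_small.
have idxK x : (idx x < K1 * K1)%N.
  by rewrite -ltn_divLR// idxD.
have mE k : measurable [set x | idx x = k].
  rewrite (_ : [set x | _] = [set x | cell re x = (k %/ K1)%N] `&` [set x | cell im x = (k %% K1)%N]).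
    exact: measurableI.
  apply/seteqP; split=> x /=; first by move=> <-; rewrite idxD idxM.
  by move=> [a b]; rewrite /idx a b -divn_eq.
have [y yP] : exists y : nat -> T, forall x, idx (y (idx x)) = idx x.
  have ex k : exists y, forall x, idx x = k -> idx y = k.
    have [[x xk]|nx] := pselect (exists x, idx x = k); first by exists x.
    by exists x0 => x xk; exfalso; apply: nx; exists x.
  by have [y yP] := choice ex; exists y => x; exact: yP.
have ar m x := step_approximation m br idxK mE (s := fun k => re (f (y k))) (e := e) x.
have ai m x := step_approximation m bi idxK mE (s := fun k => im (f (y k))) (e := e) x.
have xr x : `|re (f x) - re (f (y (idx x)))| <= e by apply: rr; rewrite -!idxD yP.
have xi x : `|im (f x) - im (f (y (idx x)))| <= e by apply: ri; rewrite -!idxM yP.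
pose Sr (m : {finite_measure set T -> \bar R}) :=
  \sum_(k < K1 * K1) re (f (y k)) * fine (m [set x | idx x = k]).
pose Si (m : {finite_measure set T -> \bar R}) :=
  \sum_(k < K1 * K1) im (f (y k)) * fine (m [set x | idx x = k]).
pose S := \sum_(k < K1 * K1) f (y k) * cm_val nu [set x | idx x = k].
have SE : S = ((Sr p1 - Sr n1) - (Si p2 - Si n2)) +i* ((Si p1 - Si n1) + (Sr p2 - Sr n2)).
  rewrite /S /Sr /Si -!sumrB -big_split /=.
  transitivity (\sum_(k < K1 * K1)
   ((re (f (y k)) * fine (p1 [set x | idx x = k]) - re (f (y k)) * fine (n1 [set x | idx x = k])
    - (im (f (y k)) * fine (p2 [set x | idx x = k]) - im (f (y k)) * fine (n2 [set x | idx x = k]))) +i*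
    (im (f (y k)) * fine (p1 [set x | idx x = k]) - im (f (y k)) * fine (n1 [set x | idx x = k])
    + (re (f (y k)) * fine (p2 [set x | idx x = k]) - re (f (y k)) * fine (n2 [set x | idx x = k]))))).
    apply: eq_bigr => k _; rewrite (V _ (mE k)); case: (f (y k)) => a b.
    by apply/eqP; rewrite eq_complex /=; apply/andP; split; apply/eqP; ring.
  by elim/big_rec3: _ => // k a b z _ ->.
have S_le : normc S <= M * finite_variation.
  apply: le_trans (_ : \sum_(k < K1 * K1) M * normc (cm_val nu [set x | idx x = k]) <= _).
    rewrite /S; elim/big_rec2: _ => [|k a z _ az]; first by rewrite /= expr0n addr0 sqrtr0.
    apply: le_trans (le_normcD _ _) _; apply: lerD => //.
    by rewrite Normc.normcM ler_wpM2r ?normc_ge0.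
  by rewrite -mulr_sumr ler_wpM2l// partition_variation_le.
rewrite -[cm_integral nu f](subrK S) addrC; apply: le_trans (le_normcD _ _) _.
apply: lerD => //; apply: le_trans (normc_le_sum _) _.
have r1 := ar p1 xr; have r2 := ar n1 xr; have r3 := ar p2 xr; have r4 := ar n2 xr.
have i1 := ai p1 xi; have i2 := ai n1 xi; have i3 := ai p2 xi; have i4 := ai n2 xi.
rewrite -/(Sr _) in r1 r2 r3 r4; rewrite -/(Si _) in i1 i2 i3 i4.
rewrite SE I /= (_ : e * (2 * L) = e * L + e * L); last by ring.
have tri (a b c e' : R) : `|a - b - (c - e')| <= `|a| + `|b| + (`|c| + `|e'|).
  by apply: le_trans (ler_normB _ _) (lerD _ _); exact: ler_normB.
have Le : e * L = e * fine (p1 setT) + e * fine (n1 setT) + (e * fine (p2 setT) + e * fine (n2 setT)).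
  by rewrite /L; ring.
rewrite Le; apply: lerD.
  rewrite [X in `|X|](_ : _ = (\int[p1]_x re (f x) - Sr p1) - (\int[n1]_x re (f x) - Sr n1) -
    ((\int[p2]_x im (f x) - Si p2) - (\int[n2]_x im (f x) - Si n2))); last by ring.
  by apply: le_trans (tri _ _ _ _) _; apply: lerD; apply: lerD.
rewrite [X in `|X|](_ : _ = (\int[p1]_x im (f x) - Si p1) - (\int[n1]_x im (f x) - Si n1) -
  ((\int[n2]_x re (f x) - Sr n2) - (\int[p2]_x re (f x) - Sr p2))); last by ring.
apply: le_trans (tri _ _ _ _) _; rewrite [`|_ - Sr n2| + _]addrC.
by apply: lerD; apply: lerD.
Qed.

End complex_measures.

(** * Convolution by a complex measure *)

Section convolution.
Context {R : realType} {n : nat}.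
Local Notation phase := 'rV[R]_(n + n).
Local Notation lebp := (leb (R := R) (n + n)).
Local Notation normc := (@Normc.normc R).
Local Notation re := (@complex.Re R).
Local Notation im := (@complex.Im R).
Variables (h : R) (h0 : 0 < h) (nu : complex_measure phase R).
Implicit Types (F : phase -> R[i]) (G : phase -> phase -> R[i]).

Lemma bounded_measurable_shift G X Y (M : R) : sesquiholo G ->
  (forall s, normc (G (X - s) (Y - s)) <= M) ->
  bounded_measurable (re \o (fun s => G (X - s) (Y - s))) /\
  bounded_measurable (im \o (fun s => G (X - s) (Y - s))).
Proof.
move=> GJ GM; have [rc ic] := jholo_continuous (jholo_TZ GJ).
have E s : G (X - s) (Y - s) = TZ G (2^-1 *: (X + Y) - s, X - Y).
  have := joint_shift_both G s (row_mx X Y).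
  by rewrite /joint /shift_both /ofXY /= row_mxKl row_mxKr.
have mk (k : R[i] -> R) : continuous (k \o TZ G) ->
    measurable_fun setT (k \o (fun s => G (X - s) (Y - s))).
  move=> kc; rewrite (_ : _ \o _ = (k \o TZ G) \o (fun s => (2^-1 *: (X + Y) - s, X - Y))).
    apply: measurableT_comp; first exact: continuous_measurable_pair.
    apply/measurable_fun_pairP; split; last exact: measurable_cst.
    by apply: measurable_rV_add; [exact: measurable_cst|exact: measurable_rV_opp].
  by apply/funext => s /=; rewrite E.
split; split; [exact: mk| |exact: mk|]; exists M => s.
  exact: le_trans (normr_Re_le _) (GM s).
exact: le_trans (normr_Im_le _) (GM s).
Qed.

Lemma shift_bound G psi X Y s : Dh_bound h G psi ->
  normc (G (X - s) (Y - s)) <= expR (1 / (4 * h) * sqn (X - Y)) * psi (X - Y).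
Proof. by move=> [_ b]; have := b (X - s) (Y - s); rewrite opprB addrA subrK. Qed.

Lemma bounded_measurable_translates F X : Dh h F ->
  bounded_measurable (re \o (fun s => F (X - s))) /\
  bounded_measurable (im \o (fun s => F (X - s))).
Proof.
move=> /(Dh_elim h0)[J E _ [psi b]].
have -> : (fun s => F (X - s)) = (fun s => Fext F (X - s) (X - s)).
  by apply/funext => s; rewrite E.
by apply: (bounded_measurable_shift J) => s; exact: shift_bound b.
Qed.

Definition convolve_ext G X Y : R[i] := cm_integral nu (fun s => G (X - s) (Y - s)).

(** All the points (X - s, Y - s) have the same difference, so the integrand is
    bounded by a constant. *)
Lemma convolve_ext_le G psi X Y : sesquiholo G -> Dh_bound h G psi ->
  normc (convolve_ext G X Y) <=
    expR (1 / (4 * h) * sqn (X - Y)) * (finite_variation nu * psi (X - Y)).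
Proof.
move=> GJ b; have le s := shift_bound X Y s b.
have [[mr _] [mi _]] := bounded_measurable_shift GJ le.
have := @cm_integral_le _ _ _ nu _ _ 0 mr mi le.
by rewrite -mulrA [psi _ * _]mulrC.
Qed.

Lemma sesquiholo_convolve_ext G : sesquiholo G -> subcritical h G ->
  sesquiholo (convolve_ext G).
Proof.
move=> GJ Gs; have [p1 [n1 [p2 [n2 [I _]]]]] := complex_measure_split nu.
pose A (m : {finite_measure set phase -> \bar R}) X Y : R[i] :=
  (\int[m]_s re (G (X - s) (Y - s))) +i* (\int[m]_s im (G (X - s) (Y - s))).
have AJ m : sesquiholo (A m) := sesquiholo_average h0 GJ Gs m.
pose B1 X Y := (-1) * A n1 X Y + A p1 X Y.
pose B2 X Y := (-1) * A n2 X Y + A p2 X Y.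
have J1 : sesquiholo B1 := jholo_linear (-1) (AJ n1) (AJ p1).
have J2 : sesquiholo B2 := jholo_linear (-1) (AJ n2) (AJ p2).
rewrite (_ : convolve_ext G = fun X Y => 'i%C * B2 X Y + B1 X Y).
  exact: jholo_linear J2 J1.
apply/funext => X; apply/funext => Y; rewrite /convolve_ext I /B1 /B2 /A !mulN1r.
by apply/eqP; rewrite eq_complex /=; apply/andP; split; apply/eqP; ring.
Qed.

Lemma variation_ge0 : 0 <= finite_variation nu.
Proof.
have := @partition_variation_le _ _ _ nu (fun=> 0%N) 1 (fun=> isT).
move=> H; apply: le_trans (H _).
  by apply: sumr_ge0 => k _; exact: normc_ge0.
move=> k; case: (eqVneq 0%N k) => [<-|k0].
  by rewrite (_ : [set x | _] = setT)//; apply/seteqP; split.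
rewrite (_ : [set x | _] = set0)//; apply/seteqP; split=> // x /= /eqP.
by rewrite (negbTE k0).
Qed.

Lemma Dh_bound_convolve G psi : sesquiholo G -> Dh_bound h G psi ->
  Dh_bound h (convolve_ext G) (fun Z => finite_variation nu * psi Z).
Proof.
move=> GJ b; split; last by move=> X Y; exact: convolve_ext_le b.
by have := L1oo_linear (finite_variation nu) 0 b.1 b.1; under eq_fun do rewrite mul0r addr0.
Qed.

Lemma Dh_convolution F : Dh h F ->
  Dh h (measure_convolution nu F) /\
  Fext (measure_convolution nu F) = convolve_ext (Fext F).
Proof.
move=> /(Dh_elim h0)[J E s [psi b]].
apply: (Dh_intro h0 _ _ (Dh_bound_convolve J b)); first exact: sesquiholo_convolve_ext.
move=> X; rewrite /convolve_ext /measure_convolution; congr cm_integral.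
by apply/funext => t; rewrite E.
Qed.

Lemma convolution_linear : linear_on (@Dh R n h) (measure_convolution nu).
Proof.
move=> c F1 F2 D1 D2; have [D12 _] := Dh_linear h0 c D1 D2; split=> //.
apply/funext => X; rewrite /measure_convolution.
have [r1 i1] := bounded_measurable_translates X D1.
have [r2 i2] := bounded_measurable_translates X D2.
exact: cm_integral_linear.
Qed.

Lemma psi_of_convolution F V : Dh h F ->
  (psi_of h (measure_convolution nu F) V <= (finite_variation nu)%:E * psi_of h F V)%E.
Proof.
move=> DF; have [DC EC] := Dh_convolution DF; have [J _ _ _] := Dh_elim h0 DF.
have b : Dh_bound h (Fext F) (least_profile h F).
  split; last by move=> X Y; exact: least_profile_ub.
  split; first exact: integrable_least_profile.
  have [_ _ _ [psi bpsi]] := Dh_elim h0 DF; have [M psiM] := bpsi.1.2.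
  exists M; apply: filterS psiM => Z; apply: le_trans.
  rewrite !ger0_norm ?least_profile_ge0//; last first.
    by apply: le_trans (least_profile_ge0 h F Z) _;
      rewrite -lee_fin least_profileE// psi_of_le.
  by rewrite -lee_fin least_profileE// psi_of_le.
have := Dh_bound_convolve J b; rewrite -EC => bC.
by apply: le_trans (psi_of_le h0 V bC) _; rewrite EFinM least_profileE.
Qed.

(** Both norms are monotone in the profile, and the profile is multiplied by at
    most the variation ([psi_of_convolution]). *)
Lemma Dh_norm_convolution F : Dh h F ->
  (Dh_norm h (measure_convolution nu F) <= cm_variation nu * Dh_norm h F)%E.
Proof.
move=> DF; have [DC _] := Dh_convolution DF.
have v0 := variation_ge0.
rewrite /Dh_norm lebE finite_variationE.
rewrite ge0_muleDr ?Lnorm_ge0//; apply: leeD.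
  rewrite !Lnorm1 -ge0_integralZl//; last first.
    by apply: measurableT_comp => //; exact: measurable_psi_of.
  apply: ge0_le_integral => //.
  - by apply: measurableT_comp => //; exact: measurable_psi_of.
  - by apply: emeasurable_funM => //; apply: measurableT_comp => //; exact: measurable_psi_of.
  by move=> V _; rewrite !gee0_abs ?psi_of_ge0// psi_of_convolution.
rewrite unlock; case: ifPn => _; last by rewrite mule0.
apply/ess_sup_inf.ess_supP.
have := ess_sup_inf.ess_sup_ge lebp (abse \o psi_of h F); apply: filterS => V le.
rewrite /= gee0_abs ?psi_of_ge0//; apply: le_trans (psi_of_convolution V DF) _.
apply: lee_wpmul2l; first by rewrite lee_fin.
by apply: le_trans le; rewrite /= gee0_abs ?psi_of_ge0.
Qed.

End convolution.

Theorem theorem2p4 (R : realType) (n : nat) (h : R) (h_gt0 : 0 < h) :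
  (* (i) *)
  (forall F : 'rV[R]_(n + n) -> R[i], Dh h F ->
     (forall T : 'rV[R]_(n + n),
        cintegrable (lebesgue_rV (n + n)) (Hh_integrand h F T)) /\
     forall X : 'rV[R]_(n + n),
       cintegrable (lebesgue_rV (n + n)) (heat_integrand h F X) /\
       F X = ((pi * h) ^- n)%:C
               * cintegral (lebesgue_rV (n + n)) (heat_integrand h F X)) /\
  (* (ii) *)
  [/\ forall F : 'rV[R]_(n + n) -> R[i],
        Dh h F -> cLfun (lebesgue_rV (n + n)) +oo (Hh h F),
      linear_on (@Dh R n h) (Hh h),
      commutes_with_translations (@Dh R n h) (Hh h) &
      has_symbol (@Dh R n h) (Hh h) (fun u => (expR (h * sqn u / 4))%:C)] /\
  (* (iii) *)
  (forall F : 'rV[R]_(n + n) -> R[i], Dh h F ->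
     exists2 Ft : 'rV[R]_n -> 'rV[R]_n -> 'rV[R]_n -> 'rV[R]_n -> R[i],
       holomorphic_extension F Ft &
       forall x1 x2 x3 x4 : 'rV[R]_n,
         ((Normc.normc (Ft x1 x2 x3 x4))%:E
            <= ((4 * pi * h) ^- n)%:E
               * 'N[lebesgue_rV (n + n)]_1[psi_of h F]
               * (expR (1 / h * (sqn x2 + sqn x4)))%:E)%E) /\
  (* (iv) *)
  (forall (F : 'rV[R]_(n + n) -> R[i])
          (Ft : 'rV[R]_n -> 'rV[R]_n -> 'rV[R]_n -> 'rV[R]_n -> R[i]),
     Dh h F -> holomorphic_extension F Ft ->
     forall x xi y eta : 'rV[R]_n,
       Fext F (row_mx x xi) (row_mx y eta)
         = Ft (2^-1 *: (x + y)) (2^-1 *: (xi - eta))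
              (2^-1 *: (xi + eta)) (2^-1 *: (y - x))) /\
  (forall Ft : 'rV[R]_n -> 'rV[R]_n -> 'rV[R]_n -> 'rV[R]_n -> R[i],
     holomorphic Ft ->
     is_cC1 (joint (sesqui_of Ft)) /\ sesqui_CR (sesqui_of Ft)) /\
  (* (v) *)
  (forall (F : 'rV[R]_(n + n) -> R[i])
          (Ft : 'rV[R]_n -> 'rV[R]_n -> 'rV[R]_n -> 'rV[R]_n -> R[i])
          (psi : 'rV[R]_(n + n) -> R[i]),
     holomorphic_extension F Ft ->
     cLfun (lebesgue_rV (n + n)) 1 psi ->
     cLfun (lebesgue_rV (n + n)) +oo psi ->
     (forall x1 x2 x3 x4 : 'rV[R]_n,
        Normc.normc (Ft x1 x2 x3 x4)
          <= Normc.normc (psi (row_mx x2 x4))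
             * expR (1 / h * (sqn x2 + sqn x4))) ->
     Dh h F) /\
  (* (vi) *)
  (forall nu : complex_measure 'rV[R]_(n + n) R,
     linear_on (@Dh R n h) (measure_convolution nu) /\
     forall F : 'rV[R]_(n + n) -> R[i], Dh h F ->
       [/\ forall X : 'rV[R]_(n + n), cm_integrable nu (fun T => F (X - T)),
           Dh h (measure_convolution nu F) &
           (Dh_norm h (measure_convolution nu F)
              <= cm_variation nu * Dh_norm h F)%E]).
Proof.
rewrite !lebE; split.
  move=> F DF; split=> [T|X]; first exact: cintegrable_Hh_integrand.
  exact: Hh_heat.
split.
  split; [by move=> F DF; exact: Hh_essentially_bounded|exact: Hh_linear|
    exact: Hh_translate|exact: Hh_symbol].
split; first by move=> F DF; exact: entire_extension.
split.
  move=> F Ft DF FtF x xi y eta; rewrite (Fext_of_holomorphic h_gt0 DF FtF).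
  by rewrite /sesqui_of !row_mxKl !row_mxKr.
split; first by move=> Ft /sesquiholo_sesqui_of/sesquiholoP.
split; first by move=> F Ft psi; exact: Dh_of_tube_bound.
move=> nu; split; first exact: convolution_linear.
move=> F DF; split.
- move=> X; have [r i] := bounded_measurable_translates h_gt0 X DF.
  exact: cm_integrable_bounded.
- exact: (Dh_convolution h_gt0 nu DF).1.
- exact: Dh_norm_convolution.
Qed.
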